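(* Let $\alpha\in(0,1)$. There exists a constant $C_\alpha>0$ such that for every nonzero function $u\in (H^2_{0,rad}\cap \dot C^{\alpha})(B)$, $$\|u\|_{L^{\infty}}^2\leq\frac{1}{8\pi^2\alpha}\,\|\Delta u\|_{L^2}^2\,\log\Big(e^3+C_\alpha N_{\alpha}(u)\sqrt{\log(2e+N_{\alpha}(u))}\Big).$$ Moreover, the constant $\frac{1}{8\pi^2\alpha}$ in this inequality is sharp, i.e. for no $\lambda<\frac{1}{8\pi^2\alpha}$ does there exist a constant $C>0$ such that $\|u\|_{L^{\infty}}^2\leq\lambda\|\Delta u\|_{L^2}^2\log\big(e^3+C N_{\alpha}(u)\sqrt{\log(2e+N_{\alpha}(u))}\big)$ holds for all nonzero $u\in (H^2_{0,rad}\cap \dot C^{\alpha})(B)$.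
   Context: $B$ is the open unit ball of $\mathbb{R}^4$ centered at the origin. $H^2_0(B)$ is the closure in the Sobolev space $H^2=W^{2,2}$ of the smooth functions compactly supported in $B$, and $H^2_{0,rad}(B)$ is the space of radially symmetric functions in $H^2_0(B)$. $\dot C^\alpha$ is the homogeneous space of $\alpha$-Hölder continuous functions with seminorm $\|u\|_{\dot C^\alpha}=\sup_{x\neq y}\frac{|u(x)-u(y)|}{|x-y|^\alpha}$ (functions in $H^2_0(B)$ being extended by zero outside $B$). $N_\alpha(u):=\frac{\|u\|_{\dot C^\alpha}}{\|\Delta u\|_{L^2}}$. *)

(* Defs.v *)
From HB Require Import structures.
From mathcomp Require Import all_boot all_order all_algebra.
From mathcomp Require Import all_classical all_reals all_analysis.

Set Implicit Arguments.
Unset Strict Implicit.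
Unset Printing Implicit Defensive.
Import Order.TTheory GRing.Theory Num.Theory.
Import numFieldNormedType.Exports.

Local Open Scope classical_set_scope.
Local Open Scope ring_scope.

(* The product type carries both the normed-space structure and the product
   (Borel) sigma-algebra.  Its library norm `|x| is the max norm: it gives the
   right topology and derivatives, but the ball, radial symmetry and the Hoelder
   seminorm below need the Euclidean norm [enorm]. *)
Notation R4 R := (R * R * R * R)%type.

Definition enorm {R : realType} (x : R4 R) : R :=
  let: (x0, x1, x2, x3) := x in
  Num.sqrt (x0 ^+ 2 + x1 ^+ 2 + x2 ^+ 2 + x3 ^+ 2).

Definition unit_ball {R : realType} : set (R4 R) := [set x | enorm x < 1].

(* [measurableTypeR R] is R with its Borel sigma-algebra, on which
   [lebesgue_measure] is declared. *)
Definition lebesgue4 {R : realType} : set (R4 (measurableTypeR R)) -> \bar R :=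
  (lebesgue_measure \x lebesgue_measure \x lebesgue_measure
     \x lebesgue_measure)%E.

HB.instance Definition _ (R : realType) := Measure.on (@lebesgue4 R).

Definition basis4 {R : realType} (i : 'I_4) : R4 R :=
  ((i == 0 :> nat)%:R, (i == 1 :> nat)%:R, (i == 2 :> nat)%:R,
   (i == 3 :> nat)%:R).

(* partials [:: i; j] f = d_i (d_j f) *)
Definition partials {R : realType} (s : seq 'I_4) (f : R4 R -> R) : R4 R -> R :=
  foldr (fun i g x => 'D_(basis4 i) g x) f s.

Definition smooth {R : realType} (f : R4 R -> R) : Prop :=
  forall s : seq 'I_4, continuous (partials s f) /\
    forall i x, derivable (partials s f) x (basis4 i).

Definition test_function {R : realType} (Om : set (R4 R)) (phi : R4 R -> R) :
    Prop :=
  let supp := closure [set x | phi x != 0] in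
  [/\ smooth phi, compact supp & supp `<=` Om].

(* Restriction of f to Om by zero turns norms over Om into norms over R^4. *)
Definition L2norm {R : realType} (Om : set (R4 R)) (f : R4 R -> R) : \bar R :=
  ('N[lebesgue4]_2%:E [EFin \o (f \_ Om)])%E.

Definition Linfnorm {R : realType} (Om : set (R4 R)) (f : R4 R -> R) : \bar R :=
  ('N[lebesgue4]_+oo [EFin \o (f \_ Om)])%E.

Definition inL2 {R : realType} (Om : set (R4 R)) (f : R4 R -> R) : Prop :=
  measurable_fun Om f /\ (L2norm Om f < +oo)%E.

Definition is_weak_partial {R : realType} (Om : set (R4 R)) (s : seq 'I_4)
    (u g : R4 R -> R) : Prop :=
  inL2 Om g /\
  forall phi, test_function Om phi ->
    \int[lebesgue4]_(x in Om) (u x * partials s phi x) =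
    (-1) ^+ size s * \int[lebesgue4]_(x in Om) (g x * phi x).

(* A representative of the weak derivative; it is unique almost everywhere on an
   open Om, and is the junk value 0 when no weak derivative exists in L^2(Om). *)
Definition weak_partial {R : realType} (Om : set (R4 R)) (s : seq 'I_4)
    (u : R4 R -> R) : R4 R -> R :=
  xget 0 [set g | is_weak_partial Om s u g].

Definition inH2 {R : realType} (Om : set (R4 R)) (u : R4 R -> R) : Prop :=
  inL2 Om u /\
  forall s : seq 'I_4, (size s <= 2)%N -> exists g, is_weak_partial Om s u g.

Definition H2norm {R : realType} (Om : set (R4 R)) (u : R4 R -> R) : \bar R :=
  ((L2norm Om u ^+ 2
    + \sum_(i < 4) L2norm Om (weak_partial Om [:: i] u) ^+ 2
    + \sum_(i < 4) \sum_(j < 4) L2norm Om (weak_partial Om [:: i; j] u) ^+ 2)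
   `^ 2^-1)%E.

Definition inH20 {R : realType} (Om : set (R4 R)) (u : R4 R -> R) : Prop :=
  inH2 Om u /\
  forall eps : R, 0 < eps ->
    exists2 phi, test_function Om phi & (H2norm Om (u \- phi)%R < eps%:E)%E.

Definition laplacian {R : realType} (Om : set (R4 R)) (u : R4 R -> R) :
    R4 R -> R :=
  fun x => \sum_(i < 4) weak_partial Om [:: i; i] u x.

Definition radial {R : realType} (u : R4 R -> R) : Prop :=
  forall x y, enorm x = enorm y -> u x = u y.

Definition holder_seminorm {R : realType} (alpha : R) (u : R4 R -> R) : \bar R :=
  ereal_sup [set t | exists x y, x != y /\
    t = (`|u x - u y| / enorm (x - y) `^ alpha)%:E].

(* The space (H^2_{0,rad} /\ C^alpha)(B).  Its elements have a unique continuous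
   representative, here defined on all of R^4 by the extension by zero; the
   pointwise conditions refer to that representative. *)
Definition H20rad_holder {R : realType} (alpha : R) (u : R4 R -> R) : Prop :=
  [/\ inH20 unit_ball u,
      radial u,
      forall x, ~ unit_ball x -> u x = 0
    & (holder_seminorm alpha u < +oo)%E].

(* Both norms are finite on [H20rad_holder alpha], so [fine] loses nothing. *)
Definition Nratio {R : realType} (alpha : R) (u : R4 R -> R) : R :=
  fine (holder_seminorm alpha u) / fine (L2norm unit_ball (laplacian unit_ball u)).

Definition log_inequality {R : realType} (alpha lambda C : R) : Prop :=
  forall u : R4 R -> R, H20rad_holder alpha u -> (exists x, u x != 0) ->
    (Linfnorm unit_ball u ^+ 2 <=
     (lambda * fine (L2norm unit_ball (laplacian unit_ball u)) ^+ 2 *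
      ln (expR 3 + C * Nratio alpha u *
            Num.sqrt (ln (2 * expR 1 + Nratio alpha u))))%:E)%E.

(* Main.v *)
From HB Require Import structures.
Require Import Defs.
From mathcomp Require Import all_boot all_order all_algebra.
From mathcomp Require Import all_classical all_reals all_analysis.
From mathcomp Require Import measurable_realfun ess_sup_inf ring lra.

Set Implicit Arguments.
Unset Strict Implicit.
Unset Printing Implicit Defensive.
Import Order.TTheory GRing.Theory Num.Theory.
Import numFieldNormedType.Exports.
Local Open Scope classical_set_scope.
Local Open Scope ring_scope.

(** Both halves come from one regularised Green function.  In dimension four,
    put s = |x - z|^2 and a = eps^2.  The function
      G = 1 / (s + a) + a / (s + a)^2            ([bubble])
    satisfies Delta G = - 24 a^2 / (s + a)^4 ([laplacian_bubble]); the right-hand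
    side has total mass - 4 pi^2 and is concentrated around z at scale eps.
    Green's formula for u in H^2_0(B) ([H20_green]) then reads
      4 pi^2 u(z) = - int_B (Delta u) G + int (u(z) - u(x)) 24 a^2 / (s + a)^4.
    Cauchy-Schwarz and int_B G^2 <= 2 pi^2 log (1 / eps) + O(1) ([nL2_bubble])
    control the first integral, Hoelder continuity the second.  With
    D = ||Delta u||_2 and H the Hoelder seminorm this is [core_estimate]:
      |u(z)| <= D sqrt ((3 - log eps) / (8 pi^2)) + 3 H eps^alpha.

    Upper bound.  Let N = H / D.  Choosing eps^(-alpha) = 1 + X with
    X = N sqrt (log (2 e + N)), the square of the first term is D^2 times
    log (1 + X) / (8 pi^2 alpha) + O(1).  The factor sqrt (log (2 e + N)) is what
    keeps the cross term bounded: sqrt (log (1 + X)) is of the order of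
    sqrt (log (2 e + N)), whereas N eps^alpha is at most its inverse.  An additive
    O(1) is absorbed by the constant C inside the logarithm.  When X is small, the
    trivial bound |u| <= 2 H is below the value that e^3 guarantees
    ([log_optimisation]).

    Sharpness.  For L = log (1 / eps) the function - log (|x|^2 + a) / 2 is about
    L near the origin and at most 0 where |x|^2 >= 1 - a.  Composed with a smooth
    convex ramp it becomes a test function u ([extremal]) with ||u||_oo >= L - O(1).
    Its Laplacian is bounded pointwise by (2 + 27 delta) G, where delta controls the
    second derivative of the ramp, so D^2 <= (2 + 27 delta)^2 (2 pi^2 L + O(1)).
    Since 0 <= u <= L and u is Lipschitz with constant 1 / eps, H <= L e^(alpha L);
    and D >= 1 for large L by [core_estimate] itself.  Hence the logarithm in the
    inequality is at most (alpha + o(1)) L, and comparing L^2 with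
    lambda * 8 pi^2 L * alpha L forces lambda >= 1 / (8 pi^2 alpha)
    ([sharp_arith]).

    The Laplacian is a sum of chosen representatives of weak derivatives.  It is
    linked to classical derivatives by uniqueness of weak derivatives
    ([is_weak_partial_unique]), which rests on a fundamental lemma of the calculus
    of variations ([inL2_ae_eq0]); Green's formula in H^2_0 follows by approximation
    with test functions ([H20_ibp2]). *)

(** * Smooth functions on R^4 generated by elementary operations *)

Definition coord {R : realType} (i : 'I_4) (x : R4 R) : R :=
  match val i with
  | 0 => x.1.1.1 | 1 => x.1.1.2 | 2 => x.1.2 | _ => x.2
  end.

Lemma coord_is_linear (R : realType) i : linear (@coord R i).
Proof.
move=> k x y; rewrite /coord.
by case: i => -[|[|[|[|//]]]] //=.
Qed.

HB.instance Definition _ (R : realType) i :=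
  GRing.isLinear.Build R (R4 R) R _ (@coord R i) (@coord_is_linear R i).

Lemma coordB (R : realType) i (x y : R4 R) : coord i (x - y) = coord i x - coord i y.
Proof. by case: i => -[|[|[|[|//]]]]. Qed.

Lemma continuous_coord (R : realType) i : continuous (@coord R i).
Proof.
rewrite /coord => x; case: i => -[|[|[|[|//]]]] //= _.
- by apply: (cvg_comp (fun x : R4 R => x.1.1)); [apply: (cvg_comp fst); exact: cvg_fst|exact: cvg_fst].
- by apply: (cvg_comp (fun x : R4 R => x.1.1)); [apply: (cvg_comp fst); exact: cvg_fst|exact: cvg_snd].
- by apply: (cvg_comp fst); [exact: cvg_fst|exact: cvg_snd].
- exact: cvg_snd.
Qed.

Definition smooth1 {R : realType} (h : R -> R) : Prop :=
  forall n x, derivable (derive1n n h) x 1.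

(** A class of functions stable under directional derivatives; this makes smoothness
    in the sense of [smooth], which quantifies over all iterated partial derivatives,
    a single induction.  The cutoffs, the Green function and the extremal
    functions below all belong to it. *)
Inductive elementary {R : realType} : (R4 R -> R) -> Prop :=
| elem_cst c : elementary (fun=> c)
| elem_coord i : elementary (coord i)
| elem_add f g : elementary f -> elementary g -> elementary (fun x => f x + g x)
| elem_mul f g : elementary f -> elementary g -> elementary (fun x => f x * g x)
| elem_inv f : (forall x, 0 < f x) -> elementary f ->
    elementary (fun x => (f x)^-1)
| elem_ln f : (forall x, 0 < f x) -> elementary f ->
    elementary (fun x => ln (f x))
| elem_comp h f : smooth1 h -> elementary f -> elementary (fun x => h (f x)).

Lemma eq_elementary (R : realType) (f g : R4 R -> R) :
  elementary f -> f =1 g -> elementary g.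
Proof. by move=> + /funext <-. Qed.

Lemma derive_coord (R : realType) i (x v : R4 R) : 'D_v (coord i) x = coord i v.
Proof.
rewrite deriveE; last first.
  by apply: linear_differentiable; exact: continuous_coord.
by rewrite diff_lin//; exact: continuous_coord.
Qed.

Lemma derive_comp1 (R : realType) (h : R -> R) (f : R4 R -> R) x v :
  derivable h (f x) 1 -> differentiable f x ->
  differentiable (h \o f) x /\ 'D_v (h \o f) x = derive1 h (f x) * 'D_v f x.
Proof.
move=> /derivable1_diffP dh df.
have dhf : differentiable (h \o f) x by exact: differentiable_comp.
split=> //; rewrite !deriveE// diff_comp//= diff1E//= mulrC; congr (_ * _).
Qed.

(** Each constructor is matched by a differentiation rule (sum, product, inverse,
    chain rule) whose right-hand side stays in the class. *)
Lemma elementary_diff (R : realType) (f : R4 R -> R) : elementary f ->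
  (forall x : R4 R, differentiable f x) /\
  forall v : R4 R, elementary (fun x => 'D_v f x).
Proof.
elim=> {f}.
- move=> c; split=> [x|v]; first exact: differentiable_cst.
  apply: (@eq_elementary _ (fun=> 0)); first exact: elem_cst.
  by move=> x; rewrite derive_cst.
- move=> i; split=> [x|v].
    by apply: linear_differentiable; exact: continuous_coord.
  apply: (@eq_elementary _ (fun=> coord i v)); first exact: elem_cst.
  by move=> x; rewrite derive_coord.
- move=> f g ef [df Df] eg [dg Dg]; split=> [x|v]; first exact: differentiableD.
  apply: (@eq_elementary _ (fun x => 'D_v f x + 'D_v g x)); first exact: elem_add.
  by move=> x; rewrite deriveD//; exact: diff_derivable.
- move=> f g ef [df Df] eg [dg Dg]; split=> [x|v]; first exact: differentiableM.
  apply: (@eq_elementary _ (fun x => f x * 'D_v g x + g x * 'D_v f x)).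
    by apply: elem_add; exact: elem_mul.
  by move=> x; rewrite deriveM//; exact: diff_derivable.
- move=> f f0 ef [df Df]; split=> [x|v].
    by apply: (@differentiableV _ _ f) => //; rewrite gt_eqF.
  apply: (@eq_elementary _ (fun x => (-1) * ((f x)^-1 * ((f x)^-1 * 'D_v f x)))).
    apply: elem_mul; [exact: elem_cst|].
    by do 2! (apply: elem_mul; [exact: elem_inv|]).
  move=> x; rewrite (@deriveV _ _ f)//.
  + by rewrite /GRing.scale/= expr2 invfM mulNr mul1r mulNr mulrA.
  + by rewrite gt_eqF.
  + exact: diff_derivable.
- move=> f f0 ef [df Df].
  have dln x : derivable (@ln R) (f x) 1 by by case: (is_derive1_ln (f0 x)).
  split=> [x|v]; first by have [] := derive_comp1 0 (dln x) (df x).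
  apply: (@eq_elementary _ (fun x => (f x)^-1 * 'D_v f x)).
    by apply: elem_mul => //; exact: elem_inv.
  move=> x; have [_ /= ->] := derive_comp1 v (dln x) (df x).
  by rewrite derive1E; case: (is_derive1_ln (f0 x)) => _ ->.
- move=> h f sh ef [df Df]; split=> [x|v].
    by have [] := derive_comp1 0 (sh 0%N (f x)) (df x).
  apply: (@eq_elementary _ (fun x => derive1 h (f x) * 'D_v f x)).
    apply: elem_mul => //; apply: elem_comp => // n x.
    by rewrite -derive1Sn; exact: sh.
  by move=> x; have [_ /= ->] := derive_comp1 v (sh 0%N (f x)) (df x).
Qed.

Lemma elementary_smooth (R : realType) (f : R4 R -> R) :
  elementary f -> smooth f.
Proof.
move=> ef s.
have {ef} : elementary (partials s f).
  by elim: s => //= i s /elementary_diff[_]; exact.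
move=> /elementary_diff[df _]; split=> [x|i x].
  exact: differentiable_continuous.
exact: diff_derivable.
Qed.

(** * Functions that are flat at the origin *)

Section flat.
Context {R : realType}.

(** From y / n <= exp (y / n), raised to the power n. *)
Lemma exprn_le_expR (n : nat) (y : R) : 0 <= y -> y ^+ n <= n%:R ^+ n * expR y.
Proof.
case: n => [|n] y0; first by rewrite !expr0 mul1r -expR0 ler_expR.
have n0 : (0 : R) < n.+1%:R by rewrite ltr0n.
have -> : expR y = expR (y / n.+1%:R) ^+ n.+1.
  by rewrite -expRM_natl mulrC divfK// gt_eqF.
rewrite -exprMn lerXn2r ?nnegrE ?mulr_ge0 ?expR_ge0 ?(ltW n0)//.
rewrite -ler_pdivrMl// mulrC (le_trans _ (expR_ge1Dx _))//.
by rewrite lerDr.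
Qed.

Lemma horner_le_expR (p : {poly R}) :
  exists2 C, 0 <= C & forall y, 0 <= y -> `|p.[y]| <= C * expR y.
Proof.
exists (\sum_(i < size p) `|p`_i| * i%:R ^+ i) => [|y y0].
  by apply: sumr_ge0 => i _; rewrite mulr_ge0// exprn_ge0.
rewrite horner_coef mulr_suml (le_trans (ler_norm_sum _ _ _))//.
apply: ler_sum => i _; rewrite normrM normrX (ger0_norm y0) -mulrA.
by rewrite ler_wpM2l// exprn_le_expR.
Qed.

(** p(1/x) exp(-1/x) on the positive half-line, extended by 0.  Allowing a polynomial
    factor makes the family closed under differentiation. *)
Definition flat (p : {poly R}) (x : R) : R :=
  if 0 < x then p.[x^-1] * expR (- x^-1) else 0.

(** Quadratic decay at 0, hence differentiability there with derivative 0, for every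
    polynomial p at once. *)
Lemma flat_le (p : {poly R}) : exists2 C, 0 <= C & forall x, `|flat p x| <= C * x ^+ 2.
Proof.
have [C C0 HC] := horner_le_expR (p * 'X ^+ 2).
exists C => // x; rewrite /flat; case: ifPn => [x0|_]; last first.
  by rewrite normr0 mulr_ge0// sqr_ge0.
have xi0 : 0 <= x^-1 by rewrite invr_ge0 ltW.
have := HC _ xi0; rewrite hornerM horner_exp hornerX !normrM !(ger0_norm xi0).
rewrite (ger0_norm (expR_ge0 _)) expRN ler_pdivrMr ?expR_gt0// => H.
have -> : `|p.[x^-1]| = `|p.[x^-1]| * (x^-1 * x^-1) * x ^+ 2.
  by rewrite -expr2 exprVn -mulrA mulVf ?mulr1// expf_neq0// gt_eqF.
by rewrite [leRHS]mulrAC ler_wpM2r// sqr_ge0.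
Qed.

Lemma is_derive_flat (p : {poly R}) (x : R) :
  is_derive x 1 (flat p) (flat ((p - p^`()) * 'X ^+ 2) x).
Proof.
have [x0|x0|->] := ltgtP x 0.
- rewrite {2}/flat ltNge (ltW x0)/=.
  apply: (near_eq_is_derive (f := fun=> 0)).
  near=> y; rewrite /flat ifF//; apply/negbTE; rewrite -leNgt ltW//.
  by near: y; exact: lt_nbhsl.
- rewrite {2}/flat x0.
  apply: (near_eq_is_derive (f := fun y : R => p.[y^-1] * expR (- y^-1))).
  + near=> y; rewrite /flat ifT//.
    by near: y; exact: lt_nbhsr.
  + have xn0 : x != 0 by rewrite gt_eqF.
    have dV : is_derive x 1 (fun y : R => y^-1) (- x ^- 2).
      by have := is_deriveV xn0 (is_derive_id x 1); rewrite /GRing.scale/= mulr1.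
    have := is_deriveM (is_derive1_comp (is_derive_poly p x^-1) dV)
      (is_derive1_comp (is_derive_expR _) (is_deriveN dV)).
    move=> H; apply: (is_derive_eq H); rewrite /GRing.scale/= !hornerE.
    by rewrite -!exprVn /=; ring.
- have [C C0 HC] := flat_le p.
  have f0 q : flat q 0 = 0 by rewrite /flat ltxx.
  rewrite f0.
  have q0 : h^-1 *: (flat p (h *: (1 : R) + 0) - flat p 0) @[h --> 0^'] --> (0 : R).
    apply/cvgr0Pnorm_le => e e0; near=> h.
    have h0 : h != 0 by near: h; exact: nbhs_dnbhs_neq.
    rewrite f0 subr0 addr0 normrM normfV ler_pdivrMl ?normr_gt0//.
    rewrite (_ : h *: 1 = h); last by rewrite /GRing.scale/= mulr1.
    rewrite (le_trans (HC _))// -real_normK ?num_real// expr2 mulrCA.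
    rewrite ler_wpM2l ?normr_ge0//.
    have hC : `|h| <= e / (C + 1).
      by near: h; apply: dnbhs0_le; rewrite divr_gt0// ltr_wpDl.
    rewrite (@le_trans _ _ ((C + 1) * `|h|)) ?ler_wpM2r ?lerDl//.
    by rewrite mulrC -ler_pdivlMr ?ltr_wpDl.
  apply: DeriveDef; first by apply/cvg_ex; exists 0.
  exact/cvg_lim.
Unshelve. all: by end_near. Qed.

Lemma smooth1_flat (p : {poly R}) : smooth1 (flat p).
Proof.
move=> n; suff [q ->] : exists q, derive1n n (flat p) = flat q.
  by move=> x; case: (is_derive_flat q x).
elim: n => [|n [q IH]]; first by exists p.
exists ((q - q^`()) * 'X ^+ 2); rewrite derive1nS IH.
by apply/funext => x; rewrite derive1E; case: (is_derive_flat q x).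
Qed.

End flat.

(** * Iterated integration over R^4 *)

Notation RR R := (measurableTypeR R).
Notation M4 R := (RR R * RR R * RR R * RR R)%type.

(** The measure on R^4 is a left-nested product, so Fubini is applied through the
    measures on R^2 and R^3. *)
Definition lebesgue2 {R : realType} : set (RR R * RR R)%type -> \bar R :=
  (lebesgue_measure \x lebesgue_measure)%E.
HB.instance Definition _ (R : realType) := Measure.on (@lebesgue2 R).

Definition lebesgue3 {R : realType} : set (RR R * RR R * RR R)%type -> \bar R :=
  (lebesgue2 \x lebesgue_measure)%E.
HB.instance Definition _ (R : realType) := Measure.on (@lebesgue3 R).

(** Exhaust the product by the products of two increasing exhaustions by sets of
    finite measure. *)
Lemma prod_sigma_finite d1 d2 (T1 : measurableType d1) (T2 : measurableType d2)
    (R : realType) (m1 : {measure set T1 -> \bar R})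
    (m2 : {sigma_finite_measure set T2 -> \bar R}) :
  sigma_finite setT m1 -> sigma_finite setT (m1 \x m2)%E.
Proof.
move=> /sigma_finiteP[F [TF ndF Foo]].
have /sigma_finiteP[G [TG ndG Goo]] := sigma_finiteT m2.
exists (fun n => F n `*` G n) => [|n].
  apply/seteqP; split=> -[x y] //= _.
  have [i _ Fx] : (\bigcup_i F i) x by rewrite -TF.
  have [j _ Gy] : (\bigcup_i G i) y by rewrite -TG.
  exists (maxn i j) => //; split=> /=.
  - by apply/subsetPset: x Fx; apply/ndF/leq_maxl.
  - by apply/subsetPset: y Gy; apply/ndG/leq_maxr.
have [mF Fn] := Foo n; have [mG Gn] := Goo n.
split; first exact: measurableX.
by rewrite product_measure1E// lte_mul_pinfty// ge0_fin_numE.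
Qed.

HB.instance Definition _ (R : realType) :=
  Measure_isSigmaFinite.Build _ _ _ (@lebesgue2 R)
    (prod_sigma_finite _ (sigma_finiteT lebesgue_measure)).

HB.instance Definition _ (R : realType) :=
  Measure_isSigmaFinite.Build _ _ _ (@lebesgue3 R)
    (prod_sigma_finite _ (sigma_finiteT lebesgue2)).

Section tonelli.
Context {R : realType}.
Notation lam := (@lebesgue_measure R).
Local Open Scope ereal_scope.

Lemma tonelli4 (f : M4 R -> \bar R) :
  measurable_fun setT f -> (forall x, 0 <= f x) ->
  \int[lebesgue4]_x f x = \int[lam]_x0 \int[lam]_x1 \int[lam]_x2 \int[lam]_x3 f (x0,x1,x2,x3).
Proof.
move=> mf f0.
rewrite [LHS](@fubini_tonelli1 _ _ _ _ _ lebesgue3 lam f)//.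
have m3 := measurable_fun_fubini_tonelli_F (m2 := lam) f mf f0.
have p3 x : 0 <= fubini_F lam f x by exact: integral_ge0.
rewrite [LHS](@fubini_tonelli1 _ _ _ _ _ lebesgue2 lam _)//.
have m2 := measurable_fun_fubini_tonelli_F (m2 := lam) _ m3 p3.
have p2 x : 0 <= fubini_F lam (fubini_F lam f) x by exact: integral_ge0.
by rewrite [LHS](@fubini_tonelli1 _ _ _ _ _ lam lam _).
Qed.

End tonelli.

(** * Measurability of open sets and continuous functions *)

Section borel4.
Context {R : realType}.

Let box (x : R4 R) (r : R) : set (R4 R) :=
  ball x.1.1.1 r `*` ball x.1.1.2 r `*` ball x.1.2 r `*` ball x.2 r.

Let measurable_box x r : measurable (box x r : set (M4 R)).
Proof.
by do 3 (apply: measurableX; last exact: measurable_ball); exact: measurable_ball.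
Qed.

Let rat_ball (x r : R) : 0 < r -> exists q : rat, ball (ratr q : R) r x.
Proof.
move=> r0; have [q] := rat_in_itvoo (ltr_pwDr r0 (lexx x)).
rewrite in_itv/= => /andP[xq qx]; exists q.
by rewrite -ball_normE /ball_/= ger0_norm ?subr_ge0 ?(ltW xq)// ltrBlDl.
Qed.

(** R^4 has countably many boxes with rational centre and radius, and an open set is
    the union of those it contains. *)
Lemma open4_measurable (U : set (R4 R)) : open U -> measurable (U : set (M4 R)).
Proof.
move=> oU.
pose P (q : rat * rat * rat * rat) : R4 R :=
  (ratr q.1.1.1, ratr q.1.1.2, ratr q.1.2, ratr q.2).
pose B q (r : rat) := if pselect (box (P q) (ratr r) `<=` U) then box (P q) (ratr r) else set0.
have -> : U = \bigcup_q0 \bigcup_q1 \bigcup_q2 \bigcup_q3 \bigcup_r B (q0, q1, q2, q3) r.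
  apply/seteqP; split=> [x Ux|x [q0 _ [q1 _ [q2 _ [q3 _ [r _]]]]]]; last first.
    by rewrite /B; case: pselect => // BU /BU.
  have /nbhs_ballP[e /= e0 xeU] : nbhs x U by exact: open_nbhs_nbhs.
  have [r] := rat_in_itvoo (divr_gt0 e0 (ltr0Sn R 1)).
  rewrite in_itv/= => /andP[r0 re].
  have [q0 b0] := rat_ball x.1.1.1 r0.
  have [q1 b1] := rat_ball x.1.1.2 r0.
  have [q2 b2] := rat_ball x.1.2 r0.
  have [q3 b3] := rat_ball x.2 r0.
  exists q0 => //; exists q1 => //; exists q2 => //; exists q3 => //; exists r => //.
  rewrite /B; case: pselect => [?|[]]; first by repeat split.
  have bb (a c d : R) : ball c (ratr r) a -> ball c (ratr r) d -> ball a e d.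
    move=> /ball_sym ca cd; have := ball_triangle ca cd; apply: le_ball.
    by rewrite ltW// -mulr2n -mulr_natr -ltr_pdivlMr.
  move=> y [[[y0 y1] y2] y3]; apply: xeU.
  split; last exact: bb b3 y3.
  split; last exact: bb b2 y2.
  split; [exact: bb b0 y0|exact: bb b1 y1].
do 5 (apply: bigcupT_measurable_rat => ?).
by rewrite /B; case: pselect => ?; [exact: measurable_box|exact: measurable0].
Qed.

Lemma continuous4_measurable (f : R4 R -> R) :
  continuous f -> measurable_fun [set: M4 R] (f : M4 R -> R).
Proof.
move=> /continuousP cf; apply: (measurability _ (RGenOpens.measurableE R)).
move=> _ [_ [a [b ->] <-]]; rewrite setTI; apply: open4_measurable.
exact/cf/interval_open.
Qed.

End borel4.

(** * The integral of a partial derivative *)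

Section iterated_zero.
Context d1 d2 (T1 : measurableType d1) (T2 : measurableType d2) (R : realType).
Variables (m1 : {sigma_finite_measure set T1 -> \bar R})
  (m2 : {sigma_finite_measure set T2 -> \bar R}).
Local Open Scope ereal_scope.

Lemma integral_prod_eq0_r (F : T1 * T2 -> \bar R) :
  (m1 \x m2).-integrable setT F ->
  (forall x, \int[m2]_y F (x, y) = 0) -> \int[m1 \x m2]_z F z = 0.
Proof.
move=> iF F0; rewrite -integral12_prod_meas1//.
by rewrite /fubini_F; under eq_integral do rewrite F0; rewrite integral0.
Qed.

(** The section in the first variable is only known to be integrable for almost every
    value of the second one, which is why integrability is granted to the hypothesis. *)
Lemma integral_prod_eq0_l (F : T1 * T2 -> \bar R) :
  (m1 \x m2).-integrable setT F ->
  (forall y, m1.-integrable setT (fun x => F (x, y)) -> \int[m1]_x F (x, y) = 0) ->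
  \int[m1 \x m2]_z F z = 0.
Proof.
move=> iF F0; rewrite -integral21_prod_meas1//.
rewrite (ae_eq_integral (cst 0))//; first by rewrite integral0.
- exact: (measurable_fubini_G iF).
- by apply: filterS (ae_integrable2 iF) => y iFy _; exact: F0.
Qed.

End iterated_zero.

Section byparts.
Context {R : realType}.
Notation lam := (@lebesgue_measure R).

(** A quantitative form of compact support; on R^4 the norm is the max norm, so the
    support lies in a cube. *)
Definition vanishes_beyond (V : normedModType R) (M : R) (f : V -> R) :=
  forall x, M < `|x| -> f x = 0.

Lemma vanishes_beyond_derive (V : normedModType R) M (f : V -> R) v :
  vanishes_beyond M f -> vanishes_beyond M (fun x => 'D_v f x).
Proof.
move=> f0 x Mx; rewrite (@near_eq_derive _ _ _ _ (cst 0)) ?derive_cst//.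
near=> y; rewrite f0//; near: y.
exact: cvgr_gt (@norm_continuous _ _ x) _ Mx.
Unshelve. all: by end_near. Qed.

Lemma integral_derive_cs (g dg : R -> R) (M : R) : 0 < M ->
  (forall x : R, is_derive x 1 g (dg x)) -> continuous dg ->
  vanishes_beyond M g ->
  (\int[lam]_x (dg x)%:E = 0)%E.
Proof.
move=> M0 gdg cdg g0.
have dgE : dg = (fun x : R => 'D_(1:R) g x) by apply/funext => x; have [_ <-] := gdg x.
have dg0 x : M < `|x| -> dg x = 0.
  by rewrite dgE; exact: vanishes_beyond_derive.
have M1 : M < M + 1 by rewrite ltrDl.
have aM x : `|x| = M + 1 -> g x = 0 by move=> xM; apply: g0; rewrite xM.
have gM : g (M + 1) = 0 by apply: aM; rewrite ger0_norm// addr_ge0// ltW.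
have gN : g (- (M + 1)) = 0 by apply: aM; rewrite normrN ger0_norm// addr_ge0// ltW.
have cg : continuous g.
  move=> x; apply: differentiable_continuous; apply/derivable1_diffP.
  by case: (gdg x).
pose K : set R := `[- (M + 1), M + 1]%classic.
have -> : (fun x => (dg x)%:E) = (fun x => (dg x)%:E) \_ K.
  apply/funext => x; rewrite patchE; case: ifPn => // /negP xK.
  rewrite dg0// ltNge; apply/negP => xM; apply: xK; rewrite inE /K/= in_itv/=.
  by rewrite -ler_norml (le_trans xM)// ltW.
rewrite -integral_mkcond (@continuous_FTC2 _ _ g) ?gM ?gN ?subee//.
- by rewrite -subr_gt0 opprK addr_gt0// addr_gt0.
- exact/continuous_subspaceT.
- split => [x _||].
  + by case: (gdg x).
  + exact/cvg_at_right_filter/cg.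
  + exact/cvg_at_left_filter/cg.
- by move=> x _; rewrite derive1E dgE.
Qed.

Lemma is_derive_section (f : R4 R -> R) (y v : R4 R) (s : R) :
  derivable f (s *: v + y) v ->
  is_derive s 1 (fun s => f (s *: v + y)) ('D_v f (s *: v + y)).
Proof.
move=> df.
have E : (fun h : R => h^-1 *: (((fun s => f (s *: v + y)) \o shift s) (h *: (1:R)) - f (s *: v + y)))
   = (fun h => h^-1 *: ((f \o shift (s *: v + y)) (h *: v) - f (s *: v + y))).
  apply/funext => h /=; do 2! f_equal.
  by rewrite scalerDl addrA /GRing.scale/= mulr1.
by split; rewrite /derivable /derive E.
Qed.

Lemma ler_norm_coord (i : 'I_4) (x : R4 R) : `|coord i x| <= `|x|.
Proof.
rewrite /coord !prod_normE !le_max.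
by case: i => -[|[|[|[|//]]]] /= _; rewrite lexx ?orbT.
Qed.

Definition cube (M : R) : set (R4 R) :=
  `[- M, M]%classic `*` `[- M, M]%classic `*` `[- M, M]%classic `*` `[- M, M]%classic.

Lemma cubeP M x : cube M x <-> `|x| <= M.
Proof.
rewrite /cube !prod_normE !ge_max /= !in_itv/= -!ler_norml.
by split=> [[[[-> ->] ->] ->]//|/andP[/andP[/andP[-> ->] ->] ->]].
Qed.

Lemma measurable_cube M : measurable (cube M : set (M4 R)).
Proof. by do 3 (apply: measurableX => //). Qed.

Lemma compact_cube M : compact (cube M).
Proof. by do 3 (apply: compact_setX; last exact: segment_compact); exact: segment_compact. Qed.

Lemma lebesgue4_cube M : 0 <= M -> lebesgue4 (cube M) = ((M *+ 2) ^+ 4)%:E.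
Proof.
move=> M0; set I := `[- M, M]%classic.
have mI : measurable (I : set (RR R)) by exact: measurable_itv.
have e : lam I = (M *+ 2)%:E.
  rewrite /I lebesgue_measure_itv/= lte_fin -EFinB opprK -mulr2n.
  case: ltP => //; rewrite -subr_ge0 -opprD -mulr2n oppr_ge0 => M2.
  by congr EFin; apply/esym/eqP; rewrite eq_le M2 mulrn_wge0.
have e2 : lebesgue2 (I `*` I) = (lam I * lam I)%E by exact: product_measure1E.
have e3 : lebesgue3 (I `*` I `*` I) = (lebesgue2 (I `*` I) * lam I)%E.
  by apply: (@product_measure1E _ _ _ _ _ lebesgue2 lam) => //; exact: measurableX.
have -> : lebesgue4 (I `*` I `*` I `*` I) = (lebesgue3 (I `*` I `*` I) * lam I)%E.
  apply: (@product_measure1E _ _ _ _ _ lebesgue3 lam) => //.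
  by do 2 (apply: measurableX => //).
by rewrite e3 e2 e -!EFinM !exprSr expr0 mul1r.
Qed.

Lemma vanishing_integrable (M : R) (f : R4 R -> R) : 0 <= M -> continuous f -> vanishes_beyond M f ->
  lebesgue4.-integrable [set: M4 R] (EFin \o f).
Proof.
move=> M0 cf f0.
have -> : EFin \o f = (EFin \o f) \_ (cube M).
  apply/funext => x; rewrite patchE; case: ifPn => // /negP xK /=.
  by rewrite f0// ltNge; apply/negP => /cubeP xM; apply: xK; rewrite inE.
apply/(integrable_mkcond _ (measurable_cube M)).
apply: (measurable_bounded_integrable (measurable_cube M)).
- by rewrite [ltLHS]lebesgue4_cube// ltry.
- by apply: measurable_funTS; exact: continuous4_measurable.
- have /compact_bounded : compact (f @` cube M).
    by apply: continuous_compact; [exact: continuous_subspaceT|exact: compact_cube].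
  case=> C [Cr HC]; exists C; split=> // y Cy x xK.
  by apply: HC Cy _ _; exists x.
Qed.

Lemma affine4E (s a0 a1 a2 a3 b0 b1 b2 b3 : R) :
  s *: ((a0, a1, a2, a3) : R4 R) + (b0, b1, b2, b3) =
  (s * a0 + b0, s * a1 + b1, s * a2 + b2, s * a3 + b3).
Proof. by []. Qed.

(** By Fubini it suffices to integrate first in the direction i, where the fundamental
    theorem of calculus gives 0. *)
Lemma integral_partial_eq0 (f : R4 R -> R) (M : R) i : 0 < M ->
  vanishes_beyond M f -> (forall x, derivable f x (basis4 i)) ->
  continuous (fun x => 'D_(basis4 i) f x) ->
  (\int[lebesgue4]_x ('D_(basis4 i) f x)%:E = 0)%E.
Proof.
move=> M0 sf df cdf.
have iF := vanishing_integrable (ltW M0) cdf (@vanishes_beyond_derive _ _ _ (basis4 i) sf).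
have key (y : R4 R) : coord i y = 0 -> (\int[lam]_s ('D_(basis4 i) f (s *: basis4 i + y))%:E = 0)%E.
  move=> Hy; apply: (@integral_derive_cs (fun s => f (s *: basis4 i + y)) _ M) => //.
  - by move=> s; apply: is_derive_section.
  - move=> s; apply: (@continuous_comp _ _ _ (fun s : R => s *: basis4 i + y) (fun x => 'D_(basis4 i) f x)).
      by apply: cvgD; [apply: cvgZr_tmp|exact: cvg_cst].
    exact: cdf.
  - move=> s Ms; apply: sf; apply: lt_le_trans Ms _.
    have cs : s = coord i (s *: basis4 i + y).
      rewrite linearD linearZ/= Hy addr0 /coord /basis4.
      by case: i {df cdf iF Hy} => -[|[|[|[|//]]]] /= _; rewrite /GRing.scale/= mulr1.
    by rewrite [X in `|X| <= _]cs; exact: ler_norm_coord.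
move: iF key; rewrite -[X in EFin \o X]/(fun x => 'D_(basis4 i) f x).
set F := (fun x => 'D_(basis4 i) f x) => iF key.
have {}key y : coord i y = 0 -> (\int[lam]_s (F (s *: basis4 i + y))%:E = 0)%E := key y.
rewrite -[LHS]/(\int[lebesgue4]_x (F x)%:E)%E.
move: iF key; move: F => F; case: i {df cdf} => -[|[|[|[|//]]]] /= Hi iF key.
- apply: (@integral_prod_eq0_l _ _ _ _ _ lebesgue3 lam) => [//|x3 iF3].
  apply: (@integral_prod_eq0_l _ _ _ _ _ lebesgue2 lam (fun p => (F (p, x3))%:E)) => [|x2 iF2]; first exact: iF3.
  apply: (@integral_prod_eq0_l _ _ _ _ _ lam lam (fun p => (F (p, x2, x3))%:E)) => [|x1 _]; first exact: iF2.
  rewrite -[RHS](key (0, x1, x2, x3))//; apply: eq_integral => s _.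
  congr (EFin (F _)).
  by rewrite /basis4/= affine4E !mulr0 mulr1 !add0r addr0.
- apply: (@integral_prod_eq0_l _ _ _ _ _ lebesgue3 lam) => [//|x3 iF3].
  apply: (@integral_prod_eq0_l _ _ _ _ _ lebesgue2 lam (fun p => (F (p, x3))%:E)) => [|x2 iF2]; first exact: iF3.
  apply: (@integral_prod_eq0_r _ _ _ _ _ lam lam (fun p => (F (p, x2, x3))%:E)) => [|x0]; first exact: iF2.
  rewrite -[RHS](key (x0, 0, x2, x3))//; apply: eq_integral => s _.
  congr (EFin (F _)).
  by rewrite /basis4/= affine4E !mulr0 mulr1 !add0r addr0.
- apply: (@integral_prod_eq0_l _ _ _ _ _ lebesgue3 lam) => [//|x3 iF3].
  apply: (@integral_prod_eq0_r _ _ _ _ _ lebesgue2 lam (fun p => (F (p, x3))%:E)) => [|-[x0 x1]]; first exact: iF3.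
  rewrite -[RHS](key (x0, x1, 0, x3))//; apply: eq_integral => s _.
  congr (EFin (F _)).
  by rewrite /basis4/= affine4E !mulr0 mulr1 !add0r addr0.
- apply: (@integral_prod_eq0_r _ _ _ _ _ lebesgue3 lam) => [//|-[[x0 x1] x2]].
  rewrite -[RHS](key (x0, x1, x2, 0))//; apply: eq_integral => s _.
  congr (EFin (F _)).
  by rewrite /basis4/= affine4E !mulr0 mulr1 !add0r addr0.
Qed.

End byparts.

(** * Square-integrable functions on the unit ball *)

Definition sqnorm {R : realType} (x : R4 R) : R := \sum_(i < 4) coord i x ^+ 2.

Section ball.
Context {R : realType}.

Lemma sqnormE (x : R4 R) :
  sqnorm x = x.1.1.1 ^+ 2 + x.1.1.2 ^+ 2 + x.1.2 ^+ 2 + x.2 ^+ 2.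
Proof. by rewrite /sqnorm !big_ord_recr big_ord0 /= add0r. Qed.

Lemma enormE (x : R4 R) : enorm x = Num.sqrt (sqnorm x).
Proof. by rewrite sqnormE; case: x => [[[x0 x1] x2] x3]. Qed.

Lemma sqnorm_ge0 (x : R4 R) : 0 <= sqnorm x.
Proof. by apply: sumr_ge0 => i _; exact: sqr_ge0. Qed.

Lemma enorm_sqr (x : R4 R) : enorm x ^+ 2 = sqnorm x.
Proof. by rewrite enormE sqr_sqrtr// sqnorm_ge0. Qed.

Lemma unit_ballP (x : R4 R) : unit_ball x <-> sqnorm x < 1.
Proof. by rewrite /unit_ball/= enormE -[X in _ < X]sqrtr1 ltr_sqrt. Qed.

Lemma elementary_sum n (F : 'I_n -> R4 R -> R) :
  (forall i, elementary (F i)) -> elementary (fun x => \sum_(i < n) F i x).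
Proof.
elim: n F => [|n IH] F eF.
  by apply: (@eq_elementary _ (fun=> 0)) => [|x]; [exact: elem_cst|rewrite big_ord0].
apply: (@eq_elementary _ (fun x => \sum_(i < n) F (widen_ord (leqnSn n) i) x + F ord_max x)).
  by apply: elem_add => //; exact: IH.
by move=> x; rewrite big_ord_recr.
Qed.

Lemma elementary_sqnorm : elementary (@sqnorm R).
Proof.
by apply: elementary_sum => i; apply: (@eq_elementary _ (fun x => coord i x * coord i x));
  [apply: elem_mul; exact: elem_coord|].
Qed.

Lemma continuous_sqnorm : continuous (@sqnorm R).
Proof. by have /elementary_smooth/(_ [::])[] := elementary_sqnorm. Qed.

Lemma open_unit_ball : open (@unit_ball R).
Proof.
have -> : unit_ball = @sqnorm R @^-1` `]-oo, 1[.
  by apply/seteqP; split=> x; rewrite /= in_itv/= => /unit_ballP.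
by move/continuousP : continuous_sqnorm; apply; exact: interval_open.
Qed.

Lemma measurable_unit_ball : measurable (unit_ball : set (M4 R)).
Proof. exact: open4_measurable open_unit_ball. Qed.

Lemma norm_coord_le_enorm (i : 'I_4) (x : R4 R) : `|coord i x| <= enorm x.
Proof.
rewrite -sqrtr_sqr enormE ler_wsqrtr// /sqnorm (bigD1 i)//= lerDl.
by apply: sumr_ge0 => j _; exact: sqr_ge0.
Qed.

Lemma norm_le_enorm (x : R4 R) : `|x| <= enorm x.
Proof.
rewrite !prod_normE !ge_max; apply/andP; split; [apply/andP; split; [apply/andP; split|]|].
- exact: (norm_coord_le_enorm ord0).
- exact: (norm_coord_le_enorm (@Ordinal 4 1 isT)).
- exact: (norm_coord_le_enorm (@Ordinal 4 2 isT)).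
- exact: (norm_coord_le_enorm (@Ordinal 4 3 isT)).
Qed.

Lemma unit_ball_sub_cube : @unit_ball R `<=` cube 1.
Proof. by move=> x /ltW x1; apply/cubeP; apply: le_trans (norm_le_enorm x) x1. Qed.

Lemma lebesgue4_unit_ball_le : (lebesgue4 (@unit_ball R) <= 16%:E)%E.
Proof.
have -> : 16%:E = lebesgue4 (cube (1:R)).
  by rewrite lebesgue4_cube//; congr EFin; rewrite -natrX.
apply: le_measure; rewrite ?inE; [exact: measurable_unit_ball|exact: measurable_cube|].
exact: unit_ball_sub_cube.
Qed.

End ball.

Section L2.
Context {R : realType}.
Notation B := (@unit_ball R).
Notation mB := (@measurable_unit_ball R).
Local Notation L2 := (L2norm B).
Implicit Types f g : R4 R -> R.

(** Squares avoid the fractional power in the definition of the norm. *)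
Lemma L2norm_sqr f : (L2 f ^+ 2 = \int[lebesgue4]_(x in B) (f x ^+ 2)%:E)%E.
Proof.
have e1 : (L2 f `^ 2 = \int[lebesgue4]_x (`|(EFin \o (f \_ B)) x| `^ 2))%E.
  by apply: poweR_Lnorm; rewrite pnatr_eq0.
have e2 (y : \bar R) : (0 <= y)%E -> (y `^ 2 = y ^+ 2)%E.
  case: y => [r||//] y0; rewrite expe2; last by rewrite poweRyr ?pnatr_eq0 ?mulyy.
  by rewrite poweR_EFin powR_mulrn// expr2 EFinM.
rewrite -e2 ?e1; last exact: Lnorm_ge0.
rewrite [RHS]integral_mkcond; apply: eq_integral => x _.
rewrite /= powR_mulrn// !patchE; case: ifPn => _.
  by rewrite real_normK// num_real.
by rewrite normr0 expr0n.
Qed.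

Lemma L2norm_ge0 f : (0 <= L2 f)%E.
Proof. exact: Lnorm_ge0. Qed.

Definition nL2 f : R := fine (L2 f).

Lemma nL2_ge0 f : 0 <= nL2 f.
Proof. by rewrite fine_ge0// L2norm_ge0. Qed.

Lemma nL2E f : inL2 B f -> L2 f = (nL2 f)%:E.
Proof. by move=> [_ f2]; rewrite fineK// ge0_fin_numE// L2norm_ge0. Qed.

Lemma nL2_sqr f : inL2 B f ->
  (\int[lebesgue4]_(x in B) (f x ^+ 2)%:E = (nL2 f ^+ 2)%:E)%E.
Proof. by move=> f2; rewrite -L2norm_sqr nL2E. Qed.

Lemma measurable_sqr f : measurable_fun (B : set (M4 R)) f ->
  measurable_fun (B : set (M4 R)) (fun x => (f x ^+ 2)%:E).
Proof. by move=> mf; apply/measurable_EFinP; exact: measurable_funX. Qed.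

Lemma inL2P f : inL2 B f <-> measurable_fun (B : set (M4 R)) f /\
  (\int[lebesgue4]_(x in B) (f x ^+ 2)%:E < +oo)%E.
Proof.
split=> [f2|[mf f2]]; first by rewrite nL2_sqr// ltry; case: f2.
split=> //; rewrite ltNge leye_eq; apply/negP => /eqP fy.
by move: f2; rewrite -L2norm_sqr fy.
Qed.

(** Membership and a bound on the norm come from the same integral estimate. *)
Lemma inL2_bound f C : measurable_fun (B : set (M4 R)) f -> 0 <= C ->
  (\int[lebesgue4]_(x in B) (f x ^+ 2)%:E <= (C ^+ 2)%:E)%E ->
  inL2 B f /\ nL2 f <= C.
Proof.
move=> mf C0 fC; have f2 : inL2 B f.
  by apply/inL2P; split=> //; exact: le_lt_trans fC (ltry _).
split=> //; move: fC; rewrite nL2_sqr// lee_fin.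
by rewrite ler_pXn2r ?nnegrE ?nL2_ge0.
Qed.

Lemma ge0_le_integralB (f g : R4 R -> R) :
  measurable_fun (B : set (M4 R)) f -> measurable_fun (B : set (M4 R)) g ->
  (forall x, B x -> 0 <= f x <= g x) ->
  (\int[lebesgue4]_(x in B) (f x)%:E <= \int[lebesgue4]_(x in B) (g x)%:E)%E.
Proof.
move=> mf mg fg; apply: ge0_le_integral.
- exact: mB.
- by move=> x /fg /andP[]; rewrite lee_fin.
- exact/measurable_EFinP.
- exact/measurable_EFinP.
- by move=> x /fg /andP[]; rewrite lee_fin.
Qed.

Lemma inL2_le f g : measurable_fun (B : set (M4 R)) f -> inL2 B g ->
  (forall x, B x -> `|f x| <= `|g x|) -> inL2 B f /\ nL2 f <= nL2 g.
Proof.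
move=> mf g2 fg; apply: inL2_bound => //; first exact: nL2_ge0.
rewrite -nL2_sqr//; apply: ge0_le_integralB.
- exact: measurable_funX.
- by apply: measurable_funX; case: g2.
- move=> x Bx; rewrite sqr_ge0/= -(real_normK (num_real (f x))) -(real_normK (num_real (g x))).
  by rewrite ler_pXn2r ?nnegrE ?normr_ge0 ?fg.
Qed.

Lemma inL2D f g : inL2 B f -> inL2 B g -> inL2 B (fun x => f x + g x).
Proof.
move=> f2 g2; have [mf _] := f2; have [mg _] := g2.
have mfg : measurable_fun (B : set (M4 R)) (fun x => f x + g x).
  exact: measurable_funD.
apply/inL2P; split=> //.
apply: (@le_lt_trans _ _ (\int[lebesgue4]_(x in B) (2 * f x ^+ 2 + 2 * g x ^+ 2)%:E)%E).
  apply: ge0_le_integralB.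
  - exact: measurable_funX.
  - by apply: measurable_funD; apply: measurable_funM => //; exact: measurable_funX.
  - by move=> x _; rewrite sqr_ge0/= -subr_ge0; have := sqr_ge0 (f x - g x); nra.
under eq_integral do rewrite EFinD (EFinM 2 (f _ ^+ 2)) (EFinM 2 (g _ ^+ 2)).
rewrite ge0_integralD//; last 5 first.
- exact: mB.
- by move=> x _; rewrite -EFinM lee_fin mulr_ge0// sqr_ge0.
- by apply/measurable_EFinP; apply: measurable_funM => //; exact: measurable_funX.
- by move=> x _; rewrite -EFinM lee_fin mulr_ge0// sqr_ge0.
- by apply/measurable_EFinP; apply: measurable_funM => //; exact: measurable_funX.
rewrite !ge0_integralZl_EFin//; try exact: mB.
  by rewrite !nL2_sqr// -!EFinM -EFinD ltry.
all: try (by apply/measurable_EFinP; exact: measurable_funX).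
all: by move=> x _; rewrite lee_fin sqr_ge0.
Qed.

Lemma inL2Z f c : inL2 B f -> inL2 B (fun x => c * f x).
Proof.
move=> f2; have [mf _] := f2.
apply/inL2P; split; first exact: measurable_funM.
under eq_integral do rewrite exprMn EFinM.
rewrite ge0_integralZl_EFin//; try exact: mB.
- by rewrite nL2_sqr// -!EFinM ltry.
- by move=> x _; rewrite lee_fin sqr_ge0.
- by apply/measurable_EFinP; exact: measurable_funX.
- exact: sqr_ge0.
Qed.

Lemma inL2B f g : inL2 B f -> inL2 B g -> inL2 B (fun x => f x - g x).
Proof.
move=> f2 g2; rewrite (_ : (fun _ => _) = fun x => f x + (-1) * g x).
  by apply: inL2D => //; exact: inL2Z.
by apply/funext => x; rewrite mulN1r.
Qed.

Lemma inL2_bounded f C : measurable_fun (B : set (M4 R)) f ->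
  (forall x, B x -> `|f x| <= C) -> inL2 B f.
Proof.
move=> mf fC; apply/inL2P; split=> //.
apply: (@le_lt_trans _ _ (\int[lebesgue4]_(x in B) (cst (C ^+ 2) x)%:E)%E).
  apply: ge0_le_integralB; first exact: measurable_funX.
    exact: measurable_cst.
  move=> x Bx; rewrite sqr_ge0/= -(real_normK (num_real (f x))).
  have := fC x Bx => H; rewrite ler_pXn2r ?nnegrE//.
  exact: le_trans (normr_ge0 _) H.
rewrite [ltLHS](_ : _ = (C ^+ 2)%:E * lebesgue4 B)%E; last exact: (integral_cst lebesgue4 mB (C ^+ 2)%:E).
rewrite lte_mul_pinfty ?lee_fin ?sqr_ge0//.
exact: le_lt_trans lebesgue4_unit_ball_le (ltry _).
Qed.

Lemma inL2_continuous f : continuous f -> inL2 B f.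
Proof.
move=> cf; have /compact_bounded : compact (f @` cube 1).
  by apply: continuous_compact; [exact: continuous_subspaceT|exact: compact_cube].
case=> C [_ HC]; apply: (@inL2_bounded _ (C + 1)).
  by apply: measurable_funTS; exact: continuous4_measurable.
by move=> x /unit_ball_sub_cube xK; apply: (HC (C + 1)); [rewrite ltrDl|exists x].
Qed.

Lemma L2_CauchySchwarz f g : inL2 B f -> inL2 B g ->
  (lebesgue4.-integrable (B : set (M4 R)) (fun x => (f x * g x)%:E)) /\
  `| \int[lebesgue4]_(x in B) (f x * g x) | <= nL2 f * nL2 g.
Proof.
move=> f2 g2; have [mf _] := f2; have [mg _] := g2.
have mfg : measurable_fun (B : set (M4 R)) (fun x => (f x * g x)%:E).
  by apply/measurable_EFinP; exact: measurable_funM.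
have H : (\int[lebesgue4]_(x in B) `|(f x * g x)%:E| <= (nL2 f * nL2 g)%:E)%E.
  have mf' := (measurable_restrictT f mB).1 mf.
  have mg' := (measurable_restrictT g mB).1 mg.
  have := @hoelder _ (M4 R) _ lebesgue4 _ _ 2 2 mf' mg' _ _ _.
  rewrite -!/(L2 _) !nL2E// -EFinM Lnorm1 => /(_ _ _ _) H.
  apply: le_trans (H _ _ _); rewrite ?ltr0n//; last first.
    by lra.
  rewrite [leLHS]integral_mkcond le_eqVlt; apply/orP; left; apply/eqP; apply: eq_integral => x _.
  by rewrite /= !patchE; case: ifPn => _ //=; rewrite mulr0 normr0.
have ifg : lebesgue4.-integrable (B : set (M4 R)) (fun x => (f x * g x)%:E).
  by apply/integrableP; split=> //; exact: le_lt_trans H (ltry _).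
split=> //; apply: le_trans (le_normr_Rintegral mB ifg) _.
rewrite -lee_fin /Rintegral fineK//.
by rewrite ge0_fin_numE ?integral_ge0//; exact: le_lt_trans H (ltry _).
Qed.

End L2.

(** * Test functions and integration by parts *)

Section test_functions.
Context {R : realType}.
Notation B := (@unit_ball R).
Notation mB := (@measurable_unit_ball R).
Implicit Types f g phi psi : R4 R -> R.

Lemma partials_rcons s i phi : partials (rcons s i) phi = partials s (fun x => 'D_(basis4 i) phi x).
Proof. by rewrite /partials foldr_rcons. Qed.

Lemma smooth_partial phi i : smooth phi -> smooth (fun x => 'D_(basis4 i) phi x).
Proof. by move=> sphi s; rewrite -partials_rcons; exact: sphi. Qed.

Lemma smooth_continuous phi : smooth phi -> continuous phi.
Proof. by move=> /(_ [::])[]. Qed.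

Lemma smooth_derivable phi i x : smooth phi -> derivable phi x (basis4 i).
Proof. by move=> /(_ [::])[_]. Qed.

(** Outside the closed support the function is locally 0, hence so is its derivative:
    the support can only shrink. *)
Lemma test_function_partial phi i : test_function B phi ->
  test_function B (fun x => 'D_(basis4 i) phi x).
Proof.
move=> [sphi cphi phiB].
have sub : closure [set x | 'D_(basis4 i) phi x != 0] `<=` closure [set x | phi x != 0].
  rewrite [X in _ `<=` X](closure_id _).1; last exact: closed_closure.
  apply: closureS => x /= Dx; apply: contrapT => ncl.
  move/eqP : Dx; apply; rewrite (@near_eq_derive _ _ _ _ (cst 0)) ?derive_cst//.
  have : nbhs x (~` closure [set x | phi x != 0]).
    by apply: open_nbhs_nbhs; split=> //; exact/closed_openC/closed_closure.
  apply: filterS => y ycl; apply/eqP/negP => /negP phiy; apply: ycl.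
  exact: subset_closure.
split; [exact: smooth_partial| |exact: subset_trans phiB].
by apply: subclosed_compact cphi sub; exact: closed_closure.
Qed.

Lemma test_function_partials phi s : test_function B phi -> test_function B (partials s phi).
Proof. by elim: s => //= i s IH /IH; exact: test_function_partial. Qed.

Lemma test_function_out phi x : test_function B phi -> ~ B x -> phi x = 0.
Proof.
move=> [_ _ phiB] xB; apply/eqP/negP => /negP phix; apply/xB/phiB.
exact: subset_closure.
Qed.

Lemma vanishes_beyond_out f : (forall x, ~ B x -> f x = 0) -> vanishes_beyond 1 f.
Proof.
move=> f0 x x1; apply: f0 => /unit_ball_sub_cube /cubeP.
by rewrite leNgt x1.
Qed.

Lemma test_function_continuous phi : test_function B phi -> continuous phi.
Proof. by case=> /smooth_continuous. Qed.

(** A closed ball of radius less than 1 is compact in B, so vanishing outside it is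
    enough. *)
Lemma test_function_elementary f r : elementary f -> r < 1 ->
  (forall x, r < sqnorm x -> f x = 0) -> test_function B f.
Proof.
move=> ef r1 f0.
have cl : closed [set x : R4 R | sqnorm x <= r].
  rewrite (_ : [set x | _] = @sqnorm R @^-1` `]-oo, r]).
    apply: preimage_closed; [by move=> x _; exact: continuous_sqnorm|exact: interval_closed].
  by apply/seteqP; split=> x /=; rewrite in_itv.
have sub : closure [set x | f x != 0] `<=` [set x : R4 R | sqnorm x <= r].
  rewrite [X in _ `<=` X](closure_id _).1//; apply: closureS => x /= fx.
  by rewrite leNgt; apply/negP => /f0 fx0; rewrite fx0 eqxx in fx.
have subB : [set x : R4 R | sqnorm x <= r] `<=` B.
  by move=> x /= xr; apply/unit_ballP; exact: le_lt_trans r1.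
split.
- exact: elementary_smooth.
- apply: (@subclosed_compact _ _ (cube 1)); [exact: closed_closure|exact: compact_cube|].
  by move=> x /sub /subB /unit_ball_sub_cube.
- exact: subset_trans subB.
Qed.

Lemma integral_unit_ball f : (forall x, ~ B x -> f x = 0) ->
  \int[lebesgue4]_(x in B) f x = \int[lebesgue4]_x f x.
Proof.
move=> f0; rewrite Rintegral_mkcond; apply: eq_Rintegral => x _.
by rewrite patchE; case: ifPn => // /negP xB; rewrite f0// => Bx; apply: xB; rewrite inE.
Qed.

Lemma integration_by_parts_ball phi g i : test_function B phi ->
  continuous g -> (forall x, derivable g x (basis4 i)) ->
  continuous (fun x => 'D_(basis4 i) g x) ->
  \int[lebesgue4]_(x in B) (phi x * 'D_(basis4 i) g x) =
  - \int[lebesgue4]_(x in B) ('D_(basis4 i) phi x * g x).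
Proof.
move=> tphi cg dg cdg.
have tdphi := test_function_partial i tphi.
have [sphi _ _] := tphi.
have dphi x : derivable phi x (basis4 i) by exact: smooth_derivable.
have cphi := test_function_continuous tphi.
have cdphi := test_function_continuous tdphi.
have o1 x : ~ B x -> phi x * 'D_(basis4 i) g x = 0.
  by move=> Bx; rewrite (test_function_out tphi)// mul0r.
have o2 x : ~ B x -> 'D_(basis4 i) phi x * g x = 0.
  by move=> Bx; rewrite (test_function_out tdphi)// mul0r.
have c1 : continuous (fun x => phi x * 'D_(basis4 i) g x).
  by move=> x; apply: cvgM; [exact: cphi|exact: cdg].
have c2 : continuous (fun x => 'D_(basis4 i) phi x * g x).
  by move=> x; apply: cvgM; [exact: cdphi|exact: cg].
have i1 := vanishing_integrable ler01 c1 (vanishes_beyond_out o1).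
have i2 := vanishing_integrable ler01 c2 (vanishes_beyond_out o2).
rewrite !integral_unit_ball//; apply/eqP; rewrite -addr_eq0; apply/eqP.
rewrite -(RintegralD measurableT i1 i2).
have E x : phi x * 'D_(basis4 i) g x + 'D_(basis4 i) phi x * g x = 'D_(basis4 i) (phi * g) x.
  by rewrite deriveM//; congr (_ + _); exact: mulrC.
transitivity (fine (\int[lebesgue4]_x ('D_(basis4 i) (phi * g) x)%:E)%E).
  by congr fine; apply: eq_integral => x _; rewrite E.
rewrite -[RHS]/(fine 0%E); congr fine; apply: (@integral_partial_eq0 _ (phi * g) 1); first exact: ltr01.
- apply: vanishes_beyond_out => x Bx.
  by rewrite /GRing.mul/= (test_function_out tphi)// mul0r.
- by move=> x; exact: derivableM.
- by rewrite -(funext E) => x; apply: cvgD; [exact: c1|exact: c2].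
Qed.

(** The order of differentiation is reversed: each integration by parts takes the
    outermost derivative of the test function and makes it the innermost one. *)
Lemma test_function_weak_partial phi s : test_function B phi ->
  is_weak_partial B s phi (partials (rev s) phi).
Proof.
move=> tphi; split.
  by apply: inL2_continuous; apply: test_function_continuous; exact: test_function_partials.
move=> psi [spsi _ _]; elim: s phi tphi => [|i s IH] phi tphi.
  by rewrite expr0 mul1r.
rewrite [partials (i :: s) psi]/= integration_by_parts_ball//.
- rewrite IH; last exact: test_function_partial.
  by rewrite rev_cons partials_rcons [size (i :: s)]/= exprS mulN1r mulNr.
- by case: (spsi s).
- by move=> x; case: (spsi s).
- by case: (spsi (i :: s)).
Qed.

End test_functions.

(** * Uniqueness of weak derivatives *)

Section orthants.
Context {R : realType}.

(** Open orthants form a pi-system, and their indicators are monotone limits of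
    products of four smooth one-dimensional steps. *)
Definition orthant (b : 'I_4 -> R) : set (R4 R) := [set x | forall i, b i < coord i x].
Definition orthants : set (set (R4 R)) := [set A | exists b, A = orthant b].

Lemma orthantsI : setI_closed orthants.
Proof.
move=> _ _ [b ->] [c ->]; exists (fun i => Num.max (b i) (c i)).
apply/seteqP; split=> [x [xb xc] i|x xbc]; first by rewrite gt_max xb xc.
by split=> i; have := xbc i; rewrite gt_max => /andP[].
Qed.

(** The coordinates are measurable for the sigma-algebra generated by the orthants,
    a half-space being a countable union of orthants. *)
Lemma measurable4_orthants (A : set (M4 R)) : measurable A -> <<s orthants >> A.
Proof.
move=> mA; pose T' := g_sigma_algebraType orthants.
suff mid : measurable_fun [set: T'] (id : T' -> M4 R).
  by have := mid measurableT A mA; rewrite setTI.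
have mc i : measurable_fun [set: T'] (coord i : T' -> R).
  apply: (measurability _ (RGenOInfty.measurableE R)).
  move=> _ [_ [c ->] <-]; rewrite setTI.
  have -> : coord i @^-1` `]c, +oo[ = \bigcup_n orthant (fun j => if j == i then c else - n%:R).
    apply/seteqP; split=> [x /=|x [n _ /(_ i)]]; last first.
      by rewrite eqxx /= in_itv/= andbT.
    rewrite in_itv/= andbT => cx.
    pose n := Num.bound (`|x|).
    exists n => // j; case: eqP => [->//|_].
    rewrite ltrNl; apply: le_lt_trans (ler_norm _) _.
    rewrite normrN; apply: le_lt_trans (ler_norm_coord _ _) _.
    by rewrite /n; have := archi_boundP (normr_ge0 x).
  apply: bigcupT_measurable => n; apply: sub_sigma_algebra.
  by exists (fun j => if j == i then c else - n%:R).
apply/measurable_fun_pairP; split; last exact: (mc (@Ordinal 4 3 isT)).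
apply/measurable_fun_pairP; split; last exact: (mc (@Ordinal 4 2 isT)).
apply/measurable_fun_pairP; split; last exact: (mc (@Ordinal 4 1 isT)).
exact: (mc ord0).
Qed.

Variable f : R4 R -> R.
Hypothesis intf : lebesgue4.-integrable [set: M4 R] (EFin \o f).
Let I (phi : R4 R -> R) := (\int[lebesgue4]_x (f x * phi x)%:E)%E.

Lemma integrable_mul_le1 (phi : R4 R -> R) : measurable_fun [set: M4 R] phi ->
  (forall x, `|phi x| <= 1) -> lebesgue4.-integrable [set: M4 R] (fun x => (f x * phi x)%:E).
Proof.
move=> mphi phi1; have mf : measurable_fun [set: M4 R] f.
  by apply/measurable_EFinP; have /integrableP[] := intf.
apply: le_integrable intf => //.
  by apply/measurable_EFinP; exact: measurable_funM.
by move=> x _; rewrite lee_fin normrM ler_piMr.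
Qed.

Lemma integral_eq0_lim (phi_ : (R4 R -> R)^nat) (phi : R4 R -> R) :
  (forall n, measurable_fun [set: M4 R] (phi_ n)) ->
  (forall n x, `|phi_ n x| <= 1) ->
  (forall x, phi_ n x @[n --> \oo] --> phi x) ->
  (forall n, I (phi_ n) = 0%E) -> I phi = 0%E.
Proof.
move=> mphi phi1 cphi I0.
have mf : measurable_fun [set: M4 R] f.
  by apply/measurable_EFinP; have /integrableP[] := intf.
have : I (phi_ n) @[n --> \oo] --> I phi.
  apply: (@dominated_cvg _ _ _ lebesgue4 _ measurableT (fun n x => (f x * phi_ n x)%:E) (fun x => (f x * phi x)%:E) (fun x => `|f x|%:E)).
  - by move=> n; apply/measurable_EFinP; exact: measurable_funM.
  - move=> x _; apply/cvg_EFin; first by exact: nearW.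
    by apply: cvgM; [exact: cvg_cst|exact: cphi].
  - by [].
  - exact: integrable_abse intf.
  - by move=> n x _; rewrite lee_fin normrM ler_piMr.
rewrite (_ : (fun n => I (phi_ n)) = cst 0%E); last exact/funext.
by move=> /(cvg_lim (@ereal_hausdorff R)) <-; rewrite lim_cst.
Qed.

Hypothesis If0 : forall psi, elementary psi -> (forall x, 0 <= psi x <= 1) -> I psi = 0%E.

(** The steps exp (-1 / (n t)) on t > 0 increase to the indicator of t > 0. *)
Lemma integral_orthant_eq0 b : I (\1_(orthant b)) = 0%E.
Proof.
(* A smooth step increasing with n to the indicator of coord i x > b i. *)
pose step (n : nat) (i : 'I_4) (x : R4 R) : R := flat 1 (n.+1%:R * (coord i x - b i)).
have step01 (n : nat) (i : 'I_4) x : 0 <= step n i x <= 1.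
  rewrite /step /flat; case: ifPn => // h; last by rewrite lexx ler01.
  rewrite hornerC mul1r expR_ge0/=.
  by rewrite -[leRHS]expR0 ler_expR oppr_le0 invr_ge0 ltW.
have estep n i : elementary (step n i).
  apply: elem_comp; first exact: smooth1_flat.
  apply: elem_mul; first exact: elem_cst.
  apply: elem_add; first exact: elem_coord.
  exact: elem_cst.
pose o0 := @Ordinal 4 0 isT. pose o1 := @Ordinal 4 1 isT. pose o2 := @Ordinal 4 2 isT. pose o3 := @Ordinal 4 3 isT.
pose phi n (x : R4 R) := step n o0 x * step n o1 x * (step n o2 x * step n o3 x).
have ephi n : elementary (phi n) by do 2 (apply: elem_mul); apply: estep.
have phi01 n x : 0 <= phi n x <= 1.
  have h i : 0 <= step n i x by have /andP[] := step01 n i x.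
  have h1 i : step n i x <= 1 by have /andP[] := step01 n i x.
  by rewrite !mulr_ge0//= !mulr_ile1 ?mulr_ge0.
apply: (@integral_eq0_lim phi).
- by move=> n; apply: continuous4_measurable; apply: smooth_continuous; exact: elementary_smooth.
- by move=> n x; have /andP[h0 h1] := phi01 n x; rewrite ger0_norm.
- move=> x; have sc i : step n i x @[n --> \oo] --> (if b i < coord i x then 1 else 0 : R).
    case: ifPn => bx; last first.
      rewrite (_ : (fun n => step n i x) = cst 0); first exact: cvg_cst.
      apply/funext => n; rewrite /step /flat ifF//; apply/negbTE.
      by rewrite -leNgt pmulr_rle0// subr_le0 leNgt.
    rewrite (_ : (fun n => step n i x) = fun n => expR (- (coord i x - b i)^-1 * n.+1%:R^-1)).
      rewrite -[X in _ --> X]expR0 -[X in expR X](mulr0 (- (coord i x - b i)^-1)).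
      apply: continuous_cvg; first exact: continuous_expR.
      by apply: cvgM; [exact: cvg_cst|exact: cvg_harmonic].
    apply/funext => n; rewrite /step /flat ifT ?mulr_gt0 ?subr_gt0//.
    by rewrite hornerC mul1r invfM mulrC mulNr mulrC.
  have -> : \1_(orthant b) x = ((if b o0 < coord o0 x then 1 else 0) * (if b o1 < coord o1 x then 1 else 0)
     * ((if b o2 < coord o2 x then 1 else 0) * (if b o3 < coord o3 x then 1 else 0))) :> R.
    rewrite indicE; have [xb|xb] := pselect (orthant b x).
      by rewrite (mem_set xb) !xb !mulr1.
    rewrite (memNset xb); have /existsNP[i /negP] := xb; rewrite -leNgt leNgt.
    case: i => -[|[|[|[|//]]]] p; rewrite (bool_irrelevance p isT) => /negbTE ->;
    by rewrite ?(mul0r, mulr0).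
  by apply: cvgM; apply: cvgM; exact: sc.
- by move=> n; exact: If0.
Qed.

(** The sets over which f has integral 0 form a lambda-system containing the orthants,
    hence all Borel sets. *)
Lemma ae_eq0_of_elementary : {ae lebesgue4, forall x, f x = 0}.
Proof.
pose H : set (set (M4 R)) := [set A | measurable (A : set (M4 R)) /\ I \1_A = 0%E].
have lH : lambda_system setT H.
  split.
  - by [].
  - split=> //; rewrite -(If0 (elem_cst 1)); last by move=> _; rewrite ler01 lexx.
    by apply: eq_integral => x _; rewrite indicT.
  - move=> A C CA [mA IA] [mC IC]; split; first exact: measurableD.
    have i1 (D : set (M4 R)) : measurable D -> lebesgue4.-integrable [set: M4 R] (fun x => (f x * \1_D x)%:E).
      move=> mD; apply: integrable_mul_le1; first exact: measurable_indic.
      by move=> x; rewrite indicE; case: (_ \in _); rewrite ?normr1 ?normr0.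
    rewrite -[RHS](_ : I \1_A - I \1_C = 0)%E; last by rewrite IA IC sube0.
    rewrite -integralB_EFin//; [|exact: i1|exact: i1].
    apply: eq_integral => x _; rewrite -EFinB -mulrBr; congr (_ * _)%:E.
    rewrite !indicE in_setD; case: (boolP (x \in C)) => xC; last by rewrite andbT subr0.
    by rewrite andbF (mem_set (CA _ (set_mem xC))) subrr.
  - move=> F ndF HF; split; first by apply: bigcup_measurable => n _; case: (HF n).
    apply: (@integral_eq0_lim (fun n => \1_(F n))).
    + by move=> n; apply: measurable_indic; case: (HF n).
    + by move=> n x; rewrite indicE; case: (_ \in _); rewrite ?normr1 ?normr0.
    + move=> x; have [[N _ FNx]|nF] := pselect ((\bigcup_n F n) x).
        rewrite [X in _ --> X](_ : _ = 1); last by rewrite indicE mem_set//; exists N.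
        apply: cvg_near_cst; exists N => // n /= Nn; rewrite indicE mem_set//.
        by have /subsetPset := ndF _ _ Nn; exact.
      rewrite [X in _ --> X](_ : _ = 0); last by rewrite indicE memNset.
      apply: cvg_near_cst; apply: nearW => n; rewrite indicE memNset// => Fnx.
      by apply: nF; exists n.
    + by move=> n; case: (HF n).
have sub : <<s orthants >> `<=` H.
  apply: (lambda_system_subset orthantsI lH) => // _ [b ->].
  split; last exact: integral_orthant_eq0.
  have -> : orthant b = \bigcap_i (coord i @^-1` `]b i, +oo[).
    by apply/seteqP; split=> x => [xb i _|xb i]; have := xb i; rewrite /= in_itv/= andbT => h; apply: h.
  apply: fin_bigcap_measurable => [|i _]; first exact: finite_finset.
  rewrite -[X in measurable X]setTI.
  by apply: continuous4_measurable; [exact: continuous_coord| | exact: measurable_itv].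
have H0 (A : set (M4 R)) : measurable A -> (\int[lebesgue4]_(x in A) (f x)%:E = 0)%E.
  move=> /measurable4_orthants /sub[_ <-]; rewrite integral_mkcond; apply: eq_integral => x _.
  by rewrite patchE indicE; case: ifPn => _; rewrite ?mulr1 ?mulr0.
have : ae_eq lebesgue4 [set: M4 R] (EFin \o f) (cst 0%E).
  apply: integral_ae_eq => //= A _ mA; rewrite H0// integral0_eq//.
by apply: filterS => x fx; apply: EFin_inj; exact: (fx Logic.I).
Qed.

End orthants.

Section uniqueness.
Context {R : realType}.
Notation B := (@unit_ball R).
Notation mB := (@measurable_unit_ball R).

(** The fundamental lemma of the calculus of variations.  Multiplying by the cutoff
    [chi n], positive exactly on a ball of radius less than 1, turns any elementary
    function into a test function; the cutoffs exhaust B. *)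
Lemma inL2_ae_eq0 (h : R4 R -> R) : inL2 B h ->
  (forall psi, test_function B psi -> \int[lebesgue4]_(x in B) (h x * psi x) = 0) ->
  {ae lebesgue4, forall x, B x -> h x = 0}.
Proof.
move=> h2 h0; have [mh _] := h2.
pose chi (n : nat) (x : R4 R) : R := flat 1 (1 - n.+1%:R^-1 - sqnorm x).
have echi n : elementary (chi n).
  apply: elem_comp; first exact: smooth1_flat.
  apply: (@eq_elementary _ (fun x => (1 - n.+1%:R^-1) + (-1) * sqnorm x)).
    apply: elem_add; first exact: elem_cst.
    apply: elem_mul; [exact: elem_cst|exact: elementary_sqnorm].
  by move=> x; rewrite mulN1r.
have aen n : {ae lebesgue4, forall x, ((fun x => h x * chi n x) \_ B) x = 0}.
  have i1 psi : elementary psi ->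
      lebesgue4.-integrable (B : set (M4 R)) (fun x => (h x * (chi n x * psi x))%:E).
    move=> epsi; apply: (L2_CauchySchwarz h2 _).1.
    apply/inL2_continuous/smooth_continuous/elementary_smooth.
    exact: elem_mul.
  apply: ae_eq0_of_elementary => [|psi epsi _].
    rewrite -restrict_EFin; apply/(integrable_mkcond _ mB).
    have := i1 _ (elem_cst 1).
    by apply: eq_integrable; [exact: mB|move=> x _; rewrite mulr1].
  transitivity (\int[lebesgue4]_(x in B) (h x * (chi n x * psi x))%:E)%E.
    rewrite [RHS]integral_mkcond; apply: eq_integral => x _.
    by rewrite !patchE; case: ifPn => _; rewrite ?mul0r// mulrA.
  rewrite -[LHS]fineK; last by apply: integrable_fin_num; [exact: mB|exact: i1].
  congr EFin; apply: (h0 (fun x => chi n x * psi x)).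
  apply: (@test_function_elementary _ _ (1 - n.+1%:R^-1)).
  - exact: elem_mul.
  - by rewrite ltrBlDr ltrDl invr_gt0.
  - by move=> x xn; rewrite /chi /flat ifF ?mul0r//; apply/negbTE; rewrite -leNgt subr_le0 ltW.
apply: filterS (ae_foralln aen) => x hx Bx.
have x1 : 0 < 1 - sqnorm x by rewrite subr_gt0; apply/unit_ballP.
have [n _ nx] : exists2 n, True & n.+1%:R^-1 < 1 - sqnorm x.
  have [N _ HN] := near_infty_natSinv_lt (PosNum x1).
  by exists N => //; exact: (HN N (leqnn N)).
have := hx n; rewrite patchE mem_set// => /eqP; rewrite mulf_eq0 => /orP[/eqP//|].
rewrite /chi /flat ifT; last by rewrite addrAC subr_gt0.
by rewrite hornerC mul1r gt_eqF// expR_gt0.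
Qed.

Lemma nL2_ae_eq0 (h : R4 R -> R) : inL2 B h ->
  {ae lebesgue4, forall x, B x -> h x = 0} -> nL2 h = 0.
Proof.
move=> h2 h0; apply/eqP; rewrite -sqrf_eq0 -eqe -nL2_sqr//; apply/eqP.
rewrite -[RHS](integral0 lebesgue4 B); apply: ae_eq_integral => //; first exact: mB.
- by apply: measurable_sqr; case: h2.
- by move: h0; apply: (@filterS _ _ (ae_filter_ringOfSetsType lebesgue4)) => x hx Bx; rewrite hx// expr0n.
Qed.

Lemma is_weak_partial_unique s (u g1 g2 : R4 R -> R) :
  is_weak_partial B s u g1 -> is_weak_partial B s u g2 ->
  {ae lebesgue4, forall x, B x -> g1 x = g2 x}.
Proof.
move=> [g12 H1] [g22 H2].
have : {ae lebesgue4, forall x, B x -> (fun x => g1 x - g2 x) x = 0}.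
  apply: inL2_ae_eq0; first exact: inL2B.
  move=> psi tpsi.
  have psi2 : inL2 B psi by apply: inL2_continuous; exact: test_function_continuous.
  have E : \int[lebesgue4]_(x in B) (g1 x * psi x) = \int[lebesgue4]_(x in B) (g2 x * psi x).
    have := H1 _ tpsi; rewrite H2// => /esym; apply: mulfI.
    by rewrite signr_eq0.
  rewrite -[RHS](subrr (\int[lebesgue4]_(x in B) (g1 x * psi x))) [in X in _ - X]E.
  rewrite -RintegralB; [|exact: mB|exact: (L2_CauchySchwarz g12 psi2).1|exact: (L2_CauchySchwarz g22 psi2).1].
  by apply: eq_Rintegral => x _; rewrite mulrBl.
by apply: (@filterS _ _ (ae_filter_ringOfSetsType lebesgue4)) => x hx Bx; apply/eqP; rewrite -subr_eq0 hx.
Qed.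

End uniqueness.

(** * Integration by parts in H^2_0 *)

Section weak.
Context {R : realType}.
Notation B := (@unit_ball R).
Notation mB := (@measurable_unit_ball R).
Implicit Types u v f g phi psi : R4 R -> R.

Lemma RintegralB_L2 f1 f2 g : inL2 B f1 -> inL2 B f2 -> inL2 B g ->
  \int[lebesgue4]_(x in B) ((f1 x - f2 x) * g x) =
  \int[lebesgue4]_(x in B) (f1 x * g x) - \int[lebesgue4]_(x in B) (f2 x * g x).
Proof.
move=> f12 f22 g2; rewrite -RintegralB; [|exact: mB|exact: (L2_CauchySchwarz f12 g2).1|exact: (L2_CauchySchwarz f22 g2).1].
by apply: eq_Rintegral => x _; rewrite mulrBl.
Qed.

Lemma eq_ae_RintegralM f1 f2 g : inL2 B f1 -> inL2 B f2 -> inL2 B g ->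
  {ae lebesgue4, forall x, B x -> f1 x = f2 x} ->
  \int[lebesgue4]_(x in B) (f1 x * g x) = \int[lebesgue4]_(x in B) (f2 x * g x).
Proof.
move=> f12 f22 g2 f12E; congr fine; apply: ae_eq_integral => //; first exact: mB.
- by case/integrableP: (L2_CauchySchwarz f12 g2).1.
- by case/integrableP: (L2_CauchySchwarz f22 g2).1.
- by move: f12E; apply: (@filterS _ _ (ae_filter_ringOfSetsType lebesgue4)) => x hx Bx; rewrite hx.
Qed.

Lemma test_function_inL2 phi : test_function B phi -> inL2 B phi.
Proof. by move=> tphi; apply: inL2_continuous; exact: test_function_continuous. Qed.

Lemma weak_partialP s u : (exists g, is_weak_partial B s u g) ->
  is_weak_partial B s u (weak_partial B s u).
Proof. by move=> ug; exact: (xgetPex 0 ug). Qed.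

Lemma is_weak_partialB s u v g1 g2 : inL2 B u -> inL2 B v ->
  is_weak_partial B s u g1 -> is_weak_partial B s v g2 ->
  is_weak_partial B s (u \- v) (fun x => g1 x - g2 x).
Proof.
move=> u2 v2 [g12 H1] [g22 H2]; split; first exact: inL2B.
move=> psi tpsi; have psi2 := test_function_inL2 tpsi.
have dpsi2 := test_function_inL2 (test_function_partials s tpsi).
rewrite !RintegralB_L2//.
by rewrite H1// H2// mulrBr.
Qed.

Lemma poweR_half_lt (y : \bar R) (e : R) : 0 < e -> (0 <= y)%E ->
  (y `^ 2^-1 < e%:E)%E -> (y <= (e ^+ 2)%:E)%E.
Proof.
move=> e0; case: y => [r| |]; rewrite ?leNye//; last first.
  by rewrite poweRyr ?invr_neq0 ?pnatr_eq0.
rewrite lee_fin => r0; rewrite poweR_EFin lte_fin => H.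
rewrite lee_fin -[leLHS](sqr_sqrtr r0) lerXn2r// ?nnegrE ?sqrtr_ge0 ?(ltW e0)//.
by rewrite -powR12_sqrt// ltW.
Qed.

Lemma H2norm_lt v (e : R) : 0 < e -> (H2norm B v < e%:E)%E ->
  (L2norm B v ^+ 2 <= (e ^+ 2)%:E)%E /\
  forall i j, (L2norm B (weak_partial B [:: i; j] v) ^+ 2 <= (e ^+ 2)%:E)%E.
Proof.
have s0 w : (0 <= L2norm B w ^+ 2)%E by rewrite expe_ge0 ?L2norm_ge0.
move=> e0; set A := (L2norm B v ^+ 2)%E.
rewrite /H2norm -/A; set P := (\sum_(i < 4) _)%E; set Q := (\sum_(i < 4) _)%E.
have A0 : (0 <= A)%E by exact: s0.
have P0 : (0 <= P)%E by apply: sume_ge0.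
have Q0 : (0 <= Q)%E by apply: sume_ge0 => i _; apply: sume_ge0.
move=> /poweR_half_lt -/(_ e0) H.
have {}H : (A + P + Q <= (e ^+ 2)%:E)%E by apply: H; rewrite !adde_ge0.
split; first by apply: le_trans H; rewrite -addeA leeDl// adde_ge0.
move=> i j; apply: le_trans H; apply: (@le_trans _ _ Q); last by rewrite leeDr//; exact: adde_ge0.
have le1 (F : 'I_4 -> \bar R) k : (forall l, 0 <= F l)%E -> (F k <= \sum_(l < 4) F l)%E.
  by move=> F0; rewrite (bigD1 k)// leeDl// sume_ge0.
apply: le_trans (le1 (fun i => \sum_(j < 4) L2norm B (weak_partial B [:: i; j] v) ^+ 2)%E i _).
  by apply: (le1 (fun j => L2norm B (weak_partial B [:: i; j] v) ^+ 2)%E).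
by move=> k; apply: sume_ge0.
Qed.

Lemma test_function_ibp2 phi g i : test_function B phi -> smooth g ->
  \int[lebesgue4]_(x in B) (phi x * partials [:: i; i] g x) =
  \int[lebesgue4]_(x in B) (partials [:: i; i] phi x * g x).
Proof.
move=> tphi sg.
rewrite [partials [:: i; i] g]/= (integration_by_parts_ball (g := partials [:: i] g))//; last 3 first.
- by case: (sg [:: i]).
- by move=> x; case: (sg [:: i]).
- by case: (sg [:: i; i]).
rewrite (integration_by_parts_ball (g := partials [::] g))//; last 4 first.
- exact: test_function_partial.
- by case: (sg [::]).
- by move=> x; case: (sg [::]).
- by case: (sg [:: i]).
by rewrite opprK.
Qed.

(** Both sides are continuous in u for the H^2 norm, by Cauchy-Schwarz, and agree on
    test functions.  Uniqueness of weak derivatives identifies the representative chosen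
    for u - phi with the difference of those of u and phi. *)
Lemma H20_ibp2 u g i : inH20 B u -> smooth g ->
  \int[lebesgue4]_(x in B) (u x * partials [:: i; i] g x) =
  \int[lebesgue4]_(x in B) (weak_partial B [:: i; i] u x * g x).
Proof.
move=> [[u2 wu] du] sg.
set s := [:: i; i]; have wpu := weak_partialP (wu s isT).
have g2 : inL2 B g by apply/inL2_continuous/smooth_continuous.
have dg2 : inL2 B (partials s g) by apply/inL2_continuous; case: (sg s).
apply/eqP; rewrite -subr_eq0 -normr_eq0; apply/eqP/le_anti; rewrite normr_ge0 andbT.
set K := nL2 (partials s g) + nL2 g.
have K0 : 0 <= K by rewrite addr_ge0// nL2_ge0.
apply/ler_addgt0Pr => e e0; rewrite add0r.
have eK : 0 < e / (K + 1) by rewrite divr_gt0// ltr_wpDl.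
have [phi tphi /(H2norm_lt eK)[v_small /(_ i i) w_small]] := du _ eK.
have phi2 := test_function_inL2 tphi.
have v2 : inL2 B (u \- phi) by exact: inL2B.
have wpphi := test_function_weak_partial s tphi.
have wv := is_weak_partialB u2 phi2 wpu wpphi.
have wpv := weak_partialP (ex_intro _ _ wv).
have aeE := is_weak_partial_unique wpv wv.
have nle f : inL2 B f -> (L2norm B f ^+ 2 <= ((e / (K + 1)) ^+ 2)%:E)%E -> nL2 f <= e / (K + 1).
  move=> f2; rewrite nL2E// expe2 -EFinM lee_fin -expr2 => H.
  by rewrite -(@ler_pXn2r _ 2)// nnegrE ?nL2_ge0// ltW.
have {}v_small := nle _ v2 v_small.
have {}w_small := nle _ wpv.1 w_small.
have -> : \int[lebesgue4]_(x in B) (u x * partials s g x) -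
   \int[lebesgue4]_(x in B) (weak_partial B s u x * g x) =
   \int[lebesgue4]_(x in B) ((u \- phi) x * partials s g x) -
   \int[lebesgue4]_(x in B) (weak_partial B s (u \- phi) x * g x).
  rewrite [X in _ = _ - X](eq_ae_RintegralM wpv.1 wv.1 g2 aeE).
  have -> : \int[lebesgue4]_(x in B) ((u \- phi) x * partials s g x) =
      \int[lebesgue4]_(x in B) (u x * partials s g x) -
      \int[lebesgue4]_(x in B) (partials s phi x * g x).
    by rewrite -(test_function_ibp2 i tphi sg); exact: RintegralB_L2.
  by rewrite (RintegralB_L2 wpu.1 wpphi.1 g2) opprB addrA subrK.
apply: le_trans (ler_normB _ _) _.
have := (L2_CauchySchwarz v2 dg2).2; have := (L2_CauchySchwarz wpv.1 g2).2.
move=> H1 H2; apply: le_trans (lerD H2 H1) _.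
apply: (@le_trans _ _ (e / (K + 1) * K)); last first.
  rewrite mulrAC ler_pdivrMr ?ltr_wpDl// ler_wpM2l ?(ltW e0)// lerDl//.
by rewrite /K mulrDr lerD// ler_wpM2r// nL2_ge0.
Qed.

End weak.

(** * Gaussian and gamma integrals *)

Section gaussian.
Context {R : realType}.
Notation lam := (@lebesgue_measure R).

(** The normal density of mean m and variance 1 / (2 t) has total mass 1. *)
Lemma integral_gauss1 (t m : R) : 0 < t ->
  (\int[lam]_x (expR (- (t * (x - m) ^+ 2)))%:E = (Num.sqrt (pi / t))%:E)%E.
Proof.
move=> t0; set s : R := Num.sqrt ((2 * t)^-1).
have s2 : s ^+ 2 *+ 2 = t^-1.
  by rewrite /s sqr_sqrtr ?invr_ge0 ?mulr_ge0 ?(ltW t0)// invfM -mulrnAl -[_ *+ 2]mulr_natl mulfV// mul1r.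
have sN0 : s != 0.
  by rewrite gt_eqF// /s sqrtr_gt0 invr_gt0 mulr_gt0.
have p0 : 0 < Num.sqrt (pi / t) by rewrite sqrtr_gt0 divr_gt0// pi_gt0.
have pk : normal_peak s = (Num.sqrt (pi / t))^-1.
  by rewrite /normal_peak -mulrnAl s2 mulrC.
have := integral_normal_pdf m s.
have -> : (fun x => (normal_pdf m s x)%:E) =
   (fun x => ((Num.sqrt (pi / t))^-1)%:E * (expR (- (t * (x - m) ^+ 2)))%:E)%E.
  apply/funext => x; rewrite normal_pdfE// pk /normal_fun s2 invrK -EFinM.
  by congr (_ * expR _)%:E; rewrite mulNr mulrC.
have mg : measurable_fun [set: RR R] (fun x => (expR (- (t * (x - m) ^+ 2)))%:E).
  apply/measurable_EFinP; apply: measurableT_comp => //.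
  apply: continuous_measurable_fun => y; apply: cvgN; apply: cvgM; first exact: cvg_cst.
  by apply: cvgM; (apply: cvgB; [exact: cvg_id|exact: cvg_cst]).
have g0 (x : R) : [set: R] x -> (0 <= (expR (- (t * (x - m) ^+ 2)))%:E)%E.
  by move=> _; rewrite lee_fin expR_ge0.
have ip0 : 0 <= (Num.sqrt (pi / t))^-1 by rewrite invr_ge0 ltW.
rewrite (ge0_integralZl_EFin lam measurableT g0 mg ip0).
set I := (\int[lam]_x _)%E => H.
rewrite -[LHS]mul1e -(divff (lt0r_neq0 p0)) EFinM -muleA H mule1//.
Qed.

Lemma gamma_cvg (c : R) k : 0 < c -> (t ^+ k * expR (- (c * t))) @[t --> +oo] --> (0 : R).
Proof.
move=> c0; set C : R := k.+1%:R ^+ k.+1 / c ^+ k.+1.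
have C0 : 0 <= C by rewrite divr_ge0 ?exprn_ge0// ltW.
apply: (@squeeze_cvgr _ _ _ _ (cst 0) (fun t => C * t^-1)); last 2 first.
- exact: cvg_cst.
- rewrite -[X in _ --> X](mulr0 C); apply: cvgM; first exact: cvg_cst.
  by apply/gtr0_cvgV0; [exact: nbhs_pinfty_gt|exact: cvg_id].
near=> t; have t0 : 0 < t by near: t; exact: nbhs_pinfty_gt.
rewrite mulr_ge0 ?exprn_ge0 ?expR_ge0 ?(ltW t0)//= expRN ler_pdivrMr ?expR_gt0//.
rewrite -(@ler_pM2r _ t)// -exprSr mulrAC divfK ?gt_eqF//.
have := @exprn_le_expR _ k.+1 (c * t) (mulr_ge0 (ltW c0) (ltW t0)).
by rewrite exprMn /C mulrAC ler_pdivlMr ?exprn_gt0// mulrC.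
Unshelve. all: by end_near. Qed.

(** A primitive of t^k exp (- c t) that vanishes at infinity, by repeated integration
    by parts. *)
Fixpoint gamma_primitive (c : R) k (t : R) : R :=
  if k is k'.+1 then c^-1 * (k%:R * gamma_primitive c k' t - t ^+ k * expR (- (c * t)))
  else - (c^-1 * expR (- (c * t))).

Lemma gamma_primitive_cvg (c : R) k : 0 < c -> gamma_primitive c k t @[t --> +oo] --> (0 : R).
Proof.
move=> c0; elim: k => [|k IH].
  rewrite -[X in _ --> X]oppr0 -[X in - X](mulr0 c^-1) /=; apply: cvgN; apply: cvgM; first exact: cvg_cst.
  have := gamma_cvg 0 c0; under eq_fun do rewrite expr0 mul1r; exact.
rewrite -[X in _ --> X](mulr0 c^-1); apply: cvgM; first exact: cvg_cst.
rewrite -[X in _ --> X]subr0 -[X in X - _](mulr0 k.+1%:R); apply: cvgB; last exact: gamma_cvg.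
by apply: cvgM; [exact: cvg_cst|exact: IH].
Qed.

Lemma gamma_primitive0 (c : R) k : c != 0 -> gamma_primitive c k 0 = - (k`!%:R / c ^+ k.+1).
Proof.
move=> c0; elim: k => [|k IH] /=; first by rewrite mulr0 oppr0 expR0 mulr1 fact0 div1r expr1.
rewrite IH expr0n/= mul0r subr0 factS natrM (exprS c k.+1).
move: (c ^+ k.+1) (expf_neq0 k.+1 c0) => C C0.
by rewrite invfM mulrN mulrN; congr (- _); rewrite mulrCA -!mulrA; congr (_ * _); rewrite mulrCA.
Qed.

Lemma is_derive_gamma_primitive (c : R) k (t : R) : c != 0 ->
  is_derive t 1 (gamma_primitive c k) (t ^+ k * expR (- (c * t))).
Proof.
move=> c0.
have dN : is_derive t 1 (fun t : R => - (c * t)) (- c).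
  have := is_deriveN (is_deriveZ c (is_derive_id t (1 : R))).
  by move=> H; apply: (is_derive_eq H); rewrite /GRing.scale/= mulr1.
have dE : is_derive t 1 (fun t : R => expR (- (c * t))) (- c * expR (- (c * t))).
  by apply: (is_derive_eq (is_derive1_comp (is_derive_expR _) dN)); rewrite mulrC.
elim: k => [|k IH].
  apply: (is_derive_eq (is_deriveN (is_deriveZ c^-1 dE))).
  by rewrite expr0 mul1r /GRing.scale/= mulNr mulrN opprK mulKf.
have dX : is_derive t 1 (fun t : R => t ^+ k.+1) (k.+1%:R * t ^+ k).
  apply: DeriveDef; first exact: exprn_derivable.
  by rewrite exp_derive /GRing.scale/= mulr1.
have H := is_deriveZ c^-1 (is_deriveB (is_deriveZ k.+1%:R IH) (is_deriveM dX dE)).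
apply: (is_derive_eq H); rewrite /GRing.scale/=.
by rewrite (_ : t ^+ k.+1 * (- c * _) = - (c * (t ^+ k.+1 * expR (- (c * t))))); [field|ring].
Qed.

Lemma integral_gamma (c : R) k : 0 < c ->
  (\int[lam]_(t in `]0%R, +oo[) (t ^+ k * expR (- (c * t)))%:E = (k`!%:R / c ^+ k.+1)%:E)%E.
Proof.
move=> c0; have cN0 : c != 0 by rewrite gt_eqF.
have cont : continuous (fun t : R => t ^+ k * expR (- (c * t))).
  move=> t; apply: cvgM; first exact: exprn_continuous.
  apply: continuous_comp; last exact: continuous_expR.
  by apply: cvgN; apply: cvgM; [exact: cvg_cst|exact: cvg_id].
have dg t := @is_derive_gamma_primitive c k t cN0.
rewrite integral_itv_obnd_cbnd; last first.
  by apply: measurable_funTS; apply/measurable_EFinP; exact: continuous_measurable_fun.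
rewrite (@ge0_continuous_FTC2y _ _ (gamma_primitive c k) _ 0).
- by rewrite gamma_primitive0// sub0e -EFinN opprK.
- by move=> t t0; rewrite mulr_ge0 ?exprn_ge0 ?expR_ge0.
- exact: continuous_subspaceT.
- exact: gamma_primitive_cvg.
- by move=> t _; case: (dg t).
- apply: cvg_at_right_filter; apply: differentiable_continuous.
  by apply/derivable1_diffP; case: (dg 0).
- by move=> t _; rewrite derive1E; case: (dg t).
Qed.

End gaussian.

(** * Integrals of powers of the regularised squared distance *)

HB.instance Definition _ (R : realType) :=
  Measure_isSigmaFinite.Build _ _ _ (@lebesgue4 R)
    (prod_sigma_finite _ (sigma_finiteT lebesgue3)).

Section radial.
Context {R : realType}.
Notation lam := (@lebesgue_measure R).
Variable z : R4 R.

Definition sqdist (x : R4 R) : R := sqnorm (x - z).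

Lemma sqdistE (x : R4 R) : sqdist x =
  (x.1.1.1 - z.1.1.1) ^+ 2 + (x.1.1.2 - z.1.1.2) ^+ 2 + (x.1.2 - z.1.2) ^+ 2 + (x.2 - z.2) ^+ 2.
Proof. by rewrite /sqdist sqnormE. Qed.

Lemma sqdist_ge0 x : 0 <= sqdist x. Proof. exact: sqnorm_ge0. Qed.

Lemma elementary_sqdist : elementary sqdist.
Proof.
apply: (@eq_elementary _ (fun x => \sum_(i < 4) (coord i x + - coord i z) * (coord i x + - coord i z))).
  apply: elementary_sum => i; apply: elem_mul; apply: elem_add;
    by [exact: elem_coord|exact: elem_cst].
by move=> x; apply: eq_bigr => i _; rewrite coordB expr2.
Qed.

Lemma measurable_sqdist : measurable_fun [set: M4 R] sqdist.
Proof.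
apply: continuous4_measurable; apply: smooth_continuous.
exact: elementary_smooth elementary_sqdist.
Qed.

Lemma integral_gauss4 (t : R) : 0 < t ->
  (\int[lebesgue4]_x (expR (- (t * sqdist x)))%:E = (pi ^+ 2 / t ^+ 2)%:E)%E.
Proof.
move=> t0; rewrite tonelli4; last 2 first.
- apply/measurable_EFinP; apply: measurableT_comp => //.
  apply: measurableT_comp => //; apply: measurable_funM => //; exact: measurable_sqdist.
- by move=> x; rewrite lee_fin expR_ge0.
pose g (m x : R) := expR (- (t * (x - m) ^+ 2)).
pose S : R := Num.sqrt (pi / t).
have gI m : (\int[lam]_x (g m x)%:E = S%:E)%E by exact: integral_gauss1.
have S0 : 0 <= S by exact: sqrtr_ge0.
have g0 m x : 0 <= g m x by exact: expR_ge0.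
have mg m : measurable_fun [set: RR R] (fun x => (g m x)%:E).
  apply/measurable_EFinP; apply: continuous_measurable_fun => y.
  apply: continuous_comp; last exact: continuous_expR.
  apply: cvgN; apply: cvgM; first exact: cvg_cst.
  by apply: cvgM; (apply: cvgB; [exact: cvg_id|exact: cvg_cst]).
have pull m (k : R) : 0 <= k -> (\int[lam]_x (k * g m x)%:E = (k * S)%:E)%E.
  move=> k0; under eq_integral do rewrite EFinM.
  rewrite ge0_integralZl_EFin//; first by rewrite gI.
  by move=> x _; rewrite lee_fin.
have E x0 x1 x2 x3 : expR (- (t * sqdist (x0, x1, x2, x3))) =
    g z.1.1.1 x0 * g z.1.1.2 x1 * g z.1.2 x2 * g z.2 x3.
  by rewrite sqdistE /= !mulrDr !opprD !expRD.
have p2 (a b s : R) : a * b * s * s = a * s * s * b by ring.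
have p3 (a s : R) : a * s * s * s = s * s * s * a by ring.
under eq_integral => x0 _.
  under eq_integral => x1 _.
    under eq_integral => x2 _.
      under eq_integral => x3 _ do rewrite E.
      rewrite pull ?mulr_ge0//.
      rewrite mulrAC.
      over.
    rewrite pull ?mulr_ge0//.
    rewrite p2.
    over.
  rewrite pull ?mulr_ge0//.
  rewrite p3.
  over.
rewrite pull ?mulr_ge0//.
have S2 : S * S = pi / t by rewrite -expr2 sqr_sqrtr// divr_ge0 ?pi_ge0 ?ltW.
have -> : S * S * S * S = (S * S) ^+ 2 by rewrite expr2 !mulrA.
by rewrite S2 expr_div_n.
Qed.

(** By Tonelli from the gamma representation
    (k + 2)! / (s + a)^(k + 3) = int_0^oo t^(k + 2) exp (- t (s + a)) dt,
    the inner integral over R^4 being the Gaussian pi^2 / t^2.  This replaces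
    integration in polar coordinates. *)
Lemma integral_sqdist_inv k (a : R) : 0 < a ->
  (\int[lebesgue4]_x (k.+2`!%:R / (sqdist x + a) ^+ k.+3)%:E
    = (pi ^+ 2 * k`!%:R / a ^+ k.+1)%:E)%E.
Proof.
move=> a0.
pose F (p : M4 R * RR R) : \bar R :=
  (if 0 < p.2 then p.2 ^+ k.+2 * expR (- ((sqdist p.1 + a) * p.2)) else 0)%:E.
have mF : measurable_fun setT F.
  apply/measurable_EFinP; apply: measurable_fun_ifT.
  - apply: measurable_fun_ltr; [exact: measurable_cst|exact: measurable_snd].
  - apply: measurable_funM; first by apply: measurable_funX; exact: measurable_snd.
    apply: measurableT_comp => //; apply: measurableT_comp => //.
    apply: measurable_funM; last exact: measurable_snd.
    apply: measurable_funD; last exact: measurable_cst.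
    by apply: measurableT_comp; [exact: measurable_sqdist|exact: measurable_fst].
  - exact: measurable_cst.
have F0 p : (0 <= F p)%E.
  by rewrite lee_fin; case: ifPn => // p0; rewrite mulr_ge0 ?expR_ge0// exprn_ge0// ltW.
have patchF (f : R -> R) : (\int[lam]_(t in `]0%R, +oo[) (f t)%:E =
    \int[lam]_t (if 0 < t then f t else 0)%:E)%E.
  rewrite integral_mkcond; apply: eq_integral => t _; rewrite patchE.
  by rewrite mem_setE in_itv/= andbT; case: ifPn.
transitivity (\int[lebesgue4]_x \int[lam]_t F (x, t))%E.
  apply: eq_integral => x _; rewrite /F/= -patchF.
  have c0 : 0 < sqdist x + a by rewrite ltr_wpDl// sqdist_ge0.
  by rewrite -(integral_gamma k.+2 c0).
rewrite (@fubini_tonelli _ _ _ _ _ lebesgue4 lam F mF F0).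
transitivity (\int[lam]_(t in `]0%R, +oo[) ((pi ^+ 2) * (t ^+ k * expR (- (a * t))))%:E)%E; last first.
  under eq_integral do rewrite EFinM.
  rewrite ge0_integralZl_EFin//.
  - by rewrite integral_gamma// -EFinM mulrA.
  - by move=> t; rewrite /= in_itv/= andbT => t0; rewrite lee_fin mulr_ge0 ?exprn_ge0 ?expR_ge0// ltW.
  - apply: measurable_funTS; apply/measurable_EFinP; apply: continuous_measurable_fun => t.
    apply: cvgM; first exact: exprn_continuous.
    apply: continuous_comp; last exact: continuous_expR.
    by apply: cvgN; apply: cvgM; [exact: cvg_cst|exact: cvg_id].
  - exact: sqr_ge0.
rewrite patchF; apply: eq_integral => t _; rewrite /F/=; case: ifPn => t0; last by rewrite integral0.
under eq_integral => x _.
  rewrite (_ : _ * expR _ = (t ^+ k.+2 * expR (- (a * t))) * expR (- (t * sqdist x))); last first.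
    by rewrite mulrDl opprD expRD (mulrC (sqdist x)) -[RHS]mulrA [in RHS](mulrC (expR (- (a * t)))).
  rewrite EFinM.
  over.
rewrite ge0_integralZl_EFin//.
- rewrite integral_gauss4// -EFinM; congr EFin.
  by rewrite !exprS; field; rewrite gt_eqF.
- apply/measurable_EFinP; apply: measurableT_comp => //.
  apply: measurableT_comp => //; apply: measurable_funM => //; exact: measurable_sqdist.
- by rewrite mulr_ge0 ?expR_ge0// exprn_ge0// ltW.
Qed.

End radial.

(** * The logarithmically divergent integral *)

Section log.
Context {R : realType}.
Notation lam := (@lebesgue_measure R).
Notation B := (@unit_ball R).
Notation mB := (@measurable_unit_ball R).
Variable z : R4 R.
Local Notation s := (sqdist z).

Lemma integral_inv3 (c a : R) : 0 <= c -> 0 < a -> a < 1 ->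
  (\int[lam]_(b in `[a, 1%R]) (2 / (c + b) ^+ 3)%:E = ((c + a) ^- 2 - (c + 1) ^- 2)%:E)%E.
Proof.
move=> c0 a0 a1.
pose F (b : R) : R := - (c + b) ^- 2.
have dF (b : R) : 0 < b -> is_derive b 1 F (2 / (c + b) ^+ 3).
  move=> b0; have cb : c + b != 0 by rewrite gt_eqF// ltr_wpDl.
  have d1 : is_derive b 1 (fun b : R => c + b) 1.
    by apply: (is_derive_eq (is_deriveD (is_derive_cst c b (1:R)) (is_derive_id b (1:R)))); rewrite add0r.
  have d2 : is_derive b 1 (fun b : R => (c + b)^-1) (- (c + b) ^- 2).
    by apply: (is_derive_eq (is_deriveV cb d1)); rewrite /GRing.scale/= mulr1.
  have d3 := is_deriveN (is_deriveM d2 d2).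
  rewrite (_ : F = - ((fun b : R => (c + b)^-1) * (fun b : R => (c + b)^-1))); last first.
    by apply/funext => y; rewrite /F -exprVn expr2.
  apply: (is_derive_eq d3); rewrite /GRing.scale/= -!exprVn.
  by ring.
have cF (b : R) : 0 < b -> {for b, continuous F}.
  move=> b0; apply: differentiable_continuous; apply/derivable1_diffP.
  by case: (dF b b0).
have cf (b : R) : 0 < b -> {for b, continuous (fun b : R => 2 / (c + b) ^+ 3)}.
  move=> b0; have cb : c + b != 0 by rewrite gt_eqF// ltr_wpDl.
  apply: cvgM; first exact: cvg_cst.
  apply: cvgV; first by rewrite expf_neq0.
  apply: (@continuous_comp _ _ _ (fun b => c + b) (fun y : R => y ^+ 3)); last exact: exprn_continuous.
  by apply: cvgD; [exact: cvg_cst|exact: cvg_id].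
rewrite (@continuous_FTC2 _ _ F)//.
- by rewrite /F -EFinB opprK addrC.
- apply: continuous_in_subspaceT => b; rewrite inE/= in_itv/= => /andP[ab _].
  by apply: cf; exact: lt_le_trans ab.
- split.
  + move=> b; rewrite in_itv/= => /andP[ab _]; have b0 := lt_trans a0 ab.
    by case: (dF b b0).
  + by apply: cvg_at_right_filter; exact: cF.
  + by apply: cvg_at_left_filter; exact: cF.
- move=> b; rewrite in_itv/= => /andP[ab _]; have b0 := lt_trans a0 ab.
  by rewrite derive1E; case: (dF b b0).
Qed.

Lemma integral_inv (a : R) : 0 < a -> a < 1 ->
  (\int[lam]_(b in `[a, 1%R]) (pi ^+ 2 / b)%:E = (- (pi ^+ 2 * ln a))%:E)%E.
Proof.
move=> a0 a1; pose F (b : R) := pi ^+ 2 * ln b.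
have dF (b : R) : 0 < b -> is_derive b 1 F (pi ^+ 2 / b).
  by move=> b0; exact: (is_deriveZ (pi ^+ 2) (is_derive1_ln b0)).
have cF (b : R) : 0 < b -> {for b, continuous F}.
  move=> b0; apply: differentiable_continuous; apply/derivable1_diffP.
  by case: (dF b b0).
rewrite (@continuous_FTC2 _ _ F)//.
- by rewrite /F ln1 mulr0 sub0e.
- apply: continuous_in_subspaceT => b; rewrite inE/= in_itv/= => /andP[ab _].
  apply: cvgM; first exact: cvg_cst.
  by apply: cvgV; [rewrite gt_eqF// (lt_le_trans a0)|exact: cvg_id].
- split.
  + move=> b; rewrite in_itv/= => /andP[ab _]; have b0 := lt_trans a0 ab.
    by case: (dF b b0).
  + by apply: cvg_at_right_filter; exact: cF.
  + by apply: cvg_at_left_filter; exact: cF.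
- move=> b; rewrite in_itv/= => /andP[ab _]; have b0 := lt_trans a0 ab.
  by rewrite derive1E; case: (dF b b0).
Qed.

(** (s + a)^-2 alone is not integrable at infinity; its difference with (s + 1)^-2 is
    int_a^1 2 (s + b)^-3 db, and each (s + b)^-3 has integral pi^2 / (2 b).  Integrating
    in b produces the logarithm. *)
Lemma integral_sqdist_inv_diff (a : R) : 0 < a -> a < 1 ->
  (\int[lebesgue4]_x ((s x + a) ^- 2 - (s x + 1) ^- 2)%:E = (- (pi ^+ 2 * ln a))%:E)%E.
Proof.
move=> a0 a1.
pose F (p : M4 R * RR R) : \bar R :=
  (2 * (\1_(`[a, 1%R]) p.2 * expR (- (3 * ln (s p.1 + p.2)))))%:E.
have mF : measurable_fun setT F.
  apply/measurable_EFinP; apply: measurable_funM; first exact: measurable_cst.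
  apply: measurable_funM.
    apply: measurableT_comp; last exact: measurable_snd.
    exact: measurable_indic.
  apply: measurableT_comp => //; apply: measurableT_comp => //.
  apply: measurable_funM; first exact: measurable_cst.
  apply: measurableT_comp; first exact: measurable_ln.
  apply: measurable_funD; last exact: measurable_snd.
  by apply: measurableT_comp; [exact: measurable_sqdist|exact: measurable_fst].
have F0 p : (0 <= F p)%E by rewrite lee_fin !mulr_ge0// expR_ge0.
have FE x b : F (x, b) = ((fun b => (2 / (s x + b) ^+ 3)%:E) \_ `[a, 1%R]) b.
  rewrite /F patchE indicE /=; case: ifPn => [|_]; last by rewrite mul0r mulr0.
  rewrite inE/= in_itv/= => /andP[ab _]; rewrite mul1r.
  have c0 : 0 < s x + b by rewrite ltr_wpDl ?sqdist_ge0// (lt_le_trans a0).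
  by rewrite expRN (mulr_natl (ln _)) -lnXn// lnK// posrE exprn_gt0.
transitivity (\int[lebesgue4]_x \int[lam]_t F (x, t))%E.
  apply: eq_integral => x _; under eq_integral do rewrite FE.
  by rewrite -integral_mkcond integral_inv3// sqdist_ge0.
rewrite (@fubini_tonelli _ _ _ _ _ lebesgue4 lam F mF F0) -integral_inv// [RHS]integral_mkcond.
apply: eq_integral => b _; under eq_integral do rewrite FE.
rewrite patchE; case: ifPn => [|bN]; last first.
  by under eq_integral do rewrite patchE (negbTE bN); rewrite integral0.
move=> bI; under eq_integral do rewrite patchE bI.
move: bI; rewrite inE/= in_itv/= => /andP[ab _].
by have := @integral_sqdist_inv _ z 0 b (lt_le_trans a0 ab); rewrite expr1 mulr1.
Qed.

Lemma continuous_sqdist_inv n (a : R) : 0 < a -> continuous (fun x => (s x + a) ^- n).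
Proof.
move=> a0 x; apply: cvgV; first by rewrite expf_neq0// gt_eqF// ltr_wpDl// sqdist_ge0.
apply: (@continuous_comp _ _ _ (fun x => s x + a) (fun y => y ^+ n)); last exact: exprn_continuous.
apply: cvgD; last exact: cvg_cst.
exact: (smooth_continuous (elementary_smooth (elementary_sqdist z))).
Qed.

(** On B the leftover (s + 1)^-2 is at most 1 and B has measure at most 16. *)
Lemma integral_ball_sqdist_inv2 (a : R) : 0 < a -> a <= 1 ->
  (\int[lebesgue4]_(x in B) ((s x + a) ^- 2)%:E <= (16 - pi ^+ 2 * ln a)%:E)%E.
Proof.
move=> a0 a1.
have m n b : 0 < b -> measurable_fun [set: M4 R] (fun x => (s x + b) ^- n).
  by move=> b0; apply: continuous4_measurable; exact: continuous_sqdist_inv.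
have I1 : (\int[lebesgue4]_(x in B) ((s x + 1) ^- 2)%:E <= 16%:E)%E.
  apply: (@le_trans _ _ (\int[lebesgue4]_(x in B) (cst (1 : R) x)%:E)%E).
    apply: ge0_le_integralB.
    - by apply: measurable_funTS; exact: m.
    - exact: measurable_cst.
    - move=> x _; have h : 1 <= s x + 1 by rewrite lerDr sqdist_ge0.
      rewrite invr_ge0 exprn_ge0 ?(le_trans ler01 h)//=.
      by rewrite invf_le1 ?exprn_gt0 ?(lt_le_trans ltr01 h)// exprn_ege1.
  rewrite (_ : integral _ _ _ = 1%:E * lebesgue4 B)%E; last exact: (integral_cst lebesgue4 mB 1%:E).
  by rewrite mul1e lebesgue4_unit_ball_le.
move: a1; rewrite le_eqVlt => /orP[/eqP ->|a1]; first by rewrite ln1 mulr0 subr0.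
have d0 x : 0 <= (s x + a) ^- 2 - (s x + 1) ^- 2.
  have h : 0 < s x + a by rewrite ltr_wpDl ?sqdist_ge0.
  have h1 : 0 < s x + 1 by rewrite ltr_wpDl ?sqdist_ge0.
  by rewrite subr_ge0 lef_pV2 ?posrE ?exprn_gt0// lerXn2r ?nnegrE ?(ltW h) ?(ltW h1)// lerD2l ltW.
have E : (\int[lebesgue4]_(x in B) ((s x + a) ^- 2)%:E =
   \int[lebesgue4]_(x in B) ((s x + 1) ^- 2)%:E +
   \int[lebesgue4]_(x in B) ((s x + a) ^- 2 - (s x + 1) ^- 2)%:E)%E.
  rewrite -ge0_integralD//; last 5 first.
  - exact: mB.
  - by move=> x _; rewrite lee_fin invr_ge0 sqr_ge0.
  - by apply/measurable_EFinP; apply: measurable_funTS; exact: m.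
  - by move=> x _; rewrite lee_fin.
  - by apply/measurable_EFinP; apply: measurable_funTS; apply: measurable_funB; exact: m.
  by apply: eq_integral => x _; rewrite -EFinD [in RHS]addrC subrK.
rewrite E EFinD; apply: leeD => //.
rewrite -(integral_sqdist_inv_diff a0 a1).
apply: ge0_subset_integral => //; first exact: mB.
- by apply/measurable_EFinP; apply: measurable_funB; exact: m.
- by move=> x _; rewrite lee_fin.
Qed.

End log.

(** * The Laplacian of radial functions and the regularised Green function *)

Section radial_laplacian.
Context {R : realType}.
Variable z : R4 R.
Local Notation s := (sqdist z).

Lemma differentiable_sqdist x : differentiable s x.
Proof. by have [] := elementary_diff (elementary_sqdist z). Qed.

Lemma coord_basis4 (i j : 'I_4) : coord i (basis4 j : R4 R) = (i == j)%:R.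
Proof.
by case: i => -[|[|[|[|//]]]] p; case: j => -[|[|[|[|//]]]] q.
Qed.

Lemma derive_sqdist i x : 'D_(basis4 i) s x = 2 * (coord i x - coord i z).
Proof.
have d j : is_derive x (basis4 i) (fun y : R4 R => coord j y - coord j z) (j == i)%:R.
  have dc : is_derive x (basis4 i) (coord j : R4 R -> R) (j == i)%:R.
    apply: DeriveDef; last by rewrite derive_coord coord_basis4.
    by apply: diff_derivable; apply: linear_differentiable; exact: continuous_coord.
  by apply: (is_derive_eq (is_deriveB dc (is_derive_cst (coord j z) x (basis4 i)))); rewrite subr0.
have -> : s = \sum_(j < 4) ((fun y : R4 R => coord j y - coord j z) * (fun y => coord j y - coord j z)).
  apply/funext => y; rewrite fct_sumE /sqdist /sqnorm; apply: eq_bigr => j _.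
  by rewrite coordB expr2.
have H := is_derive_sum (fun j => is_deriveM (d j) (d j)).
case: H => _ ->; rewrite (bigD1 i)//= big1 => [|j ji]; last first.
  by rewrite (negbTE ji) !scaler0 addr0.
by rewrite eqxx addr0 /GRing.scale/=; ring.
Qed.

Lemma derive_radial (h : R -> R) (h1 : R) i x :
  is_derive (s x) 1 h h1 ->
  differentiable (fun x => h (s x)) x /\
  'D_(basis4 i) (fun x => h (s x)) x = h1 * (2 * (coord i x - coord i z)).
Proof.
move=> [dh h1E]; have [] := derive_comp1 (basis4 i) dh (differentiable_sqdist x).
by move=> df ->; split=> //; rewrite derive1E h1E derive_sqdist.
Qed.

(** In dimension 4, with h evaluated at the squared distance:
    Delta (h o s) = |grad s|^2 h'' + (Delta s) h', where |grad s|^2 = 4 s and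
    Delta s = 8. *)
Lemma laplacian_radial (h h1 h2 : R -> R) x :
  (forall t : R, 0 <= t -> is_derive t 1 h (h1 t)) ->
  (forall t : R, 0 <= t -> is_derive t 1 h1 (h2 t)) ->
  \sum_(i < 4) partials [:: i; i] (fun x => h (s x)) x = 4 * s x * h2 (s x) + 8 * h1 (s x).
Proof.
move=> dh dh1.
have E i : partials [:: i; i] (fun x => h (s x)) x =
    2 * h1 (s x) + 4 * h2 (s x) * (coord i x - coord i z) ^+ 2.
  rewrite /=.
  have -> : 'D_(basis4 i) (fun x => h (s x)) = (fun x => h1 (s x)) * (fun x => 2 * (coord i x - coord i z)).
    by apply/funext => y; have [_ ->] := derive_radial i (dh (s y) (sqdist_ge0 z y)).
  have [d1 D1] := derive_radial i (dh1 (s x) (sqdist_ge0 z x)).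
  have dc : is_derive x (basis4 i) (fun x : R4 R => 2 * (coord i x - coord i z)) 2.
    have dc : is_derive x (basis4 i) (coord i : R4 R -> R) 1.
      apply: DeriveDef; last by rewrite derive_coord coord_basis4 eqxx.
      by apply: diff_derivable; apply: linear_differentiable; exact: continuous_coord.
    apply: (is_derive_eq (is_deriveZ 2 (is_deriveB dc (is_derive_cst (coord i z) x (basis4 i))))).
    by rewrite subr0 /GRing.scale/= mulr1.
  have dh' : is_derive x (basis4 i) (fun x => h1 (s x)) (h2 (s x) * (2 * (coord i x - coord i z))).
    by apply: DeriveDef; [exact: diff_derivable|].
  by case: (is_deriveM dh' dc) => _ ->; rewrite /GRing.scale/=; ring.
rewrite (eq_bigr _ (fun i _ => E i)) big_split/= sumr_const card_ord -mulr_sumr.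
rewrite (_ : \sum_(i < 4) _ = s x); last first.
  by rewrite /sqdist /sqnorm; apply: eq_bigr => i _; rewrite coordB.
by rewrite -mulr_natl; ring.
Qed.

End radial_laplacian.

Section bubble.
Context {R : realType}.
Variables (z : R4 R) (a : R).
Hypothesis a0 : 0 < a.
Local Notation s := (sqdist z).

(** 1 / s is, up to a constant, the Green function of the Laplacian in dimension 4.  The
    second term is chosen so that the Laplacian of the regularisation is the fourth
    power of 1 / (s + a), which decays fast enough for the Hoelder estimate. *)
Definition bubble (x : R4 R) : R := (s x + a)^-1 + a * (s x + a) ^- 2.

Let sa x : 0 < s x + a.
Proof. by rewrite ltr_wpDl ?sqdist_ge0. Qed.

Lemma elementary_bubble : elementary bubble.
Proof.
have esa : elementary (fun x => s x + a).
  by apply: elem_add; [exact: elementary_sqdist|exact: elem_cst].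
have eV := elem_inv sa esa.
apply: (@eq_elementary _ (fun x => (s x + a)^-1 + a * ((s x + a)^-1 * (s x + a)^-1))).
  by apply: elem_add => //; apply: elem_mul; [exact: elem_cst|exact: elem_mul].
by move=> x; rewrite /bubble -exprVn expr2.
Qed.

Lemma laplacian_bubble x :
  \sum_(i < 4) partials [:: i; i] bubble x = - (24 * a ^+ 2 * (s x + a) ^- 4).
Proof.
pose q (t : R) := (t + a)^-1.
have dq (t : R) : 0 <= t -> is_derive t 1 q (- q t ^+ 2).
  move=> t0; have ta : t + a != 0 by rewrite gt_eqF// ltr_wpDl.
  have d1 : is_derive t 1 (fun t : R => t + a) 1.
    by apply: (is_derive_eq (is_deriveD (is_derive_id t (1:R)) (is_derive_cst a t (1:R)))); rewrite addr0.
  have : is_derive t 1 (fun t : R => (t + a)^-1) (- (t + a) ^- 2).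
    by apply: (is_derive_eq (is_deriveV (f := fun t : R => t + a) (x := t) ta d1)); rewrite /GRing.scale/= mulr1.
  by rewrite /q exprVn.
pose h : R -> R := q + a *: (q * q).
pose h1 : R -> R := - (q * q) - (2 * a) *: (q * (q * q)).
pose h2 (t : R) : R := 2 * q t ^+ 3 + 6 * a * q t ^+ 4.
have dh (t : R) : 0 <= t -> is_derive t 1 h (h1 t).
  move=> t0; have d := dq t t0; have d2 := is_deriveM d d.
  apply: (is_derive_eq (is_deriveD d (is_deriveZ a d2))).
  by rewrite /h1 !fctE /GRing.scale/=; ring.
have dh1 (t : R) : 0 <= t -> is_derive t 1 h1 (h2 t).
  move=> t0; have d := dq t t0; have d2 := is_deriveM d d.
  apply: (is_derive_eq (is_deriveB (is_deriveN d2) (is_deriveZ (2 * a) (is_deriveM d d2)))).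
  by rewrite /h2 !fctE /GRing.scale/=; ring.
rewrite (_ : bubble = fun x => h (s x)); last first.
  by apply/funext => y; rewrite /bubble /h -exprVn expr2.
rewrite (laplacian_radial z x dh dh1) /h1 /h2 -exprVn -/(q (s x)) !fctE.
have E : s x * q (s x) = 1 - a * q (s x).
  by apply/eqP; rewrite eq_sym subr_eq -mulrDl divff// gt_eqF.
transitivity (4 * (s x * q (s x)) * (2 * q (s x) ^+ 2 + 6 * a * q (s x) ^+ 3)
   - 8 * (q (s x) ^+ 2 + 2 * a * q (s x) ^+ 3)).
  by rewrite /GRing.scale/=; ring.
by rewrite E; ring.
Qed.

Lemma smooth_bubble : smooth bubble.
Proof. exact/elementary_smooth/elementary_bubble. Qed.

End bubble.

(** * The pointwise estimate at a given scale *)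

Section core.
Context {R : realType}.
Notation B := (@unit_ball R).
Notation mB := (@measurable_unit_ball R).
Implicit Types u : R4 R -> R.

Lemma inL2_cst0 : inL2 B (fun=> 0 : R).
Proof. by apply: inL2_continuous => x; exact: cvg_cst. Qed.

Lemma inL2_sum n (F : 'I_n -> R4 R -> R) : (forall i, inL2 B (F i)) ->
  inL2 B (fun x => \sum_(i < n) F i x).
Proof.
elim: n F => [|n IH] F F2.
  by under eq_fun do rewrite big_ord0; exact: inL2_cst0.
by under eq_fun do rewrite big_ord_recr; apply: inL2D => //; exact: IH.
Qed.

Lemma Rintegral_sum_L2 n (F G : 'I_n -> R4 R -> R) :
  (forall i, inL2 B (F i)) -> (forall i, inL2 B (G i)) ->
  \int[lebesgue4]_(x in B) (\sum_(i < n) (F i x * G i x)) =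
  \sum_(i < n) \int[lebesgue4]_(x in B) (F i x * G i x).
Proof.
move=> F2 G2.
have iFG i : lebesgue4.-integrable (B : set (M4 R)) (fun x => (F i x * G i x)%:E).
  exact: (L2_CauchySchwarz (F2 i) (G2 i)).1.
rewrite /Rintegral; under eq_integral do rewrite -sumEFin.
rewrite integral_sum//; last exact: mB.
rewrite -sum_fine// => i _; apply: integrable_fin_num => //; exact: mB.
Qed.

Lemma inL2_laplacian u : inH20 B u -> inL2 B (laplacian B u).
Proof.
move=> [[u2 wu] _]; apply: inL2_sum => i.
by have [] := weak_partialP (wu [:: i; i] isT).
Qed.

(** Green's formula without boundary terms, thanks to the approximation of u by test
    functions. *)
Lemma H20_green u g : inH20 B u -> smooth g ->
  \int[lebesgue4]_(x in B) (u x * \sum_(i < 4) partials [:: i; i] g x) =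
  \int[lebesgue4]_(x in B) (laplacian B u x * g x).
Proof.
move=> hu sg; have [[u2 wu] _] := hu.
have g2 : inL2 B g by apply/inL2_continuous/smooth_continuous.
transitivity (\sum_(i < 4) \int[lebesgue4]_(x in B) (u x * partials [:: i; i] g x)).
  rewrite -Rintegral_sum_L2//.
    by apply: eq_Rintegral => x _; rewrite mulr_sumr.
  by move=> i; apply/inL2_continuous; case: (sg [:: i; i]).
under eq_bigr do rewrite H20_ibp2//.
rewrite -Rintegral_sum_L2//.
  by apply: eq_Rintegral => x _; rewrite /laplacian mulr_suml.
by move=> i; have [] := weak_partialP (wu [:: i; i] isT).
Qed.

(** The supremum only ranges over distinct points; the diagonal case is trivial. *)
Lemma holderP (alpha : R) u : 0 < alpha -> (holder_seminorm alpha u < +oo)%E ->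
  0 <= fine (holder_seminorm alpha u) /\
  forall x y, `|u x - u y| <= fine (holder_seminorm alpha u) * enorm (x - y) `^ alpha.
Proof.
move=> a0 Hfin.
have ub x y : x != y -> ((`|u x - u y| / enorm (x - y) `^ alpha)%:E <= holder_seminorm alpha u)%E.
  by move=> xy; apply: ereal_sup_ubound; exists x, y.
have e10 : (0 : R4 R) != ((1, 0, 0, 0) : R4 R).
  by apply/eqP => /(congr1 (fun x : R4 R => x.1.1.1))/=/eqP; rewrite eq_sym oner_eq0.
have H0 : (0 <= holder_seminorm alpha u)%E.
  by apply: le_trans (ub _ _ e10); rewrite lee_fin divr_ge0 ?powR_ge0.
have Hf : holder_seminorm alpha u \is a fin_num by rewrite ge0_fin_numE.
split=> [|x y]; first exact: fine_ge0.
have [<-|xy] := eqVneq x y.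
  by rewrite subrr normr0 mulr_ge0 ?powR_ge0// fine_ge0.
have nxy : 0 < enorm (x - y).
  rewrite lt_neqAle eq_sym enormE sqrtr_ge0 andbT; apply/negP => /eqP e0.
  have := norm_le_enorm (x - y); rewrite enormE e0 normr_le0 subr_eq0.
  by rewrite (negbTE xy).
rewrite -ler_pdivrMr ?powR_gt0// -lee_fin fineK//.
exact: ub.
Qed.

(** Replaces |x - z|^alpha by a polynomial in |x - z|^2, whose integral against the
    kernel is explicit. *)
Lemma powR_le1Dsqr (alpha rho : R) : 0 < alpha < 1 -> 0 <= rho -> rho `^ alpha <= 1 + rho ^+ 2.
Proof.
move=> /andP[a0 a1] r0; have [r1|r1] := leP rho 1.
  apply: (@le_trans _ _ 1); last by rewrite lerDl sqr_ge0.
  have -> : 1 = 1 `^ alpha :> R by rewrite powR1.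
  by apply: ge0_ler_powR => //; exact: ltW.
apply: (@le_trans _ _ rho).
  by rewrite -[leRHS]powRr1// ler_powR// ltW.
apply: (@le_trans _ _ (rho ^+ 2)); last by rewrite lerDr.
by rewrite expr2 ler_peMl// ltW.
Qed.

Lemma pi_sqr_ge4 : 4 <= (pi : R) ^+ 2.
Proof.
have p2 := pi_ge2 R.
by rewrite -[leLHS](_ : 2 ^+ 2 = 4); [rewrite lerXn2r ?nnegrE// (le_trans _ p2)|rewrite -natrX].
Qed.

(** Of the three terms of G^2 only (s + a)^-2 contributes a logarithm; the two others
    are scale invariant and bounded by their integrals over R^4. *)
Lemma nL2_bubble (z : R4 R) (a : R) : 0 < a -> a <= 1 ->
  nL2 (bubble z a) ^+ 2 <= 16 + 2 * pi ^+ 2 - pi ^+ 2 * ln a.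
Proof.
move=> a0 a1; set s := sqdist z.
have sa x : 0 < s x + a by rewrite ltr_wpDl ?sqdist_ge0.
have bub2 : inL2 B (bubble z a) by apply/inL2_continuous/smooth_continuous/smooth_bubble.
rewrite -lee_fin -nL2_sqr//.
have m n : measurable_fun [set: M4 R] (fun x => (s x + a) ^- n).
  by apply: continuous4_measurable; exact: continuous_sqdist_inv.
have p n x : 0 <= (s x + a) ^- n by rewrite invr_ge0 exprn_ge0// ltW.
have E x : bubble z a x ^+ 2 = (s x + a) ^- 2 + (a * (2 / (s x + a) ^+ 3) + a ^+ 2 / 6 * (6 / (s x + a) ^+ 4)).
  by rewrite /bubble -/s; field; rewrite gt_eqF.
have tail k (c : R) : 0 <= c ->
   (\int[lebesgue4]_(x in B) (c * (k.+2`!%:R / (s x + a) ^+ k.+3))%:E <= (c * (pi ^+ 2 * k`!%:R / a ^+ k.+1))%:E)%E.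
  move=> c0; rewrite [leRHS]EFinM -(integral_sqdist_inv z k a0) -ge0_integralZl_EFin//; last 2 first.
  - by move=> x _; rewrite lee_fin divr_ge0// exprn_ge0// ltW.
  - apply/measurable_EFinP; apply: measurable_funM; [exact: measurable_cst|exact: m].
  under [leRHS]eq_integral do rewrite -EFinM.
  apply: ge0_subset_integral => //; first exact: mB.
  - apply/measurable_EFinP; apply: measurable_funM; first exact: measurable_cst.
    apply: measurable_funM; [exact: measurable_cst|exact: m].
  - by move=> x _; rewrite lee_fin mulr_ge0// divr_ge0// exprn_ge0// ltW.
have mt k (c : R) : measurable_fun (B : set (M4 R)) (fun x => (c * (k.+2`!%:R / (s x + a) ^+ k.+3))%:E).
  apply: measurable_funTS; apply/measurable_EFinP; apply: measurable_funM; first exact: measurable_cst.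
  apply: measurable_funM; [exact: measurable_cst|exact: m].
have pt k (c : R) x : 0 <= c -> (0 <= (c * (k.+2`!%:R / (s x + a) ^+ k.+3))%:E)%E.
  by move=> c0; rewrite lee_fin mulr_ge0// divr_ge0// exprn_ge0// ltW.
under eq_integral do rewrite E EFinD EFinD.
rewrite ge0_integralD//; last 5 first.
- exact: mB.
- by move=> x _; rewrite lee_fin.
- by apply: measurable_funTS; apply/measurable_EFinP; exact: m.
- by move=> x _; rewrite adde_ge0// ?(pt 0%N)// ?(pt 1%N)// ?divr_ge0 ?sqr_ge0// ltW.
- by apply: emeasurable_funD; [exact: (mt 0%N)|exact: (mt 1%N)].
rewrite ge0_integralD//; last 5 first.
- exact: mB.
- by move=> x _; rewrite (pt 0%N)// ltW.
- exact: (mt 0%N).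
- by move=> x _; rewrite (pt 1%N)// divr_ge0 ?sqr_ge0.
- exact: (mt 1%N).
have h0 := tail 0%N a (ltW a0).
have h1 := tail 1%N (a ^+ 2 / 6) (divr_ge0 (sqr_ge0 _) (ler0n _ _)).
apply: le_trans (leeD (integral_ball_sqdist_inv2 z a0 a1) (leeD h0 h1)) _.
rewrite -!EFinD lee_fin.
have -> : a * (pi ^+ 2 * 0`!%:R / a ^+ 1) = pi ^+ 2 by rewrite fact0 mulr1 expr1; field; rewrite gt_eqF.
have -> : a ^+ 2 / 6 * (pi ^+ 2 * 1`!%:R / a ^+ 2) = pi ^+ 2 / 6.
  by rewrite mulr1; field; rewrite gt_eqF.
have := sqr_ge0 (pi : R); lra.
Qed.

Lemma nL2_bubble_sqrt (z : R4 R) (eps : R) : 0 < eps -> eps <= 1 ->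
  nL2 (bubble z (eps ^+ 2)) <= 4 * pi ^+ 2 * Num.sqrt ((3 - ln eps) / (8 * pi ^+ 2)).
Proof.
move=> e0 e1; have p0 : 0 < (pi : R) ^+ 2 by rewrite exprn_gt0// pi_gt0.
have ln_e : ln (eps ^+ 2) = 2 * ln eps by rewrite lnXn// mulr_natl.
have le0 : ln eps <= 0 by exact: ln_le0.
have pp : 0 <= (3 - ln eps) / (8 * pi ^+ 2).
  by apply: divr_ge0; [lra|rewrite mulr_ge0// ltW].
have r0 : 0 <= 4 * pi ^+ 2 * Num.sqrt ((3 - ln eps) / (8 * pi ^+ 2)).
  by rewrite mulr_ge0 ?sqrtr_ge0// mulr_ge0// ltW.
rewrite -(@ler_pXn2r _ 2)// ?nnegrE ?nL2_ge0//.
have ea0 : 0 < eps ^+ 2 by rewrite exprn_gt0.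
have ea1 : eps ^+ 2 <= 1 by rewrite exprn_ile1// ltW.
apply: le_trans (nL2_bubble z ea0 ea1) _.
rewrite exprMn sqr_sqrtr// ln_e.
rewrite (_ : (4 * pi ^+ 2) ^+ 2 * _ = 2 * pi ^+ 2 * (3 - ln eps)); last first.
  by move: (pi ^+ 2) p0 => q q0; field; exact: lt0r_neq0.
have := pi_sqr_ge4; move: (pi ^+ 2) => q q4; nra.
Qed.

(** Green's formula against [bubble] represents 4 pi^2 u(z) as an average of u at scale
    eps plus int (Delta u) G.  For the average,
    |u(z) - u(x)| <= H eps^alpha (1 + s / a), and int (1 + s / a) 24 a^2 / (s + a)^4
    = 12 pi^2 is three times the mass of the kernel: hence the factor 3. *)
Lemma core_estimate (alpha : R) u (z : R4 R) (eps : R) : 0 < alpha < 1 ->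
  inH20 B u -> (forall x, ~ B x -> u x = 0) -> (holder_seminorm alpha u < +oo)%E ->
  0 < eps <= 1 ->
  `|u z| <= nL2 (laplacian B u) * Num.sqrt ((3 - ln eps) / (8 * pi ^+ 2)) +
     3 * fine (holder_seminorm alpha u) * eps `^ alpha.
Proof.
move=> al01 hu u0 Hfin /andP[e0 e1].
have /andP[al0 al1] := al01.
have [H0 holder] := holderP al0 Hfin.
set H := fine _ in H0 holder *; set D := nL2 _.
have [[u2 _] _] := hu.
pose a := eps ^+ 2; have a0 : 0 < a by exact: exprn_gt0.
have a1 : a <= 1 by rewrite /a exprn_ile1// ltW.
set s := sqdist z.
have sa x : 0 < s x + a by rewrite ltr_wpDl ?sqdist_ge0.
(* P is the approximate identity, of mass 4 pi^2, and Q a majorant of (u z - u) P. *)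
pose P (x : R4 R) := 24 * a ^+ 2 * (s x + a) ^- 4.
have p0 : 0 < (pi : R) ^+ 2 by rewrite exprn_gt0// pi_gt0.
have m n : measurable_fun [set: M4 R] (fun x => (s x + a) ^- n).
  by apply: continuous4_measurable; exact: continuous_sqdist_inv.
have mP : measurable_fun [set: M4 R] P by apply: measurable_funM; [exact: measurable_cst|exact: m].
have mu : measurable_fun [set: M4 R] u.
  have -> : u = u \_ B.
    by apply/funext => x; rewrite patchE; case: ifPn => // /negP xB; rewrite u0// => Bx; apply: xB; rewrite inE.
  by apply/(measurable_restrictT u mB); case: u2.
have int k (c : R) : 0 <= c ->
   (\int[lebesgue4]_x (c * (k.+2`!%:R / (s x + a) ^+ k.+3))%:E = (c * (pi ^+ 2 * k`!%:R / a ^+ k.+1))%:E)%E.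
  move=> c0; rewrite [RHS]EFinM -(integral_sqdist_inv z k a0) -ge0_integralZl_EFin//.
  - by move=> x _; rewrite lee_fin divr_ge0// exprn_ge0// ltW.
  - apply/measurable_EFinP; apply: measurable_funM; [exact: measurable_cst|exact: m].
have iP : (\int[lebesgue4]_x (P x)%:E = (4 * pi ^+ 2)%:E)%E.
  have := int 1%N (4 * a ^+ 2) (mulr_ge0 (ler0n _ _) (sqr_ge0 _)).
  rewrite (_ : 4 * a ^+ 2 * (_ / _) = 4 * pi ^+ 2); last by rewrite mulr1; field; rewrite gt_eqF.
  by move=> <-; apply: eq_integral => x _; rewrite /P; congr EFin; rewrite (_ : 3`! = 6)%N//; ring.
pose Q (x : R4 R) := H * eps `^ alpha * (24 * a * (s x + a) ^- 3).
have HQ0 : 0 <= H * eps `^ alpha by rewrite mulr_ge0// powR_ge0.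
have iQ : (\int[lebesgue4]_x (Q x)%:E = (12 * pi ^+ 2 * (H * eps `^ alpha))%:E)%E.
  have := int 0%N (H * eps `^ alpha * 12 * a) (mulr_ge0 (mulr_ge0 HQ0 (ler0n _ _)) (ltW a0)).
  rewrite (_ : _ * a * (_ / _) = 12 * pi ^+ 2 * (H * eps `^ alpha)); last by rewrite fact0 mulr1 expr1; field; rewrite gt_eqF.
  by move=> <-; apply: eq_integral => x _; rewrite /Q; congr EFin; rewrite (_ : 2`! = 2)%N//; ring.
have uzQ x : `|(u z - u x) * P x| <= Q x.
  have Px0 : 0 <= P x by rewrite mulr_ge0 ?invr_ge0 ?exprn_ge0 ?(ltW (sa _))// mulr_ge0// sqr_ge0.
  rewrite normrM (ger0_norm Px0).
  pose rho := enorm (x - z) / eps.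
  have rho0 : 0 <= rho by rewrite divr_ge0 ?(ltW e0)// enormE sqrtr_ge0.
  have rho2 : rho ^+ 2 = s x / a by rewrite /rho expr_div_n enorm_sqr.
  have step : `|u z - u x| <= H * eps `^ alpha * ((s x + a) / a).
    rewrite distrC; apply: le_trans (holder x z) _.
    have -> : enorm (x - z) = eps * rho by rewrite /rho mulrC divfK// gt_eqF.
    rewrite powRM ?(ltW e0)// mulrA ler_wpM2l//.
    apply: le_trans (powR_le1Dsqr al01 rho0) _.
    by rewrite rho2 mulrDl divff ?gt_eqF// addrC.
  apply: le_trans (ler_wpM2r Px0 step) _.
  rewrite /Q /P -subr_ge0 (_ : _ - _ = 0)//.
  by field; rewrite !gt_eqF.
have mQ : measurable_fun [set: M4 R] Q.
  by do 2 (apply: measurable_funM; first exact: measurable_cst); exact: m.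
have P0 x : 0 <= P x by rewrite mulr_ge0 ?invr_ge0 ?exprn_ge0 ?(ltW (sa _))// mulr_ge0// sqr_ge0.
have Q0 x : 0 <= Q x by apply: le_trans (uzQ x).
have iiP : lebesgue4.-integrable [set: M4 R] (EFin \o P).
  apply/integrableP; split; first exact/measurable_EFinP.
  under eq_integral do rewrite gee0_abs ?lee_fin//.
  by rewrite iP ltry.
have iiQ : lebesgue4.-integrable [set: M4 R] (EFin \o Q).
  apply/integrableP; split; first exact/measurable_EFinP.
  under eq_integral do rewrite gee0_abs ?lee_fin//.
  by rewrite iQ ltry.
have iiu : lebesgue4.-integrable [set: M4 R] (fun x => ((u z - u x) * P x)%:E).
  apply: le_integrable iiQ => //.
    apply/measurable_EFinP; apply: measurable_funM => //; apply: measurable_funB => //.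
  by move=> x _; rewrite lee_fin (ger0_norm (Q0 x)).
have J1 : `|\int[lebesgue4]_x ((u z - u x) * P x)| <= 12 * pi ^+ 2 * (H * eps `^ alpha).
  apply: le_trans (le_normr_Rintegral measurableT iiu) _.
  rewrite -[leRHS]/(fine (12 * pi ^+ 2 * (H * eps `^ alpha))%:E) -iQ.
  apply: le_Rintegral => //.
  exact: (integrable_norm iiu).
have J2 : u z * (4 * pi ^+ 2) = \int[lebesgue4]_x ((u z - u x) * P x) + \int[lebesgue4]_x (u x * P x).
  have iiuP : lebesgue4.-integrable [set: M4 R] (fun x => (u x * P x)%:E).
    have H1 : lebesgue4.-integrable [set: M4 R] (fun x => (u z * P x)%:E).
      by under eq_fun do rewrite EFinM; exact: integrableZl.
    apply: eq_integrable (integrableB measurableT H1 iiu) => // x _.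
    by rewrite /= -EFinB -mulrBl opprB addrC subrK.
  rewrite -RintegralD//.
  under eq_Rintegral do rewrite -mulrDl subrK.
  by rewrite RintegralZl// /Rintegral iP.
have J3 : \int[lebesgue4]_x (u x * P x) = - \int[lebesgue4]_(x in B) (laplacian B u x * bubble z a x).
  rewrite -(H20_green hu (smooth_bubble z a0)).
  rewrite -integral_unit_ball; last by move=> x xB; rewrite u0// mul0r.
  under [in RHS]eq_Rintegral do rewrite laplacian_bubble//.
  rewrite -mulN1r -RintegralZl; last 2 first.
  - exact: mB.
  - apply: (L2_CauchySchwarz u2 _).1; apply: inL2_continuous.
    move=> x; apply: cvgN; apply: cvgM; first exact: cvg_cst.
    exact: continuous_sqdist_inv.
  by apply: eq_Rintegral => x _; rewrite mulN1r mulrN opprK.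
have J4 : `|\int[lebesgue4]_(x in B) (laplacian B u x * bubble z a x)| <= D * nL2 (bubble z a).
  apply: (L2_CauchySchwarz _ _).2; first exact: inL2_laplacian.
  exact/inL2_continuous/smooth_continuous/smooth_bubble.
have D0 : 0 <= D by exact: nL2_ge0.
have b0 : 0 <= nL2 (bubble z a) by exact: nL2_ge0.
have bub := nL2_bubble_sqrt z e0 e1.
have p4 : 0 < 4 * (pi : R) ^+ 2 by rewrite mulr_gt0.
rewrite -(ler_pM2l p4) mulrC -[X in _ * X <= _](ger0_norm (ltW p4)) -normrM J2 J3.
apply: le_trans (ler_normB _ _) _.
rewrite mulrDr addrC; apply: lerD.
  apply: le_trans J4 _; rewrite mulrCA; exact: ler_wpM2l.
apply: le_trans J1 _; rewrite le_eqVlt; apply/orP; left; apply/eqP; ring.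
Qed.

End core.

(** * Optimisation of the scale *)

Section optimisation.
Context {R : realType}.

Lemma expR1_ge1 : 1 <= expR 1 :> R.
Proof. by rewrite -[leLHS]expR0 ler_expR. Qed.

Lemma ln_2e_ge1 (N : R) : 0 <= N -> 1 <= ln (2 * expR 1 + N).
Proof.
move=> N0; rewrite -[leLHS](expRK 1) ler_ln ?posrE ?expR_gt0//.
- by have := expR_ge0 (1 : R); lra.
- by have := expR_gt0 (1 : R); lra.
Qed.

Lemma ln_le_id (t : R) : 0 < t -> ln t <= t.
Proof.
move=> t0; have := @expR_ge1Dx R (ln t); rewrite lnK ?posrE//; lra.
Qed.

(** Here N = H / D, y = |u(z)| / D and q = 8 pi^2.  For X = N sqrt (log (2 e + N)) above
    a threshold x0 the scale is (1 + X)^(-1 / alpha); below x0, y <= 2 N is so small that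
    log (e^3) = 3 suffices. *)
Lemma log_optimisation (alpha q : R) : 0 < alpha -> 0 < q ->
  exists2 C, 0 < C & forall N y, 0 <= N -> 0 <= y -> y <= 2 * N ->
    (forall eps, 0 < eps <= 1 -> y <= Num.sqrt ((3 - ln eps) / q) + 3 * N * eps `^ alpha) ->
    y ^+ 2 <= 1 / (q * alpha) * ln (expR 3 + C * N * Num.sqrt (ln (2 * expR 1 + N))).
Proof.
move=> a0 q0; have qa0 : 0 < q * alpha by exact: mulr_gt0.
(* K bounds the squared first term by K times log (2 e + N); c collects the
   bounded terms, later absorbed as the factor E inside the logarithm. *)
pose K := (3 + 2 / alpha) / q.
have K0 : 0 < K by rewrite divr_gt0// addr_gt0// divr_gt0.
pose c := 3 / q + 6 * Num.sqrt K + 9.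
pose E := expR (q * alpha * c).
pose x0 := Num.sqrt (3 / (4 * (q * alpha))).
have x00 : 0 < x0 by rewrite sqrtr_gt0 divr_gt0// mulr_gt0.
have E0 : 0 < E by exact: expR_gt0.
exists (E * (1 + x0^-1)) => [|N y N0 y0 y2N hy].
  by rewrite mulr_gt0// addr_gt0// invr_gt0.
have := ln_2e_ge1 N0; set L := ln _ => L1.
have L0 : 0 < L by exact: lt_le_trans L1.
have sL1 : 1 <= Num.sqrt L by rewrite -[leLHS]sqrtr1 ler_wsqrtr.
have sL0 : 0 < Num.sqrt L by exact: lt_le_trans sL1.
pose X := N * Num.sqrt L.
have X0 : 0 <= X by rewrite mulr_ge0// ltW.
have NX : N <= X by rewrite /X ler_peMr.
rewrite -(mulrA _ N) -/X.
have qaI0 : 0 < 1 / (q * alpha) by rewrite divr_gt0.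
have CX0 : 0 <= E * (1 + x0^-1) * X.
  by rewrite mulr_ge0// mulr_ge0 ?(ltW E0)// addr_ge0// invr_ge0 ltW.
have e30 : 0 < expR 3 :> R by exact: expR_gt0.
have [Xx0|x0X] := leP X x0.
  apply: (@le_trans _ _ (1 / (q * alpha) * 3)).
    have y2 : y <= 2 * x0 by apply: le_trans y2N _; rewrite ler_wpM2l// (le_trans NX).
    apply: (@le_trans _ _ ((2 * x0) ^+ 2)); first by rewrite lerXn2r ?nnegrE// (le_trans y0).
    rewrite exprMn /x0 sqr_sqrtr; last by rewrite divr_ge0// mulr_ge0// ltW.
    rewrite le_eqVlt; apply/orP; left; apply/eqP; field.
    by rewrite !gt_eqF.
  rewrite ler_pM2l// -[leLHS]expRK ler_ln ?posrE//; last by rewrite ltr_wpDr.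
  by rewrite lerDl.
have X10 : 0 < 1 + X by rewrite ltr_wpDr.
pose eps := (1 + X) `^ (- alpha^-1).
have eps0 : 0 < eps by rewrite powR_gt0.
have eps1 : eps <= 1.
  rewrite /eps -[leRHS](powRr0 (1 + X)) ler_powR// ?lerDl//.
  by rewrite oppr_le0 invr_ge0 ltW.
have epsa : eps `^ alpha = (1 + X)^-1.
  by rewrite /eps -powRrM mulNr mulVf ?gt_eqF// powR_inv1// ltW.
have lneps : - ln eps = ln (1 + X) / alpha by rewrite /eps ln_powR mulNr opprK mulrC.
have := hy eps; rewrite eps0 eps1 epsa => /(_ isT).
rewrite lneps; set W := (3 + _) / q => hyW.
have lnX0 : 0 <= ln (1 + X) by rewrite ln_ge0// lerDl.
have W0 : 0 <= W by rewrite divr_ge0 ?(ltW q0)// addr_ge0// divr_ge0// ltW.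
have lnX : ln (1 + X) <= 2 * L.
  have t0 : 0 < 2 * expR 1 + N by rewrite ltr_wpDr// mulr_gt0// expR_gt0.
  rewrite /L mulr_natl -lnXn// ler_ln ?posrE ?exprn_gt0//.
  have sLt : Num.sqrt L <= 2 * expR 1 + N.
    apply: (@le_trans _ _ L); last exact: ln_le_id.
    rewrite -[leRHS](sqr_sqrtr (ltW L0)) expr2 ler_peMr// sqrtr_ge0.
  have := ler_wpM2l N0 sLt; rewrite -/X.
  have := expR1_ge1; move: (expR 1) => e e1 XN.
  clear - XN e1 N0; move: X XN => X XN; nra.
have WK : W <= K * L.
  rewrite /W /K mulrAC ler_pM2r ?invr_gt0//.
  rewrite mulrDl; apply: lerD; first by rewrite ler_peMr.
  by rewrite mulrAC ler_pM2r// invr_gt0.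
have sW : Num.sqrt W <= Num.sqrt K * Num.sqrt L.
  by rewrite -(sqrtrM _ (ltW K0)) ler_wsqrtr.
have NX1 : N * (1 + X)^-1 <= (Num.sqrt L)^-1.
  rewrite ler_pdivrMr// mulrC ler_pdivlMr// -/X lerDr//.
have sWN : Num.sqrt W * (N * (1 + X)^-1) <= Num.sqrt K.
  apply: (@le_trans _ _ (Num.sqrt K * Num.sqrt L * (Num.sqrt L)^-1)).
    by apply: ler_pM => //; rewrite ?sqrtr_ge0// mulr_ge0// invr_ge0 ltW.
  by rewrite mulfK// gt_eqF.
have N1 : N * (1 + X)^-1 <= 1.
  by apply: le_trans NX1 _; rewrite invf_le1.
have N00 : 0 <= N * (1 + X)^-1 by rewrite mulr_ge0// invr_ge0 ltW.
have y2 : y ^+ 2 <= W + 6 * Num.sqrt K + 9.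
  have s2 := sqr_sqrtr W0.
  have sW0 := sqrtr_ge0 W.
  move: hyW; rewrite -mulrA.
  clear - sWN N1 N00 y0 s2 sW0.
  move: s2 sW0 sWN N1 N00.
  move: W (N * (1 + X)^-1) (Num.sqrt K) (Num.sqrt W) => w n k r <- r0 h1 h2 h3 h4.
  have : y ^+ 2 <= (r + 3 * n) ^+ 2 by rewrite lerXn2r ?nnegrE ?addr_ge0 ?mulr_ge0.
  nra.
apply: le_trans y2 _.
have -> : W + 6 * Num.sqrt K + 9 = 1 / (q * alpha) * (ln (1 + X) + q * alpha * c).
  rewrite /W /c; clear - q0 a0; move: (Num.sqrt K) (ln (1 + X)) => k l; field.
  by rewrite !gt_eqF.
rewrite ler_pM2l// -[q * alpha * c]expRK -lnM ?posrE// ler_ln ?posrE ?mulr_gt0//; last by rewrite ltr_wpDr.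
apply: (@le_trans _ _ (E * (1 + x0^-1) * X)); last by rewrite lerDr ltW.
rewrite mulrC -/E -mulrA ler_pM2l// mulrDl mul1r addrC lerD2l.
by rewrite mulrC ler_pdivlMr// mul1r ltW.
Qed.

End optimisation.

(** * The inequality with the constant 1 / (8 pi^2 alpha) *)

Section upper_bound.
Context {R : realType}.
Notation B := (@unit_ball R).
Implicit Types u : R4 R -> R.

Lemma Linfnorm_le u (M : R) : 0 <= M -> (forall x, `|u x| <= M) ->
  (Linfnorm B u <= M%:E)%E.
Proof.
move=> M0 uM; rewrite /Linfnorm unlock; case: ifPn => _; last by rewrite lee_fin.
apply/ess_supP; apply: nearW => x /=; rewrite lee_fin patchE.
by case: ifPn => _; rewrite ?normr0.
Qed.

Lemma Linfnorm_ge0 u : (0 <= Linfnorm B u)%E.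
Proof. exact: Lnorm_ge0. Qed.

Lemma Linfnorm_sqr_le u (T : R) : 0 <= T -> (forall x, `|u x| ^+ 2 <= T) ->
  (Linfnorm B u ^+ 2 <= T%:E)%E.
Proof.
move=> T0 uT; have : (Linfnorm B u <= (Num.sqrt T)%:E)%E.
  apply: Linfnorm_le => [|x]; first exact: sqrtr_ge0.
  by rewrite -(ler_pXn2r (n := 2)) ?nnegrE ?sqrtr_ge0// sqr_sqrtr.
have := Linfnorm_ge0 u; case: (Linfnorm B u) => // r.
move=> r0 rT; rewrite expe2 -EFinM lee_fin -expr2; move: r0 rT; rewrite !lee_fin => r0 rT.
by rewrite -(sqr_sqrtr T0) lerXn2r ?nnegrE ?sqrtr_ge0.
Qed.

(** Compare with the boundary point (1, 0, 0, 0), where u vanishes. *)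
Lemma holder_le2 (alpha : R) u z : 0 < alpha < 1 -> H20rad_holder alpha u ->
  `|u z| <= 2 * fine (holder_seminorm alpha u).
Proof.
move=> /andP[a0 a1] [_ _ u0 Hfin]; have [H0 holder] := holderP a0 Hfin.
have [zB|/u0->] := pselect (B z); last by rewrite normr0 mulr_ge0.
pose e : R4 R := (1, 0, 0, 0).
have ue : u e = 0.
  apply: u0 => /unit_ballP; rewrite sqnormE /=.
  by rewrite expr1n expr0n/= !addr0 ltxx.
have := holder z e; rewrite ue subr0 mulrC => H; apply: le_trans H _.
apply: ler_wpM2r => //.
have n2 : enorm (z - e) <= 2.
  rewrite enormE -[leRHS]ger0_norm// -sqrtr_sqr ler_wsqrtr//.
  have := zB => /unit_ballP; rewrite !sqnormE /=.
  case: z {zB} => [[[z0 z1] z2] z3] /=.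
  by rewrite !subr0; nra.
apply: (@le_trans _ _ (2 `^ alpha)).
  by apply: ge0_ler_powR; rewrite ?nnegrE ?(ltW a0)// enormE sqrtr_ge0.
by rewrite -[leRHS]powRr1// ler_powR ?ler1n ?(ltW a1).
Qed.

(** It remains to exclude D = 0: then the pointwise estimate leaves only the term
    3 H eps^alpha, which tends to 0, so u = 0. *)
Theorem log_inequality_holds (alpha : R) : 0 < alpha < 1 ->
  exists C, 0 < C /\ log_inequality alpha (1 / (8 * pi ^+ 2 * alpha)) C.
Proof.
move=> al01; have /andP[a0 a1] := al01.
have q0 : 0 < 8 * (pi : R) ^+ 2 by rewrite mulr_gt0// exprn_gt0// pi_gt0.
have [C C0 HC] := log_optimisation a0 q0.
exists C; split=> // u hu [z0 uz0].
have [hu1 _ u0 Hfin] := hu.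
have [H0 _] := holderP a0 Hfin.
have core z eps := @core_estimate R alpha u z eps al01 hu1 u0 Hfin.
have h2 z := holder_le2 z al01 hu.
rewrite /Nratio -/(nL2 (laplacian B u)).
move: (fine (holder_seminorm alpha u)) H0 core h2 => H H0 core h2.
have := nL2_ge0 (laplacian B u).
move: (nL2 (laplacian B u)) core => D core.
rewrite le_eqVlt => /orP[/eqP D0|D0].
  exfalso; move/eqP : uz0; apply; apply/eqP; rewrite -normr_le0 leNgt; apply/negP => uz0.
  (* t is a value of eps^alpha for which 3 H eps^alpha is below |u z0|. *)
  pose t := Num.min 1 (`|u z0| / (3 * H + 1)).
  have H1 : 0 < 3 * H + 1 by rewrite ltr_wpDl// mulr_ge0.
  have t0 : 0 < t by rewrite lt_min ltr01 divr_gt0.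
  have t1 : t <= 1 by rewrite ge_min lexx.
  have e01 : 0 < t `^ alpha^-1 <= 1.
    rewrite powR_gt0//=; have -> : 1 = 1 `^ alpha^-1 :> R by rewrite powR1.
    by apply: ge0_ler_powR => //; rewrite ?nnegrE ?invr_ge0 ?ltW.
  have := core z0 _ e01; rewrite -D0 mul0r add0r -powRrM mulVf ?gt_eqF// powRr1 ?(ltW t0)//.
  apply/negP; rewrite -ltNge.
  apply: (@lt_le_trans _ _ ((3 * H + 1) * t)); first by rewrite ltr_pM2r// ltrDl.
  by rewrite mulrC -ler_pdivlMr// ge_min lexx orbT.
have N0 : 0 <= H / D by rewrite divr_ge0// ltW.
apply: Linfnorm_sqr_le => [|z].
  have qa : 0 <= 1 / (8 * (pi : R) ^+ 2 * alpha) by apply: divr_ge0 => //; exact: ltW (mulr_gt0 q0 a0).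
  apply: mulr_ge0; first by apply: mulr_ge0 => //; exact: sqr_ge0.
  apply: ln_ge0; apply: (@le_trans _ _ (expR 3)); first by rewrite -[leLHS]expR0 ler_expR.
  by rewrite lerDl; exact: (mulr_ge0 (mulr_ge0 (ltW C0) N0) (sqrtr_ge0 _)).
have -> : `|u z| = D * (`|u z| / D) by rewrite mulrC divfK// gt_eqF.
rewrite exprMn [leRHS]mulrAC [leRHS]mulrC ler_pM2l ?exprn_gt0//.
apply: HC => //.
- by rewrite divr_ge0// ltW.
- by rewrite mulrA ler_pM2r ?invr_gt0.
- move=> eps e01; have := core z eps e01.
  rewrite -(ler_pM2r (x := D^-1)) ?invr_gt0// mulrDl mulrAC divff ?gt_eqF// mul1r.
  by rewrite -!mulrA [eps `^ _ * _]mulrC.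
Qed.

End upper_bound.

(** * Arithmetic of the sharpness argument *)

Section sharp_arith.
Context {R : realType}.

Lemma expR1_ge2 : 2 <= expR 1 :> R.
Proof. by have := expR_ge1Dx (1 : R); lra. Qed.

(** N <= L e^(alpha L) makes the argument of the logarithm at most e^(alpha L) times a
    polynomial in L, and the polynomial is below e^(beta L) once L is large; the
    threshold comes from y^3 <= 27 e^y. *)
Lemma ln_growth (alpha beta C L N : R) : 0 < alpha < 1 -> 0 < beta -> 0 < C -> 2 <= L ->
  27 * (expR 3 + 3 * C) / beta ^+ 3 <= L ->
  0 <= N -> N <= L * expR (alpha * L) ->
  ln (expR 3 + C * N * Num.sqrt (ln (2 * expR 1 + N))) <= (alpha + beta) * L.
Proof.
move=> /andP[al0 al1] b0 C0 L2 Lbig N0 NL.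
have L0 : 0 < L by lra.
have eL : L <= expR L by have := expR_ge1Dx L; lra.
have e1 := expR1_ge2.
have ea1 : 1 <= expR (alpha * L) by rewrite -[leLHS]expR0 ler_expR mulr_ge0 ?ltW.
have eaL : expR (alpha * L) <= expR L by rewrite ler_expR ler_piMl ?ltW.
have NL2 : N <= expR L ^+ 2.
  apply: le_trans NL _; rewrite expr2; apply: ler_pM; rewrite ?expR_ge0 ?(ltW L0)//.
have le3 : ln (2 * expR 1 + N) <= 3 * L.
  rewrite -[leRHS]expRK ler_ln ?posrE ?expR_gt0//; last first.
    by rewrite ltr_wpDr// mulr_gt0// expR_gt0.
  rewrite expRM_natl.
  have eL1 : expR 1 <= expR L by rewrite ler_expR; lra.
  have e4 : 4 <= expR L.
    apply: (@le_trans _ _ (expR 2)); last by rewrite ler_expR.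
    rewrite -[expR 2](_ : expR 1 ^+ 2 = _); last by rewrite -expRM_natl mulr1.
    by move: e1; move: (expR 1) => e e1; nra.
  move: (expR L) (expR 1) NL2 eL1 e4 => E e NL2 eE E4.
  have : 0 <= E * E by nra.
  nra.
have l1 : 1 <= ln (2 * expR 1 + N) by exact: ln_2e_ge1.
have sq : Num.sqrt (ln (2 * expR 1 + N)) <= 3 * L.
  apply: le_trans le3; have l0 : 0 <= ln (2 * expR 1 + N) by exact: le_trans ler01 l1.
  rewrite -[leRHS](sqr_sqrtr l0) expr2 ler_peMr ?sqrtr_ge0//.
  by rewrite -[leLHS]sqrtr1 ler_wsqrtr.
have e3 : 0 < expR 3 :> R by exact: expR_gt0.
rewrite -[leRHS]expRK ler_ln ?posrE ?expR_gt0//; last first.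
  by rewrite ltr_wpDr// mulr_ge0 ?sqrtr_ge0// mulr_ge0// ltW.
apply: (@le_trans _ _ (expR 3 + C * (L * expR (alpha * L)) * (3 * L))).
  rewrite lerD2l.
  exact: (ler_pM (mulr_ge0 (ltW C0) N0) (sqrtr_ge0 _) (ler_wpM2l (ltW C0) NL) sq).
have cube : (beta * L) ^+ 3 <= 27 * expR (beta * L).
  have := @exprn_le_expR R 3 (beta * L) (mulr_ge0 (ltW b0) (ltW L0)).
  by rewrite (_ : 3%:R ^+ 3 = 27)// -natrX.
have ebL : expR 3 + 3 * C * L ^+ 2 <= expR (beta * L).
  rewrite -(@ler_pM2l _ 27)//; apply: le_trans cube.
  rewrite exprMn; move: Lbig; rewrite ler_pdivrMr ?exprn_gt0// => Lbig.
  move: (beta ^+ 3) (expR 3) Lbig e3 => b e Lbig e3.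
  have h : 27 * (e + 3 * C) * L ^+ 2 <= L * b * L ^+ 2 by rewrite ler_wpM2r// sqr_ge0.
  have L21 : 1 <= L ^+ 2 by rewrite expr2; nra.
  have h2 : 27 * e * 1 <= 27 * e * L ^+ 2 by rewrite ler_wpM2l// mulr_ge0// ltW.
  lra.
rewrite [leRHS](_ : _ = expR (alpha * L) * expR (beta * L)); last by rewrite mulrDl expRD.
apply: (@le_trans _ _ (expR (alpha * L) * (expR 3 + 3 * C * L ^+ 2))); last by rewrite ler_pM2l ?expR_gt0.
move: (expR (alpha * L)) ea1 => A A1; rewrite mulrDr; apply: lerD.
  by rewrite ler_peMl// ltW.
by rewrite le_eqVlt; apply/orP; left; apply/eqP; ring.
Qed.

Lemma cube_margin (r : R) : 0 < r -> r < 1 -> r * (1 + (1 - r) / 8) ^+ 3 < 1.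
Proof.
move=> r0 r1; set t := (1 - r) / 8.
have rt : r = 1 - 8 * t by rewrite /t mulrC divfK// subKr.
have t0 : 0 < t by rewrite /t divr_gt0// subr_gt0.
have t8 : t < 1 / 8 by move: r0; rewrite rt; lra.
have h : (1 + t) ^+ 3 <= 1 + 4 * t by rewrite !exprS expr0; clear - t0 t8; nra.
apply: le_lt_trans (ler_wpM2l (ltW r0) h) _.
by rewrite rt; clear - t0 t8; nra.
Qed.

(** With r = 8 p alpha lambda < 1 and sg = 1 + (1 - r) / 8, the parameter delta is such
    that 2 + 27 delta = 2 sg, and beta such that alpha + beta = alpha sg.  The inequality
    would then give (L - c)^2 <= r sg^3 L (L + 3) with r sg^3 < 1 ([cube_margin]), which
    fails for L large.  Passing from N = H / D to H needs D >= 1, which follows from the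
    hypothesis on eta at eta = e^(-L) / 12^(1 / alpha): there the Hoelder term is at most
    L / 4. *)
Lemma sharp_arith (alpha lambda C p : R) : 4 <= p -> 0 < alpha < 1 -> 0 < lambda ->
  lambda * (8 * p * alpha) < 1 -> 0 < C ->
  exists delta L, [/\ 0 < delta, 2 <= L, 1 / 2 + 1 / delta < L & forall D H, 0 <= H -> H <= L * expR (alpha * L) ->
    0 <= D -> D ^+ 2 <= (2 + 27 * delta) ^+ 2 * (16 + 2 * p + 2 * p * L) ->
    (forall eta, 0 < eta <= 1 ->
      L - 1 / 2 - 1 / delta <= D * Num.sqrt ((3 - ln eta) / (8 * p)) + 3 * H * eta `^ alpha) ->
    (L - 1 / 2 - 1 / delta) ^+ 2 <=
      lambda * D ^+ 2 * ln (expR 3 + C * (H / D) * Num.sqrt (ln (2 * expR 1 + H / D))) -> False].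
Proof.
move=> p4 al01 l0; have /andP[al0 al1] := al01.
set r := lambda * _ => r1 C0.
have r0 : 0 < r by rewrite /r !mulr_gt0//; lra.
pose t := (1 - r) / 8.
have t0 : 0 < t by rewrite /t; lra.
pose sg := 1 + t.
pose kp := r * sg ^+ 3.
have kp1 : kp < 1 by rewrite /kp /sg /t; clear - r0 r1; move: r r0 r1 => r r0 r1; exact: cube_margin.
have kp0 : 0 < kp by rewrite /kp mulr_gt0// exprn_gt0// /sg ltr_wpDl.
pose delta := 2 * t / 27.
have d0 : 0 < delta by rewrite /delta; lra.
pose beta := alpha * t.
have b0 : 0 < beta by exact: mulr_gt0.
(* Rescaling eta by kap multiplies eta^alpha by 1 / 12. *)
pose kap : R := (12^-1) `^ alpha^-1.
have kap0 : 0 < kap by rewrite powR_gt0// invr_gt0.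
have kapa : kap `^ alpha = 12^-1 by rewrite -powRrM mulVf ?gt_eqF// powRr1// invr_ge0.
have kap1 : kap <= 1.
  have -> : 1 = 1 `^ alpha^-1 :> R by rewrite powR1.
  by apply: ge0_ler_powR; rewrite ?nnegrE ?invr_ge0 ?(ltW al0)// invf_le1// ler1n.
pose c := 1 / 2 + 1 / delta.
have c0 : 0 < c by rewrite /c addr_gt0// divr_gt0.
pose k0 := - ln kap.
have k00 : 0 <= k0 by rewrite /k0 oppr_ge0 ln_le0.
pose T1 := 27 * (expR 3 + 3 * C) / beta ^+ 3.
have T10 : 0 <= T1 by rewrite /T1 divr_ge0 ?exprn_ge0 ?(ltW b0)// mulr_ge0// addr_ge0 ?expR_ge0// mulr_ge0// ltW.
pose T2 := (2 * c + 3) / (1 - kp).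
have T20 : 0 <= T2 by rewrite /T2 divr_ge0 ?subr_ge0 ?(ltW kp1)// addr_ge0// mulr_ge0// ltW.
(* L exceeds all the thresholds below; a sum avoids nested maxima. *)
pose L := 2 + 2 * c + 16 * (4 + k0) + T1 + T2 + 1.
exists delta, L.
have L2 : 2 <= L by rewrite /L; clear - c0 k00 T10 T20; move: c k0 T1 T2 c0 k00 T10 T20 => *; lra.
have Lc : 2 * c <= L by rewrite /L; clear - c0 k00 T10 T20; move: c k0 T1 T2 c0 k00 T10 T20 => *; lra.
have Lk : 16 * (4 + k0) <= L by rewrite /L; clear - c0 k00 T10 T20; move: c k0 T1 T2 c0 k00 T10 T20 => *; lra.
have LT1 : T1 <= L by rewrite /L; clear - c0 k00 T10 T20; move: c k0 T1 T2 c0 k00 T10 T20 => *; lra.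
have LT2 : T2 < L by rewrite /L; clear - c0 k00 T10 T20; move: c k0 T1 T2 c0 k00 T10 T20 => *; lra.
have L0 : 0 < L by exact: lt_le_trans L2.
have k0E : ln kap = - k0 by rewrite /k0 opprK.
have cE : L - 1 / 2 - 1 / delta = L - c by rewrite /c opprD addrA.
clearbody L k0 c.
split=> //; first by rewrite -subr_gt0 opprD addrA cE; clear - c0 Lc; lra.
move=> D H H0 HL D0 D2 core main.
rewrite cE in core main.
have D1 : 1 <= D.
  have e1 : 0 < kap * expR (- L) <= 1.
    rewrite mulr_gt0 ?expR_gt0//= mulr_ile1 ?expR_ge0 ?(ltW kap0)//.
    by rewrite -[leRHS]expR0 ler_expR oppr_le0 ltW.
  have := core _ e1; rewrite lnM ?posrE ?expR_gt0// expRK.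
  rewrite powRM ?expR_ge0 ?(ltW kap0)// kapa.
  have -> : expR (- L) `^ alpha = (expR (alpha * L))^-1.
    by rewrite /powR gt_eqF ?expR_gt0// expRK mulrN expRN.
  have Hs : 3 * H * (12^-1 * (expR (alpha * L))^-1) <= L / 4.
    rewrite (_ : _ * _ = H / expR (alpha * L) / 4); last by field; rewrite gt_eqF// expR_gt0.
    by rewrite ler_pM2r ?invr_gt0// ler_pdivrMr ?expR_gt0.
  have pp : 0 <= (3 - (ln kap - L)) / (8 * p).
    apply: divr_ge0; last by clear - p4; lra.
    by rewrite k0E; clear - L0 k00; lra.
  have Sq : Num.sqrt ((3 - (ln kap - L)) / (8 * p)) <= L / 4.
    rewrite -(ler_pXn2r (n := 2)) ?nnegrE ?sqrtr_ge0 ?divr_ge0 ?(ltW L0)// sqr_sqrtr//.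
    rewrite ler_pdivrMr; last by clear - p4; lra.
    have -> : 3 - (ln kap - L) = 3 + L + k0 by rewrite k0E; ring.
    clear - Lk k00 p4 L2.
    by rewrite expr2; nra.
  move=> h; rewrite leNgt; apply/negP => D1.
  have h2 : D * Num.sqrt ((3 - (ln kap - L)) / (8 * p)) < L / 4.
    apply: (@le_lt_trans _ _ (D * (L / 4))); first by rewrite ler_wpM2l.
    by rewrite gtr_pMl// divr_gt0.
  have absurd (m n l d : R) : l - d <= m + n -> m < l / 4 -> n <= l / 4 -> 2 * d <= l -> 0 < l -> False.
    by clear => *; lra.
  exact: (absurd _ _ _ _ h h2 Hs Lc L0).
have N0 : 0 <= H / D by rewrite divr_ge0.
have NL : H / D <= L * expR (alpha * L).
  by apply: le_trans HL; rewrite ler_pdivrMr ?(lt_le_trans ltr01)// ler_peMr.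
have lnle := ln_growth al01 b0 C0 L2 LT1 N0 NL.
have ln0 : 0 <= ln (expR 3 + C * (H / D) * Num.sqrt (ln (2 * expR 1 + H / D))).
  apply: ln_ge0; apply: (@le_trans _ _ (expR 3)); first by rewrite -[leLHS]expR0 ler_expR.
  by rewrite lerDl; exact: (mulr_ge0 (mulr_ge0 (ltW C0) N0) (sqrtr_ge0 _)).
have : (L - c) ^+ 2 <= kp * L * (L + 3).
  apply: le_trans main _.
  apply: (@le_trans _ _ (lambda * ((2 + 27 * delta) ^+ 2 * (16 + 2 * p + 2 * p * L)) * ((alpha + beta) * L))).
    apply: ler_pM => //; first by rewrite mulr_ge0 ?sqr_ge0// ltW.
    by rewrite ler_pM2l.
  have -> : 2 + 27 * delta = 2 * sg by rewrite /delta /sg; clear; move: t => t; field.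
  have -> : alpha + beta = alpha * sg by rewrite /beta /sg mulrDr mulr1.
  have -> : lambda * ((2 * sg) ^+ 2 * (16 + 2 * p + 2 * p * L)) * (alpha * sg * L) =
            (lambda * alpha * sg ^+ 3 * L) * (4 * (16 + 2 * p + 2 * p * L)) by ring.
  have -> : kp * L * (L + 3) = (lambda * alpha * sg ^+ 3 * L) * (8 * p * (L + 3)).
    by rewrite /kp /r; ring.
  rewrite ler_wpM2l//.
    by rewrite !mulr_ge0 ?exprn_ge0 ?ltW// /sg ltr_wpDl// ltW.
  clear - p4; lra.
apply/negP; rewrite -ltNge.
move: LT2; rewrite /T2 ltr_pdivrMr ?subr_gt0// => LT2.
clear - LT2 L0 c0 kp1 kp0; move: L LT2 L0 => L LT2 L0; move: c kp c0 kp1 kp0 LT2 => c k c0 k1 k0 LT2.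
have h : 0 < L * (L * (1 - k) - (2 * c + 3 * k)) by apply: mulr_gt0 => //; lra.
have h2 := sqr_ge0 c.
rewrite -subr_gt0 (_ : _ - _ = L * (L * (1 - k) - (2 * c + 3 * k)) + c ^+ 2); last by ring.
by rewrite ltr_pwDl.
Qed.

End sharp_arith.

(** * A smooth ramp with bounded second derivative *)

Section ramp.
Context {R : realType}.
Variable delta : R.
Hypothesis d0 : 0 < delta.

(** t exp (- 1 / (delta t)) for t > 0, and 0 otherwise: a smooth version of the positive
    part, within 1 / delta of it, whose second derivative is of order delta. *)
Definition ramp (t : R) : R := t * flat 1 (delta * t).

Let p1 : {poly R} := (1 - 1^`()) * 'X ^+ 2.
Let p2 : {poly R} := (p1 - p1^`()) * 'X ^+ 2.

Definition ramp1 (t : R) : R := flat 1 (delta * t) + delta * t * flat p1 (delta * t).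
Definition ramp2 (t : R) : R :=
  2 * delta * flat p1 (delta * t) + delta ^+ 2 * t * flat p2 (delta * t).

Let is_derive_flatM p (t : R) :
  is_derive t 1 (fun t : R => flat p (delta * t)) (delta * flat ((p - p^`()) * 'X ^+ 2) (delta * t)).
Proof.
have dl : is_derive t 1 (fun t : R => delta * t) delta.
  by apply: (is_derive_eq (is_deriveZ delta (is_derive_id t (1:R)))); rewrite /GRing.scale/= mulr1.
by apply: (is_derive_eq (is_derive1_comp (is_derive_flat p _) dl)); rewrite mulrC.
Qed.

Lemma is_derive_ramp (t : R) : is_derive t 1 ramp (ramp1 t).
Proof.
apply: (is_derive_eq (is_deriveM (is_derive_id t (1:R)) (is_derive_flatM 1 t))).
by rewrite /ramp1 /GRing.scale/=; ring.
Qed.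

Lemma is_derive_ramp1 (t : R) : is_derive t 1 ramp1 (ramp2 t).
Proof.
have dl : is_derive t 1 (fun t : R => delta * t) delta.
  by apply: (is_derive_eq (is_deriveZ delta (is_derive_id t (1:R)))); rewrite /GRing.scale/= mulr1.
apply: (is_derive_eq (is_deriveD (is_derive_flatM 1 t) (is_deriveM dl (is_derive_flatM p1 t)))).
by rewrite /ramp2 /GRing.scale/= -/p1 -/p2; ring.
Qed.

Let p1E (y : R) : p1.[y] = y ^+ 2.
Proof. by rewrite /p1 derivC subr0 mul1r horner_exp hornerX. Qed.

Let p2E (y : R) : p2.[y] = (y ^+ 2 - 2 * y) * y ^+ 2.
Proof.
rewrite /p2 hornerM horner_exp hornerX hornerD hornerN p1E; congr ((_ - _) * _).
rewrite /p1 derivC subr0 mul1r derivXn /= hornerMn hornerXn expr1.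
by rewrite mulr_natl.
Qed.

Lemma ramp_le0 (t : R) : t <= 0 -> ramp t = 0.
Proof.
move=> t0; rewrite /ramp /flat ifF ?mulr0//; apply/negbTE.
by rewrite -leNgt mulr_ge0_le0// ltW.
Qed.

Lemma ramp_gt0E (t : R) : 0 < t -> ramp t = t * expR (- (delta * t)^-1).
Proof. by move=> t0; rewrite /ramp /flat mulr_gt0// hornerC mul1r. Qed.

Lemma ramp_ge (t : R) : t - delta^-1 <= ramp t.
Proof.
have [t0|t0] := leP t 0.
  by rewrite ramp_le0// subr_le0 (le_trans t0)// invr_ge0 ltW.
rewrite ramp_gt0E//; apply: (@le_trans _ _ (t * (1 + - (delta * t)^-1))).
  by rewrite mulrDr mulr1 mulrN invfM mulrCA divff ?mulr1// gt_eqF.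
by rewrite ler_pM2l// expR_ge1Dx.
Qed.

Lemma ramp_ge0 (t : R) : 0 <= ramp t.
Proof.
have [t0|t0] := leP t 0; first by rewrite ramp_le0.
by rewrite ramp_gt0E// mulr_ge0 ?expR_ge0// ltW.
Qed.

Lemma ramp_le (t l : R) : t <= l -> 0 <= l -> ramp t <= l.
Proof.
move=> tl l0; have [t0|t0] := leP t 0; first by rewrite ramp_le0.
apply: le_trans tl; rewrite ramp_gt0E// ler_piMr ?(ltW t0)//.
by rewrite -[leRHS]expR0 ler_expR oppr_le0 invr_ge0 mulr_ge0// ltW.
Qed.

(** With y = 1 / (delta t) the derivative is (1 + y) exp (- y). *)
Lemma ramp1_bound (t : R) : 0 <= ramp1 t <= 1.
Proof.
rewrite /ramp1 /flat; case: ifPn => dt0; last by rewrite mulr0 addr0 lexx ler01.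
set y := (delta * t)^-1.
have y0 : 0 < y by rewrite invr_gt0.
have dty : delta * t = y^-1 by rewrite /y invrK.
rewrite hornerC p1E mul1r dty expr2.
have -> : expR (- y) + y^-1 * (y * y * expR (- y)) = (1 + y) * expR (- y).
  by field; rewrite gt_eqF.
rewrite mulr_ge0 ?expR_ge0 ?addr_ge0 ?(ltW y0)//=.
by rewrite expRN ler_pdivrMr ?expR_gt0// mul1r expR_ge1Dx.
Qed.

(** With y = 1 / (delta t) the second derivative is delta y^3 exp (- y). *)
Lemma ramp2_bound (t : R) : 0 <= ramp2 t <= 27 * delta.
Proof.
rewrite /ramp2 /flat; case: ifPn => dt0; last by rewrite !mulr0 addr0 lexx mulr_ge0// ltW.
set y := (delta * t)^-1.
have y0 : 0 < y by rewrite invr_gt0.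
have tE : t = (delta * y)^-1 by rewrite /y invfM invrK mulKf// gt_eqF.
rewrite p1E p2E.
have -> : 2 * delta * (y ^+ 2 * expR (- y)) +
    delta ^+ 2 * t * ((y ^+ 2 - 2 * y) * y ^+ 2 * expR (- y)) = delta * (y ^+ 3 * expR (- y)).
  by rewrite tE; field; rewrite !gt_eqF.
rewrite !mulr_ge0 ?expR_ge0 ?exprn_ge0 ?(ltW y0) ?(ltW d0)//= [leLHS]mulrC ler_pM2r//.
rewrite expRN ler_pdivrMr ?expR_gt0//.
have := @exprn_le_expR R 3 y (ltW y0).
by rewrite (_ : 3%:R ^+ 3 = 27)// -natrX.
Qed.

Lemma ramp_lipschitz (t v : R) : `|ramp t - ramp v| <= `|t - v|.
Proof.
wlog tv : t v / t <= v.
  move=> H; have [|/ltW vt] := leP t v; first exact: H.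
  by rewrite distrC [leRHS]distrC; exact: H.
have cr : {within `[t, v], continuous ramp}.
  apply: continuous_subspaceT => x; apply: differentiable_continuous.
  by apply/derivable1_diffP; case: (is_derive_ramp x).
have [c _] := MVT_segment tv (fun x _ => is_derive_ramp x) cr.
rewrite distrC => ->; rewrite normrM distrC ler_piMl//.
by have /andP[c0 c1] := ramp1_bound c; rewrite ger0_norm.
Qed.

End ramp.

(** * The regularised logarithm *)

Section log_profile.
Context {R : realType}.
Variable L : R.
Local Notation s := (sqdist (0 : R4 R)).
Local Notation eps := (expR (- L)).
Local Notation a := (eps ^+ 2).
Implicit Types x y v : R4 R.

Let eps0 : 0 < eps. Proof. exact: expR_gt0. Qed.
Let a0 : 0 < a. Proof. exact: exprn_gt0. Qed.

Let lna : ln a = - (2 * L).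
Proof. by rewrite lnXn// expRK mulNrn mulr_natl. Qed.

Let sa0 x : 0 < s x + a.
Proof. by rewrite ltr_wpDl// sqdist_ge0. Qed.

(** As a function of t = |x|^2 this is log (1 / |x|) regularised at scale exp (- L),
    where it saturates at the value L. *)
Definition log_profile (t : R) : R := - (1 / 2) * ln (t + a).

Lemma log_profile_le (t : R) : 0 <= t -> log_profile t <= L.
Proof.
move=> t0; have : ln a <= ln (t + a).
  by rewrite ler_ln ?posrE// ?lerDr// ltr_wpDl.
by rewrite lna /log_profile; lra.
Qed.

Lemma log_profile_ge (t : R) : 0 <= t -> t <= a -> L - 1 / 2 <= log_profile t.
Proof.
move=> t0 ta; have h : ln (t + a) <= ln (2 * a).
  by rewrite ler_ln ?posrE ?mulr_gt0// ?ltr_wpDl// mulr_natl mulr2n lerD2r.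
have l2 : ln 2 <= 1 :> R.
  by rewrite -[leRHS](expRK 1) ler_ln ?posrE ?expR_gt0//; exact: expR_ge1Dx.
by move: h; rewrite lnM ?posrE// lna /log_profile; lra.
Qed.

Lemma log_profile_le0 (t : R) : 1 <= t + a -> log_profile t <= 0.
Proof. by move=> /ln_ge0; rewrite /log_profile; lra. Qed.

Lemma cauchy_schwarz4 x y :
  (\sum_(i < 4) coord i x * coord i y) ^+ 2 <= sqnorm x * sqnorm y.
Proof.
case: x => [[[x0 x1] x2] x3]; case: y => [[[y0 y1] y2] y3].
rewrite !sqnormE !big_ord_recr big_ord0 /= add0r -subr_ge0.
rewrite (_ : _ - _ = (x0 * y1 - x1 * y0) ^+ 2 + (x0 * y2 - x2 * y0) ^+ 2 + (x0 * y3 - x3 * y0) ^+ 2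
  + (x1 * y2 - x2 * y1) ^+ 2 + (x1 * y3 - x3 * y1) ^+ 2 + (x2 * y3 - x3 * y2) ^+ 2); last by rewrite /coord/=; ring.
by rewrite !addr_ge0// sqr_ge0.
Qed.

Lemma enorm_distC x y : enorm (x - y) = enorm (y - x).
Proof.
rewrite !enormE /sqnorm; congr Num.sqrt; apply: eq_bigr => i _.
by rewrite !coordB; ring.
Qed.

(** sqrt (s + a) is the Euclidean norm of (x, sqrt a) in R^5; this is its triangle
    inequality. *)
Lemma sqrt_sqdist_le x y :
  Num.sqrt (s x + a) <= Num.sqrt (s y + a) + enorm (x - y).
Proof.
have e0 : 0 <= enorm (x - y) by rewrite enormE sqrtr_ge0.
have q0 := sqrtr_ge0 (s y + a).
rewrite -(ler_pXn2r (n := 2)) ?nnegrE ?sqrtr_ge0 ?addr_ge0//.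
rewrite sqrrD enorm_sqr !sqr_sqrtr ?(ltW (sa0 _))//.
pose d := \sum_(i < 4) coord i y * coord i (x - y).
have E : s x = s y + d *+ 2 + sqnorm (x - y).
  rewrite /d /sqdist !subr0 /sqnorm -sumrMnl -!big_split/=; apply: eq_bigr => i _.
  by rewrite coordB; ring.
have dle : d <= Num.sqrt (s y + a) * enorm (x - y).
  have [d0|/ltW d0] := leP d 0; first by apply: le_trans d0 _; exact: mulr_ge0.
  rewrite -(ler_pXn2r (n := 2)) ?nnegrE ?mulr_ge0// exprMn enorm_sqr sqr_sqrtr ?(ltW (sa0 _))//.
  apply: le_trans (cauchy_schwarz4 _ _) _.
  by rewrite ler_wpM2r ?sqnorm_ge0// /sqdist subr0 lerDl ltW.
rewrite E addrAC lerD2r addrAC lerD2l ler_wMn2r//.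
Qed.

(** The profile is - log sqrt (s + a), and sqrt (s + a) is 1-Lipschitz and at least
    exp (- L). *)
Lemma log_profile_lipschitz x y :
  `|log_profile (s x) - log_profile (s y)| <= enorm (x - y) / eps.
Proof.
have half z : log_profile (s z) = - ln (Num.sqrt (s z + a)).
  have P0 : 0 < Num.sqrt (s z + a) by rewrite sqrtr_gt0.
  have := lnXn 2 P0; rewrite sqr_sqrtr ?(ltW (sa0 _))//.
  by rewrite /log_profile => ->; rewrite -[ln _ *+ 2]mulr_natl mulrA mulNr mul1r mulVf// mulN1r.
have one z w : log_profile (s z) - log_profile (s w) <= enorm (z - w) / eps.
  rewrite !half.
  set P := Num.sqrt (s z + a); set Q := Num.sqrt (s w + a).
  have P0 : 0 < P by rewrite sqrtr_gt0.
  have Q0 : 0 < Q by rewrite sqrtr_gt0.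
  have Pe : eps <= P.
    by rewrite -[leLHS]ger0_norm ?(ltW eps0)// -sqrtr_sqr ler_wsqrtr// lerDr sqdist_ge0.
  have QP : Q <= P + enorm (z - w).
    by rewrite enorm_distC; exact: sqrt_sqdist_le.
  have -> : - ln P - - ln Q = ln (Q / P) by rewrite ln_div ?posrE// opprK addrC.
  apply: (@le_trans _ _ (Q / P - 1)).
    rewrite -{1}(subrK 1 (Q / P)) addrC; apply: le_ln1Dx.
    by rewrite ltrBDr addNr divr_gt0.
  apply: (@le_trans _ _ (enorm (z - w) / P)).
    by rewrite lerBlDr ler_pdivrMr// mulrDl divfK ?gt_eqF// mul1r addrC.
  by rewrite ler_wpM2l ?lef_pV2 ?posrE// enormE sqrtr_ge0.
rewrite ler_norml one andbT lerNl opprB.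
by rewrite enorm_distC; exact: one.
Qed.

End log_profile.

(** * Test functions as elements of H^2_0 *)

Section test_functions_in_H20.
Context {R : realType}.
Notation B := (@unit_ball R).
Implicit Types phi : R4 R -> R.

Lemma L2norm_ae_eq0 (h : R4 R -> R) : inL2 B h ->
  {ae lebesgue4, forall x, B x -> h x = 0} -> L2norm B h = 0%E.
Proof. by move=> h2 h0; rewrite nL2E// nL2_ae_eq0. Qed.

(** A test function approximates itself; the zero function has null norm because its
    weak derivatives are unique. *)
Lemma test_function_inH20 phi : test_function B phi -> inH20 B phi.
Proof.
move=> tphi; have phi2 := test_function_inL2 tphi.
split; first by split=> // s _; exists (partials (rev s) phi); exact: test_function_weak_partial.
move=> eps eps0; exists phi => //.
have w0 s : L2norm B (weak_partial B s (phi \- phi)) = 0%E.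
  have wphi := test_function_weak_partial s tphi.
  have w := is_weak_partialB phi2 phi2 wphi wphi.
  have wp := weak_partialP (ex_intro _ _ w).
  apply: (L2norm_ae_eq0 wp.1); move: (is_weak_partial_unique wp w).
  by apply: (@filterS _ _ (ae_filter_ringOfSetsType lebesgue4)) => x hx Bx; rewrite hx// subrr.
have v0 : L2norm B (phi \- phi) = 0%E.
  apply: L2norm_ae_eq0; first exact: inL2B.
  by apply: aeW => x _ /=; rewrite subrr.
rewrite /H2norm v0 big1 => [|i _]; last by rewrite w0 expe2 mule0.
rewrite big1 => [|i _]; last by rewrite big1 => // j _; rewrite w0 expe2 mule0.
by rewrite expe2 mule0 !adde0 poweR0r ?lte_fin// invr_neq0.
Qed.

(** The weak Laplacian of a test function agrees almost everywhere with the classical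
    one. *)
Lemma nL2_laplacian_le phi (g : R4 R -> R) : test_function B phi -> inL2 B g ->
  (forall x, `|\sum_(i < 4) partials [:: i; i] phi x| <= `|g x|) ->
  nL2 (laplacian B phi) <= nL2 g.
Proof.
move=> tphi g2 le_g.
have dphi2 i : inL2 B (partials [:: i; i] phi).
  exact: test_function_inL2 (test_function_partials _ tphi).
have L2 := inL2_sum dphi2.
have lap2 := inL2_laplacian (test_function_inH20 tphi).
apply: (@le_trans _ _ (nL2 (fun x => \sum_(i < 4) partials [:: i; i] phi x))); last first.
  by have [] := inL2_le L2.1 g2 (fun x _ => le_g x).
have aeE i : {ae lebesgue4, forall x, B x -> weak_partial B [:: i; i] phi x = partials [:: i; i] phi x}.
  have w := test_function_weak_partial [:: i; i] tphi.
  exact: is_weak_partial_unique (weak_partialP (ex_intro _ _ w)) w.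
rewrite -(@ler_pXn2r _ 2)// ?nnegrE ?nL2_ge0// -lee_fin -!nL2_sqr//.
rewrite le_eqVlt; apply/orP; left; apply/eqP; apply: ae_eq_integral => //.
- exact: measurable_unit_ball.
- by apply: measurable_sqr; case: lap2.
- by apply: measurable_sqr; case: L2.
have : {ae lebesgue4, forall x, forall i, B x -> weak_partial B [:: i; i] phi x = partials [:: i; i] phi x}.
  exact: (@filter_forall _ _ _ _ (ae_filter_ringOfSetsType lebesgue4)) aeE.
apply: (@filterS _ _ (ae_filter_ringOfSetsType lebesgue4)) => x hx Bx.
by rewrite /laplacian (eq_bigr _ (fun i _ => hx i Bx)).
Qed.

(** The essential supremum sees the lower bound because cubes have positive measure. *)
Lemma Linfnorm_ge (u : R4 R -> R) (m r : R) : 0 < r -> cube r `<=` B ->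
  (forall x, cube r x -> m <= u x) -> (m%:E <= Linfnorm B u)%E.
Proof.
move=> r0 rB um.
have mu0 : (0 < lebesgue4 [set: M4 R])%E.
  apply: (@lt_le_trans _ _ (lebesgue4 (cube r))).
    by rewrite lebesgue4_cube ?(ltW r0)// lte_fin exprn_gt0// mulrn_wgt0.
  by apply: le_measure; rewrite ?inE//; exact: measurable_cube.
rewrite /Linfnorm unlock mu0 leNgt; apply/negP => lt_m.
have := ess_sup_ge lebesgue4 (fun x => `|(EFin \o (u \_ B)) x|%E).
case=> A [mA A0 sub].
have : (lebesgue4 (cube r) <= lebesgue4 A)%E.
  apply: le_measure; rewrite ?inE//; first exact: measurable_cube.
  move=> x xr; apply: sub => /= h.
  have := le_lt_trans h lt_m; rewrite lte_fin patchE mem_set; last exact: rB.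
  by apply/negP; rewrite -leNgt; apply: le_trans (ler_norm _); exact: um.
by rewrite A0 lebesgue4_cube ?(ltW r0)// lee_fin leNgt exprn_gt0// mulrn_wgt0.
Qed.

End test_functions_in_H20.

(** * The extremal family and sharpness *)

Section extremal.
Context {R : realType}.
Variables delta L : R.
Hypotheses (d0 : 0 < delta) (L2 : 2 <= L).
Notation B := (@unit_ball R).
Local Notation s := (sqdist (0 : R4 R)).
Local Notation eps := (expR (- L)).
Local Notation a := (eps ^+ 2).

Let L0 : 0 < L. Proof. exact: lt_le_trans L2. Qed.
Let eps0 : 0 < eps. Proof. exact: expR_gt0. Qed.
Let eps1 : eps < 1. Proof. by rewrite -[ltRHS]expR0 ltr_expR oppr_lt0. Qed.
Let a0 : 0 < a. Proof. exact: exprn_gt0. Qed.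
Let a1 : a < 1. Proof. by rewrite exprn_ilt1// ltW. Qed.
Let sE x : s x = sqnorm x. Proof. by rewrite /sqdist subr0. Qed.
Let sa0 x : 0 < s x + a. Proof. by rewrite ltr_wpDl// sqdist_ge0. Qed.

(** The ramp cuts off the negative values of the logarithm, so that the support stays
    inside B. *)
Definition extremal (x : R4 R) : R := ramp delta (log_profile L (s x)).

Lemma extremal_eq0 x : 1 - a < sqnorm x -> extremal x = 0.
Proof.
move=> x1; apply: ramp_le0 => //; apply: log_profile_le0.
by rewrite sE -lerBlDr ltW.
Qed.

Lemma extremal_out x : ~ B x -> extremal x = 0.
Proof.
move=> xB; apply: extremal_eq0; apply: (@lt_le_trans _ _ 1); first by rewrite ltrBlDr ltrDl.
by rewrite leNgt; apply/negP => /unit_ballP.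
Qed.

Lemma extremal_bound x : 0 <= extremal x <= L.
Proof.
rewrite ramp_ge0//= ramp_le ?(ltW L0)//.
by apply: log_profile_le => //; exact: sqdist_ge0.
Qed.

Lemma extremal_ge x : sqnorm x <= a -> L - 1 / 2 - 1 / delta <= extremal x.
Proof.
move=> xa; apply: le_trans (ramp_ge d0 _).
by rewrite [1 / delta]div1r lerD2r; apply: log_profile_ge => //; rewrite ?sE ?sqnorm_ge0.
Qed.

Lemma extremal_radial : radial extremal.
Proof. by move=> x y xy; rewrite /extremal !sE -!enorm_sqr xy. Qed.

Lemma elementary_extremal : elementary extremal.
Proof.
have el : elementary (fun x => log_profile L (s x)).
  apply: elem_mul; first exact: elem_cst.
  apply: elem_ln => //.
  by apply: elem_add; [exact: elementary_sqdist|exact: elem_cst].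
apply: elem_mul => //.
apply: elem_comp; first exact: smooth1_flat.
by apply: elem_mul => //; exact: elem_cst.
Qed.

Lemma test_function_extremal : test_function B extremal.
Proof.
apply: (test_function_elementary (r := 1 - a)) elementary_extremal _ extremal_eq0.
by rewrite ltrBlDr ltrDl.
Qed.

(** With l the profile and Q = 1 / (s + a), the Laplacian is
      ramp''(l) s Q^2 - 2 ramp'(l) (1 + a Q) Q,
    and s Q = 1 - a Q lies in [0, 1]. *)
Lemma laplacian_extremal_le x :
  `|\sum_(i < 4) partials [:: i; i] extremal x| <= `|(2 + 27 * delta) * bubble 0 a x|.
Proof.
pose l := log_profile L.
pose q (t : R) := (t + a)^-1.
have ta0 (t : R) : 0 <= t -> 0 < t + a by move=> t0; rewrite ltr_wpDl.
have dtD (t : R) : is_derive t 1 (fun t : R => t + a) 1.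
  by apply: (is_derive_eq (is_deriveD (is_derive_id t (1:R)) (is_derive_cst a t (1:R)))); rewrite addr0.
have dq (t : R) : 0 <= t -> is_derive t 1 q (- q t ^+ 2).
  move=> /ta0/lt0r_neq0 ta.
  have : is_derive t 1 (fun t : R => (t + a)^-1) (- (t + a) ^- 2).
    by apply: (is_derive_eq (is_deriveV (f := fun t : R => t + a) (x := t) ta (dtD t))); rewrite /GRing.scale/= mulr1.
  by rewrite /q exprVn.
have dl (t : R) : 0 <= t -> is_derive t 1 l (- (1 / 2) * q t).
  move=> /ta0 ta.
  have dln := is_derive1_comp (f := @ln R) (g := fun t : R => t + a) (is_derive1_ln ta) (dtD t).
  apply: (is_derive_eq (is_deriveZ (- (1 / 2)) dln)).
  by rewrite /GRing.scale/= mulr1.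
pose h1 (t : R) := - (1 / 2) * (ramp1 delta (l t) * q t).
pose h2 (t : R) := (1 / 4) * ramp2 delta (l t) * q t ^+ 2 + (1 / 2) * ramp1 delta (l t) * q t ^+ 2.
have dh (t : R) : 0 <= t -> is_derive t 1 (ramp delta \o l) (h1 t).
  move=> t0; apply: (is_derive_eq (is_derive1_comp (f := ramp delta) (g := l) (is_derive_ramp delta (l t)) (dl t t0))).
  by rewrite /h1; ring.
have dh1 (t : R) : 0 <= t -> is_derive t 1 h1 (h2 t).
  move=> t0; have d1 := is_derive1_comp (f := ramp1 delta) (g := l) (is_derive_ramp1 delta (l t)) (dl t t0).
  apply: (is_derive_eq (is_deriveZ (- (1 / 2)) (is_deriveM d1 (dq t t0)))).
  by rewrite /h2 /GRing.scale/=; field.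
rewrite (laplacian_radial 0 x dh dh1) /h1 /h2 /bubble -exprVn -/(q (s x)).
have q0 : 0 < q (s x) by rewrite invr_gt0.
have E : s x * q (s x) = 1 - a * q (s x).
  by apply/eqP; rewrite eq_sym subr_eq -mulrDl divff// gt_eqF.
have sq0 : 0 <= s x * q (s x) by rewrite mulr_ge0 ?sqdist_ge0// ltW.
have /andP[r10 r11] := ramp1_bound delta (l (s x)).
have /andP[r20 r2l] := ramp2_bound d0 (l (s x)).
move: sq0 E q0; move: (q (s x)) => Q sq0 E q0.
move: (ramp1 _ _) (ramp2 _ _) r10 r11 r20 r2l => r1 r2 r10 r11 r20 r2l.
have -> : 4 * s x * (1 / 4 * r2 * Q ^+ 2 + 1 / 2 * r1 * Q ^+ 2) + 8 * (- (1 / 2) * (r1 * Q))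
  = r2 * (s x * Q) * Q + 2 * r1 * (s x * Q) * Q - 4 * r1 * Q by field.
rewrite [`|_ * (_ + _)|]ger0_norm; last first.
  by rewrite mulr_ge0 ?addr_ge0 ?mulr_ge0 ?exprn_ge0 ?(ltW d0) ?(ltW q0) ?(ltW a0).
move: sq0; rewrite E; move: (expR (- L)) a0 => e e0 sq0.
move: (e ^+ 2) e0 sq0 => b b0 sq0.
have bq : 0 <= b * Q by rewrite mulr_ge0 ?ltW.
have -> : (2 + 27 * delta) * (Q + b * Q ^+ 2) = (2 + 27 * delta) * (1 + b * Q) * Q by ring.
(* Both terms in the bracket are nonnegative, so the larger bounds the difference. *)
have -> : r2 * (1 - b * Q) * Q + 2 * r1 * (1 - b * Q) * Q - 4 * r1 * Q =
  (r2 * (1 - b * Q) - 2 * r1 * (1 + b * Q)) * Q by ring.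
rewrite normrM [`|Q|]gtr0_norm// ler_pM2r//.
move: (b * Q) bq sq0 => w w0 w1; clear - w0 w1 r10 r11 r20 r2l d0.
move: delta d0 r2l => d dd r2l.
rewrite ler_norml; apply/andP; split; nra.
Qed.

Lemma nL2_laplacian_extremal :
  nL2 (laplacian B extremal) ^+ 2 <=
  (2 + 27 * delta) ^+ 2 * (16 + 2 * pi ^+ 2 + 2 * pi ^+ 2 * L).
Proof.
have bub2 : inL2 B (bubble 0 a) by apply: inL2_continuous; apply: smooth_continuous; exact: smooth_bubble.
have k0 : 0 <= 2 + 27 * delta by rewrite addr_ge0// mulr_ge0// ltW.
have le1 : nL2 (laplacian B extremal) <= nL2 (fun x => (2 + 27 * delta) * bubble 0 a x).
  apply: nL2_laplacian_le test_function_extremal _ laplacian_extremal_le.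
  exact: inL2Z.
apply: (@le_trans _ _ (nL2 (fun x => (2 + 27 * delta) * bubble 0 a x) ^+ 2)).
  by rewrite ler_pXn2r ?nnegrE ?nL2_ge0.
have -> : nL2 (fun x => (2 + 27 * delta) * bubble 0 a x) ^+ 2 = (2 + 27 * delta) ^+ 2 * nL2 (bubble 0 a) ^+ 2.
  apply: EFin_inj; rewrite -nL2_sqr; last exact: inL2Z.
  rewrite EFinM -nL2_sqr// -ge0_integralZl_EFin ?sqr_ge0//.
  - by apply: eq_integral => x _; rewrite exprMn EFinM.
  - exact: measurable_unit_ball.
  - by move=> x _; rewrite lee_fin sqr_ge0.
  - by apply: measurable_sqr; case: bub2.
rewrite ler_wpM2l ?sqr_ge0//.
apply: le_trans (nL2_bubble 0 a0 (ltW a1)) _.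
by rewrite lnXn// expRK mulNrn mulrN opprK -[L *+ 2]mulr_natl lerD2l mulrCA mulrA.
Qed.

(** Interpolation between the bounds 0 <= u <= L and the Lipschitz constant exp L: at
    distance at least exp (- L) the first one is used, below it the second. *)
Lemma extremal_holder (alpha : R) : 0 < alpha < 1 ->
  (holder_seminorm alpha extremal <= (L * expR (alpha * L))%:E)%E.
Proof.
move=> /andP[al0 al1]; apply: ge_ereal_sup => _ [x [y [xy ->]]]; rewrite lee_fin.
have e0 : 0 < enorm (x - y).
  by apply: lt_le_trans (norm_le_enorm _); rewrite normr_gt0 subr_eq0.
rewrite ler_pdivrMr ?powR_gt0//.
have -> : L * expR (alpha * L) * enorm (x - y) `^ alpha = L * (enorm (x - y) / eps) `^ alpha.
  rewrite powRM ?invr_ge0 ?(ltW e0) ?(ltW eps0)// -expRN opprK -mulrA; congr (_ * _).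
  by rewrite mulrC /powR [in RHS](gt_eqF (expR_gt0 _)) expRK.
have lip : `|extremal x - extremal y| <= enorm (x - y) / eps.
  exact: le_trans (ramp_lipschitz delta _ _) (log_profile_lipschitz L x y).
have [r1|r1] := leP 1 (enorm (x - y) / eps).
  apply: (@le_trans _ _ L).
    have /andP[x0 xL] := extremal_bound x; have /andP[y0 yL] := extremal_bound y.
    by rewrite ler_norml; apply/andP; split; lra.
  rewrite ler_peMr ?(ltW L0)//.
  have -> : 1 = 1 `^ alpha :> R by rewrite powR1.
  by apply: ge0_ler_powR => //; rewrite ?nnegrE ?(ltW al0)// (le_trans ler01).
apply: le_trans lip _.
have r0 : 0 < enorm (x - y) / eps by rewrite divr_gt0.
apply: (@le_trans _ _ ((enorm (x - y) / eps) `^ alpha)).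
  by rewrite -[leLHS]powRr1 ?(ltW r0)// ger_powR ?r0 ?(ltW r1) ?(ltW al1).
by rewrite ler_peMl ?powR_ge0// (le_trans _ L2)// ler1n.
Qed.

Lemma extremal_in (alpha : R) : 0 < alpha < 1 -> H20rad_holder alpha extremal.
Proof.
move=> al; split.
- exact: test_function_inH20 test_function_extremal.
- exact: extremal_radial.
- exact: extremal_out.
- exact: le_lt_trans (extremal_holder al) (ltry _).
Qed.

Lemma Linfnorm_extremal_ge : ((L - 1 / 2 - 1 / delta)%:E <= Linfnorm B extremal)%E.
Proof.
have small x : cube (eps / 2) x -> sqnorm x <= a.
  move=> /cubeP xe; rewrite /sqnorm.
  have h i : coord i x ^+ 2 <= (eps / 2) ^+ 2.
    rewrite -(real_normK (num_real (coord i x))) ler_pXn2r ?nnegrE ?divr_ge0 ?(ltW eps0)//.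
    exact: le_trans (ler_norm_coord _ _) xe.
  apply: le_trans (ler_sum _ (fun i _ => h i)) _.
  by rewrite sumr_const card_ord -[_ *+ 4]mulr_natl le_eqVlt; apply/orP; left; apply/eqP; field.
apply: (@Linfnorm_ge _ _ _ (eps / 2)); first by rewrite divr_gt0.
- by move=> x /small xa; apply/unit_ballP; exact: le_lt_trans xa a1.
- by move=> x /small; exact: extremal_ge.
Qed.

End extremal.

Theorem theorem1p3 (R : realType) (alpha : R) (halpha : 0 < alpha < 1) :
  (exists C : R, 0 < C /\
     log_inequality alpha (1 / (8 * pi ^+ 2 * alpha)) C) /\
  (forall lambda : R, lambda < 1 / (8 * pi ^+ 2 * alpha) ->
     ~ (exists C : R, 0 < C /\ log_inequality alpha lambda C)).
Proof.
split; first exact: log_inequality_holds.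
move=> lambda lt_l [C [C0 HC]].
have al0 : 0 < alpha by case/andP: halpha.
have k0 : 0 < 8 * pi ^+ 2 * alpha by rewrite !mulr_gt0 ?exprn_gt0 ?pi_gt0.
(* A positive constant above lambda: the argument needs lambda > 0, and the
   inequality only gets weaker as the constant increases. *)
pose lam := Num.max lambda (2^-1 / (8 * pi ^+ 2 * alpha)).
have lam0 : 0 < lam by rewrite lt_max divr_gt0 ?invr_gt0 ?orbT.
have lam1 : lam * (8 * pi ^+ 2 * alpha) < 1.
  rewrite -ltr_pdivlMr// gt_max lt_l/= ltr_pM2r ?invr_gt0//.
  by rewrite invf_lt1// ltr1n.
have [delta [L [d0 L2 mpos contra]]] := sharp_arith pi_sqr_ge4 halpha lam0 lam1 C0.
pose u := extremal delta L.
have hu : H20rad_holder alpha u by exact: extremal_in.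
have [hu1 _ u0 Hfin] := hu.
have [H0 _] := holderP al0 Hfin.
have u0m : L - 1 / 2 - 1 / delta <= u 0.
  apply: extremal_ge => //; rewrite /sqnorm big1 ?exprn_ge0 ?expR_ge0// => i _.
  by rewrite linear0 expr0n.
have m0 : 0 < L - 1 / 2 - 1 / delta by rewrite -addrA -opprD subr_gt0.
have unz : exists x, u x != 0 by exists 0; rewrite gt_eqF// (lt_le_trans m0).
apply: (contra (nL2 (laplacian unit_ball u)) (fine (holder_seminorm alpha u))) => //.
- have := extremal_holder d0 L2 halpha; rewrite -/u; case: (holder_seminorm alpha u) => [r||]//= _.
  by rewrite mulr_ge0 ?expR_ge0// (le_trans _ L2).
- exact: nL2_ge0.
- exact: nL2_laplacian_extremal.
- move=> eta eta01; apply: le_trans u0m _; apply: le_trans (ler_norm _) _.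
  exact: core_estimate.
have := HC u hu unz; rewrite /Nratio -/(nL2 (laplacian unit_ball u)).
have := Linfnorm_extremal_ge d0 L2; rewrite -/u.
move: (nL2 _) (nL2_ge0 (laplacian unit_ball u)) (fine _) H0 => D D0 H H0 Hm Hle.
apply: (@le_trans _ _ (lambda * D ^+ 2 * ln (expR 3 + C * (H / D) * Num.sqrt (ln (2 * expR 1 + H / D))))).
  rewrite -lee_fin; apply: le_trans Hle.
  by rewrite expr2 EFinM expe2 lee_pmul// lee_fin ltW.
have N0 : 0 <= H / D by rewrite divr_ge0.
rewrite ler_wpM2r//.
  apply: ln_ge0; apply: (@le_trans _ _ (expR 3)); first by rewrite -[leLHS]expR0 ler_expR.
  by rewrite lerDl; exact: (mulr_ge0 (mulr_ge0 (ltW C0) N0) (sqrtr_ge0 _)).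
by rewrite ler_wpM2r ?sqr_ge0// le_max lexx.
Qed.
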